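(* Let $f:\mathbb{R}^d\to\mathbb{R}$ be twice differentiable, $L$-smooth, $\mu$-strongly convex and $M$-strongly self-concordant. Let $1\le k<d$ and $\eta_0\ge1$, and run the faster randomized block BFGS method from $x_0\in\mathbb{R}^d$ and $\mathbf{L}_0,G_0\in\mathbb{R}^{d\times d}$, with $G_0$ symmetric positive definite, such that $$M\lambda(x_0)\le\frac{\ln2}{4}\cdot\frac{d-k}{\eta_0d^2},\qquad\nabla^2 f(x_0)\preceq G_0\preceq\eta_0\nabla^2 f(x_0),\qquad G_0^{-1}=\mathbf{L}_0^\top\mathbf{L}_0.$$ Then for all $t\ge0$, $$\mathbb{E}\left[\frac{\lambda(x_{t+1})}{\lambda(x_t)}\right]\le2d\eta_0\left(1-\frac{k}{d}\right)^t.$$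
   Context: Notation: $\preceq$ is the Loewner order on symmetric matrices; $\|\cdot\|$ is the Euclidean norm; $\|v\|_z=(v^\top\nabla^2 f(z)v)^{1/2}$. The scalar $L$ (smoothness constant) is unrelated to the matrices $\mathbf{L}_t$. Assumptions on $f$: $L$-smooth means $\|\nabla f(x)-\nabla f(y)\|\le L\|x-y\|$ for all $x,y$. $\mu$-strongly convex ($\mu>0$) means $f(\theta x+(1-\theta)y)\le\theta f(x)+(1-\theta)f(y)-\frac{\theta(1-\theta)\mu}{2}\|x-y\|^2$ for all $x,y$ and $\theta\in[0,1]$. $M$-strongly self-concordant ($M\ge0$) means $\nabla^2 f(y)-\nabla^2 f(x)\preceq M\|y-x\|_z\nabla^2 f(w)$ for all $x,y,z,w\in\mathbb{R}^d$. Local gradient norm: $\lambda(x)=\sqrt{\nabla f(x)^\top(\nabla^2 f(x))^{-1}\nabla f(x)}$. The ratio $\lambda(x_{t+1})/\lambda(x_t)$ is read as $0$ when $\lambda(x_t)=0$. Block BFGS update: for symmetric positive definite $A\preceq G$ in $\mathbb{R}^{d\times d}$ and full rank $U\in\mathbb{R}^{d\times k}$, $k\le d$, $$\text{BlockBFGS}(G,A,U)=G-GU(U^\top GU)^{-1}U^\top G+AU(U^\top AU)^{-1}U^\top A.$$ Scaling-matrix update: for $\mathbf{L},A\in\mathbb{R}^{d\times d}$, $U\in\mathbb{R}^{d\times k}$, with $W=U^\top\mathbf{L}A\mathbf{L}^\top U$, $$\text{UpdateL}(\mathbf{L},A,U)=\mathbf{L}+\big(U(U^\top U)^{-1/2}-\mathbf{L}A\mathbf{L}^\top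 U\,W^{-1/2}\big)W^{-1/2}U^\top\mathbf{L}.$$ Faster randomized block BFGS method: given (deterministic) $x_0,G_0,\mathbf{L}_0,k$, for $t=0,1,\dots$: $x_{t+1}=x_t-G_t^{-1}\nabla f(x_t)$; $r_t=\|x_{t+1}-x_t\|_{x_t}$; $\tilde G_t=(1+Mr_t)G_t$; $\tilde{\mathbf{L}}_t=\mathbf{L}_t/\sqrt{1+Mr_t}$; draw $U_t\in\mathbb{R}^{d\times k}$ with i.i.d. $\mathcal{N}(0,1)$ entries, independent across iterations; $G_{t+1}=\text{BlockBFGS}(\tilde G_t,\nabla^2 f(x_{t+1}),\tilde{\mathbf{L}}_t^\top U_t)$; $\mathbf{L}_{t+1}=\text{UpdateL}(\tilde{\mathbf{L}}_t,\nabla^2 f(x_{t+1}),U_t)$. The $U_t$ have full rank almost surely, so the method is defined almost surely. *)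

(* Defs.v *)
From HB Require Import structures.
From mathcomp Require Import all_boot all_order all_algebra.
From mathcomp Require Import all_classical all_reals all_analysis.

Set Implicit Arguments.
Unset Strict Implicit.
Unset Printing Implicit Defensive.

Import Order.TTheory GRing.Theory Num.Theory.
Import numFieldNormedType.Exports.

Local Open Scope classical_set_scope.
Local Open Scope ring_scope.

Section Matrices.
Context {R : realType}.

Definition qform n (A : 'M[R]_n) (v : 'cV[R]_n) : R := (v^T *m A *m v) 0 0.

Definition psdmx n (A : 'M[R]_n) : Prop :=
  A^T = A /\ forall v : 'cV[R]_n, 0 <= qform A v.

Definition pdmx n (A : 'M[R]_n) : Prop :=
  A^T = A /\ forall v : 'cV[R]_n, v != 0 -> 0 < qform A v.

Definition loewner_le n (A B : 'M[R]_n) : Prop := psdmx (B - A).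

(* The canonical norm `|v| on matrices is the sup norm. *)
Definition norm2 n (v : 'cV[R]_n) : R := Num.sqrt (\sum_i v i 0 ^+ 2).

(* The positive semidefinite square root, which exists and is unique when A is
   positive semidefinite; 0 if there is none. *)
Definition sqrtmx n (A : 'M[R]_n) : 'M[R]_n :=
  xget 0 [set S : 'M[R]_n | psdmx S /\ S *m S = A].

Definition invsqrtmx n (A : 'M[R]_n) : 'M[R]_n := invmx (sqrtmx A).

(* When U^T G U or U^T A U is singular, invmx is the identity function on it;
   this happens with probability 0 along the method below. *)
Definition block_bfgs d k (G A : 'M[R]_d) (U : 'M[R]_(d, k)) : 'M[R]_d :=
  G - G *m U *m invmx (U^T *m G *m U) *m U^T *m G
    + A *m U *m invmx (U^T *m A *m U) *m U^T *m A.

Definition update_scaling d k (L A : 'M[R]_d) (U : 'M[R]_(d, k)) : 'M[R]_d :=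
  let W := U^T *m L *m A *m L^T *m U in
  L + (U *m invsqrtmx (U^T *m U) - L *m A *m L^T *m U *m invsqrtmx W)
        *m invsqrtmx W *m U^T *m L.

End Matrices.

Section Objective.
Context {R : realType} {d : nat}.
Implicit Types (f : 'cV[R]_d -> R) (x v : 'cV[R]_d).

Definition grad f x : 'cV[R]_d := \col_i 'D_(delta_mx i 0) f x.

Definition hess f x : 'M[R]_d :=
  \matrix_(i, j) ('D_(delta_mx j 0) (grad f) x) i 0.

Definition twice_differentiable f : Prop :=
  (forall x, differentiable f x) /\ (forall x, differentiable (grad f) x).

Definition smooth f (L : R) : Prop :=
  forall x y, norm2 (grad f x - grad f y) <= L * norm2 (x - y).

Definition strongly_convex f (mu : R) : Prop :=
  0 < mu /\
  forall x y (theta : R), 0 <= theta <= 1 ->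
    f (theta *: x + (1 - theta) *: y) <=
      theta * f x + (1 - theta) * f y
        - theta * (1 - theta) * mu / 2 * norm2 (x - y) ^+ 2.

Definition local_norm f (z v : 'cV[R]_d) : R := Num.sqrt (qform (hess f z) v).

Definition strongly_self_concordant f (M : R) : Prop :=
  0 <= M /\
  forall x y z w,
    loewner_le (hess f y - hess f x) ((M * local_norm f z (y - x)) *: hess f w).

Definition local_grad_norm f x : R :=
  Num.sqrt (qform (invmx (hess f x)) (grad f x)).

End Objective.

Section Method.
Context {R : realType} {d k : nat}.

Record bfgs_state := BfgsState {
  state_x : 'cV[R]_d;
  state_G : 'M[R]_d;
  state_L : 'M[R]_d }.

Definition bfgs_step (f : 'cV[R]_d -> R) (M : R)
    (s : bfgs_state) (U : 'M[R]_(d, k)) : bfgs_state :=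
  let: BfgsState x G L := s in
  let x' := x - invmx G *m grad f x in
  let c := 1 + M * local_norm f x (x' - x) in
  let Gtilde := c *: G in
  let Ltilde := (Num.sqrt c)^-1 *: L in
  let A := hess f x' in
  BfgsState x' (block_bfgs Gtilde A (Ltilde^T *m U))
            (update_scaling Ltilde A U).

Fixpoint bfgs_run (f : 'cV[R]_d -> R) (M : R) (s0 : bfgs_state)
    (U : nat -> 'M[R]_(d, k)) (t : nat) : bfgs_state :=
  if t is t'.+1 then bfgs_step f M (bfgs_run f M s0 U t') (U t') else s0.

End Method.

Section Sampling.
Context {disp : measure_display} {T : measurableType disp} {R : realType}.
Context (P : probability T R).

Definition mutually_independent (I : eqType) (X : I -> {RV P >-> R}) : Prop :=
  forall (s : seq I) (B : I -> set R), uniq s ->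
    (forall i, measurable (B i)) ->
    P (\bigcap_(i in [set` s]) (X i @^-1` B i)) =
      (\prod_(i <- s) P (X i @^-1` B i))%E.

Definition iid_gaussian_matrices d k
    (U : nat -> 'I_d -> 'I_k -> {RV P >-> R}) : Prop :=
  (forall t i j (B : set R), measurable B ->
     distribution P (U t i j) B = normal_prob 0 1 B) /\
  mutually_independent (fun p : nat * 'I_d * 'I_k => U p.1.1 p.1.2 p.2).

Definition sample_mx d k (U : nat -> 'I_d -> 'I_k -> {RV P >-> R})
    (omega : T) (t : nat) : 'M[R]_(d, k) := \matrix_(i, j) U t i j omega.

(* As y / 0 = 0, this is 0 where local_grad_norm f x_t = 0. *)
Definition gradient_ratio d k (f : 'cV[R]_d -> R) (M : R)
    (x0 : 'cV[R]_d) (G0 L0 : 'M[R]_d)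
    (U : nat -> 'I_d -> 'I_k -> {RV P >-> R}) (t : nat) (omega : T) : R :=
  let x s := state_x (bfgs_run f M (BfgsState x0 G0 L0) (sample_mx U omega) s) in
  local_grad_norm f (x t.+1) / local_grad_norm f (x t).

End Sampling.

(* Main.v *)
(* Write A_t for the Hessian at x_t, m_t = M lambda(x_t), and measure the quality of G_t by
   gap_t = tr(A_t^-1 G_t) - d >= 0. A quasi-Newton step gives
   lambda(x_{t+1}) <= sqrt(1 + m_t) (gap_t + m_t) lambda(x_t), so the ratio is controlled by
   gap_t. The update preserves A_t <= G_t and G_t^-1 = L_t^T L_t, and with the scaled
   directions L_t^T U it satisfies
     gap_{t+1} = tr Q - tr(Q Pi) + k - d,   Pi = U (U^T U)^-1 U^T,
   where Q depends on U_0, ..., U_{t-1} only and tr Q <= (1 + m_t)^2 (gap_t + d).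
   The law of U_t is invariant under sign changes and exchanges of its rows. The former kill
   the off-diagonal terms of E tr(Q Pi) and the latter equalise the diagonal ones, so that
   E tr(Q Pi) = (k/d) E tr Q. Hence gap_t + 2 d m_t contracts in expectation by 1 - k/d, up to
   factors exp(O(m_t)) whose product stays bounded because m_t decreases geometrically. *)

Require Import Defs.
From HB Require Import structures.
From mathcomp Require Import all_boot all_order all_fingroup all_algebra.
From mathcomp Require Import all_classical all_reals all_analysis.
From mathcomp Require Import measurable_realfun.
From mathcomp Require Import ring lra.

Set Implicit Arguments.
Unset Strict Implicit.
Unset Printing Implicit Defensive.

Import Order.TTheory GRing.Theory Num.Theory.
Import numFieldNormedType.Exports.

Local Open Scope classical_set_scope.
Local Open Scope ring_scope.

(** * Symmetric matrices and block BFGS updates *)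

Section BilinearForms.
Context {R : realType}.

(** The factors exp(O(m_t)) can leave the expectation only if m_t, which is random, has a
    deterministic majorant. So a crude linear rate, valid on every path with injective blocks, is
    proved beforehand; it uses only G_t <= eta_t A_t. The symmetry argument needs transformations of
    the sample space, which an abstract probability space does not offer; the law of the blocks is
    therefore carried to the space of all families of entries, where sign flips and row swaps act
    and preserve it. On singular blocks [invmx] returns its argument and nothing is controlled, so
    expectations are integrals over the paths with invertible Gram matrices, a set of probability
    one that the row actions preserve. Independence of Q and U_t enters in one form only: acting on
    the rows of U_t does not change Q. Symmetry of the Hessian is drawn from Loewner comparisons,
    and measurability of the square roots, which are defined by choice, from an explicit convergent
    iteration. With ln 2 / 4 in the hypothesis the accumulated exponent stays below ln 2, whence the
    factor 2 of the bound. *)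

Definition bform n (A : 'M[R]_n) (u v : 'cV[R]_n) : R := (u^T *m A *m v) 0 0.

Lemma qformE n (A : 'M[R]_n) v : qform A v = bform A v v.
Proof. by []. Qed.

Lemma bformDl n (A : 'M[R]_n) u v w : bform A (u + v) w = bform A u w + bform A v w.
Proof. by rewrite /bform linearD /= !mulmxDl mxE. Qed.

Lemma bformDr n (A : 'M[R]_n) u v w : bform A w (u + v) = bform A w u + bform A w v.
Proof. by rewrite /bform mulmxDr mxE. Qed.

Lemma bformZl n (A : 'M[R]_n) c u v : bform A (c *: u) v = c * bform A u v.
Proof. by rewrite /bform linearZ /= -!scalemxAl mxE. Qed.

Lemma bformZr n (A : 'M[R]_n) c u v : bform A u (c *: v) = c * bform A u v.
Proof. by rewrite /bform -!scalemxAr mxE. Qed.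

Lemma bformNl n (A : 'M[R]_n) u v : bform A (- u) v = - bform A u v.
Proof. by rewrite -scaleN1r bformZl mulN1r. Qed.

Lemma bformNr n (A : 'M[R]_n) u v : bform A u (- v) = - bform A u v.
Proof. by rewrite -scaleN1r bformZr mulN1r. Qed.

Lemma bformC n (A : 'M[R]_n) u v : A^T = A -> bform A u v = bform A v u.
Proof.
move=> sA; rewrite /bform -[in RHS]trace_mx11 -mxtrace_tr !trmx_mul trmxK sA.
by rewrite trace_mx11 mulmxA.
Qed.

Lemma bform_addmx n (A B : 'M[R]_n) u v : bform (A + B) u v = bform A u v + bform B u v.
Proof. by rewrite /bform mulmxDr mulmxDl mxE. Qed.

Lemma bform_oppmx n (A : 'M[R]_n) u v : bform (- A) u v = - bform A u v.
Proof. by rewrite /bform mulmxN mulNmx mxE. Qed.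

Lemma bform_scalemx n c (A : 'M[R]_n) u v : bform (c *: A) u v = c * bform A u v.
Proof. by rewrite /bform -scalemxAr -scalemxAl mxE. Qed.

Lemma qform_addmx n (A B : 'M[R]_n) v : qform (A + B) v = qform A v + qform B v.
Proof. exact: bform_addmx. Qed.

Lemma qform_scalemx n c (A : 'M[R]_n) v : qform (c *: A) v = c * qform A v.
Proof. exact: bform_scalemx. Qed.

Lemma qform_submx n (A B : 'M[R]_n) v : qform (A - B) v = qform A v - qform B v.
Proof. by rewrite qform_addmx !qformE bform_oppmx. Qed.

Lemma qform_congr n m (A : 'M[R]_n) (B : 'M[R]_(n, m)) v :
  qform (B^T *m A *m B) v = qform A (B *m v).
Proof. by rewrite /qform trmx_mul !mulmxA. Qed.

Lemma bform1E n (u v : 'cV[R]_n) : bform 1%:M u v = \sum_i u i 0 * v i 0.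
Proof. by rewrite /bform mulmx1 mxE; apply: eq_bigr => i _; rewrite mxE. Qed.

Lemma bform_delta n (A : 'M[R]_n) i j : bform A (delta_mx i 0) (delta_mx j 0) = A i j.
Proof.
by rewrite /bform trmx_delta -rowE -colE !mxE.
Qed.

Lemma qformD n (A : 'M[R]_n) u v : A^T = A ->
  qform A (u + v) = qform A u + 2 * bform A u v + qform A v.
Proof.
move=> sA; rewrite !qformE !(bformDl, bformDr) (bformC v u sA); ring.
Qed.

Lemma qformZ n (A : 'M[R]_n) c v : qform A (c *: v) = c ^+ 2 * qform A v.
Proof. by rewrite !qformE bformZl bformZr mulrA expr2. Qed.

Lemma qformN n (A : 'M[R]_n) v : qform A (- v) = qform A v.
Proof. by rewrite !qformE bformNl bformNr opprK. Qed.

Lemma qform0 n (A : 'M[R]_n) : qform A 0 = 0.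
Proof. by rewrite /qform mulmx0 mxE. Qed.

Lemma norm2_sqr n (v : 'cV[R]_n) : norm2 v ^+ 2 = qform 1%:M v.
Proof.
rewrite /norm2 sqr_sqrtr ?sumr_ge0 // => [|i _]; last exact: sqr_ge0.
by rewrite qformE bform1E; apply: eq_bigr => i _; rewrite expr2.
Qed.

Lemma psdmx1 n : psdmx (1%:M : 'M[R]_n).
Proof.
split=> [|v]; first exact: trmx1.
by rewrite -norm2_sqr sqr_ge0.
Qed.

Lemma qform1_eq0 n (v : 'cV[R]_n) : qform 1%:M v = 0 -> v = 0.
Proof.
rewrite qformE bform1E => /eqP.
rewrite psumr_eq0 => [/allP h|i _]; last by rewrite -expr2 sqr_ge0.
apply/matrixP => i j; rewrite ord1 mxE.
by have := h i (mem_index_enum _); rewrite mulf_eq0 orbb => /eqP.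
Qed.

Lemma pdmx1 n : pdmx (1%:M : 'M[R]_n).
Proof.
split=> [|v v0]; first exact: trmx1.
rewrite lt_neqAle (psdmx1 n).2 andbT eq_sym; apply: contra v0 => /eqP h.
by apply/eqP/qform1_eq0.
Qed.

Lemma pdmx_psd n (A : 'M[R]_n) : pdmx A -> psdmx A.
Proof.
move=> [sA pA]; split=> // v; have [->|v0] := eqVneq v 0; last exact/ltW/pA.
by rewrite qform0.
Qed.

Lemma cauchy_schwarz n (A : 'M[R]_n) u v : psdmx A ->
  bform A u v ^+ 2 <= qform A u * qform A v.
Proof.
move=> [sA pA].
have key x y : 0 <= qform A y * (qform A y * qform A x - bform A x y ^+ 2).
  have := pA (qform A y *: x + (- bform A x y) *: y).
  rewrite qformD // !qformZ bformZl bformZr; congr (0 <= _).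
  rewrite sqrrN; ring.
have pu := pA u; have pv := pA v.
have [v0|v0] := eqVneq (qform A v) 0; last first.
  have vp : 0 < qform A v by rewrite lt_neqAle eq_sym v0.
  by have := key u v; rewrite pmulr_rge0 // subr_ge0 mulrC.
have [u0|u0] := eqVneq (qform A u) 0; last first.
  have vp : 0 < qform A u by rewrite lt_neqAle eq_sym u0.
  by have := key v u; rewrite pmulr_rge0 // subr_ge0 (bformC _ _ sA).
(* Both quadratic values vanish here and [key] says nothing; with b the bilinear value, testing u -
   b v gives - 2 b^2 >= 0. *)
have := pA (u - bform A u v *: v).
rewrite qformD // qformN qformZ bformNr bformZr u0 v0 !mulr0 !add0r addr0.
by rewrite expr2; lra.
Qed.

Lemma psdmx_qform0 n (A : 'M[R]_n) v : psdmx A -> qform A v = 0 -> A *m v = 0.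
Proof.
move=> pA q0; have := cauchy_schwarz (A *m v) v pA.
rewrite q0 mulr0 => h.
have : bform A (A *m v) v = 0.
  by apply/eqP; rewrite -sqrf_eq0; rewrite eq_le h sqr_ge0.
rewrite /bform -mulmxA => h2; apply: qform1_eq0.
by rewrite /qform mulmx1.
Qed.

Lemma psdmxD n (A B : 'M[R]_n) : psdmx A -> psdmx B -> psdmx (A + B).
Proof.
move=> [sA pA] [sB pB]; split=> [|v]; first by rewrite linearD /= sA sB.
by rewrite qform_addmx addr_ge0.
Qed.

Lemma psdmxZ n c (A : 'M[R]_n) : 0 <= c -> psdmx A -> psdmx (c *: A).
Proof.
move=> c0 [sA pA]; split=> [|v]; first by rewrite linearZ /= sA.
by rewrite qform_scalemx mulr_ge0.
Qed.

Lemma pdmxZ n c (A : 'M[R]_n) : 0 < c -> pdmx A -> pdmx (c *: A).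
Proof.
move=> c0 [sA pA]; split=> [|v v0]; first by rewrite linearZ /= sA.
by rewrite qform_scalemx mulr_gt0 ?pA.
Qed.

Lemma psdmx_congr n m (A : 'M[R]_n) (B : 'M[R]_(n, m)) :
  psdmx A -> psdmx (B^T *m A *m B).
Proof.
move=> [sA pA]; split=> [|v]; first by rewrite !trmx_mul trmxK sA mulmxA.
by rewrite qform_congr.
Qed.

Lemma psdmx_tr_mul n m (B : 'M[R]_(n, m)) : psdmx (B^T *m B).
Proof. by rewrite -[B^T]mulmx1; apply: psdmx_congr; exact: psdmx1. Qed.

Lemma loewnerP n (A B : 'M[R]_n) : A^T = A -> B^T = B ->
  loewner_le A B <-> forall v, qform A v <= qform B v.
Proof.
move=> sA sB; split=> [[_ h] v|h].
  by have := h v; rewrite qform_submx subr_ge0.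
split=> [|v]; first by rewrite linearB /= sA sB.
by rewrite qform_submx subr_ge0.
Qed.

Lemma loewner_qform n (A B : 'M[R]_n) v : loewner_le A B -> qform A v <= qform B v.
Proof.
by move=> [_ h]; have := h v; rewrite qform_submx subr_ge0.
Qed.

Lemma psdmx_trace_ge0 n (A : 'M[R]_n) : psdmx A -> 0 <= \tr A.
Proof.
move=> [_ pA]; apply: sumr_ge0 => i _.
by rewrite -bform_delta; exact: pA.
Qed.

Lemma psdmx_trace_eq0 n (A : 'M[R]_n) : psdmx A -> \tr A = 0 -> A = 0.
Proof.
move=> [sA pA] t0.
have d0 i : qform A (delta_mx i 0) = 0.
  move/eqP: t0; rewrite psumr_eq0 => [/allP h|j _].
    by rewrite qformE bform_delta; apply/eqP/h; exact: mem_index_enum.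
  by rewrite -bform_delta; exact: pA.
apply/matrixP => i j; rewrite mxE -bform_delta /bform -mulmxA.
by rewrite psdmx_qform0 ?d0 // mulmx0 mxE.
Qed.

(** Cauchy-Schwarz for E at v and E v gives |E v|^4 <= E(v) E(E v) <= E(v) c |E v|^2, and |E v|^2
    cancels. In operator terms, E <= c implies E^2 <= c E. *)
Lemma psdmx_sqr_le n (E : 'M[R]_n) c v : psdmx E -> 
  (forall v, qform E v <= c * qform 1%:M v) ->
  qform 1%:M (E *m v) <= c * qform E v.
Proof.
move=> pE hE.
have := cauchy_schwarz v (E *m v) pE.
have -> : bform E v (E *m v) = qform 1%:M (E *m v).
  by rewrite -qform_congr mulmx1 pE.1 /bform /qform !mulmxA.
have h0 := (psdmx1 n).2 (E *m v); move: h0; set q := qform 1%:M _ => h0.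
have [->|q0] := eqVneq q 0; last first.
  have qp : 0 < q by rewrite lt_neqAle eq_sym q0.
  move=> /le_trans /(_ (ler_wpM2l (pE.2 v) (hE _))).
  by rewrite expr2 mulrCA mulrA ler_pM2r.
have [v0|v0] := eqVneq v 0; first by rewrite v0 qform0 mulr0.
have vp := (pdmx1 n).2 _ v0.
move=> _; apply: mulr_ge0; last exact: pE.2.
by have := le_trans (pE.2 v) (hE v); rewrite pmulr_lge0.
Qed.

Lemma mul_tr_eq0 n m (B : 'M[R]_(n, m)) : B^T *m B = 0 -> B = 0.
Proof.
move=> e; apply/matrixP => i j.
have := qform_congr 1%:M B (delta_mx j 0).
rewrite mulmx1 e /= [X in X = _ -> _]/qform mulmx0 mul0mx [X in X = _ -> _]mxE.
by move=> /esym/qform1_eq0; rewrite -colE => /matrixP /(_ i 0); rewrite !mxE.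
Qed.

(** With D = S - T, S D + D T = S^2 - T^2 = 0, so D S D and D T D have opposite traces; both are
    nonnegative, hence zero. Then S D = T D = 0, so D^2 = 0, and D = 0 by symmetry. *)
Lemma psdmx_sqrt_unique n (S T : 'M[R]_n) : psdmx S -> psdmx T ->
  S *m S = T *m T -> S = T.
Proof.
move=> pS pT e; pose D := S - T.
have sD : D^T = D by rewrite /D linearB /= pS.1 pT.1.
have h : S *m D = - (D *m T).
  by rewrite /D mulmxBr mulmxBl e opprB.
have pDS := psdmx_congr D pS; have pDT := psdmx_congr D pT.
have st : \tr (D^T *m S *m D) + \tr (D^T *m T *m D) = 0.
  rewrite -[D^T *m S *m D]mulmxA h mulmxN raddfN sD.
  by rewrite [\tr (D *m T *m D)]mxtrace_mulC addNr.
have tS0 : \tr (D^T *m S *m D) = 0.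
  have := psdmx_trace_ge0 pDS; have := psdmx_trace_ge0 pDT; lra.
have tT0 : \tr (D^T *m T *m D) = 0 by rewrite tS0 add0r in st.
have ker (Z : 'M[R]_n) : psdmx Z -> \tr (D^T *m Z *m D) = 0 -> Z *m D = 0.
  move=> pZ t0; apply/matrixP => i j; have := psdmx_trace_eq0 (psdmx_congr D pZ) t0.
  move=> /(congr1 (fun M => qform M (delta_mx j 0))).
  rewrite qform_congr /= [X in _ = X -> _]/qform mulmx0 mul0mx [X in _ = X -> _]mxE.
  move=> /(psdmx_qform0 pZ); rewrite mulmxA -colE => /matrixP /(_ i 0).
  by rewrite !mxE.
have DD : D *m D = 0.
  have -> : D *m D = S *m D - T *m D by rewrite -mulmxBl.
  by rewrite (ker S) // (ker T) // subr0.
apply/eqP; rewrite -subr_eq0 -/D; apply/eqP.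
by apply: mul_tr_eq0; rewrite sD.
Qed.

Lemma sqrtmx_eq n (S : 'M[R]_n) : psdmx S -> sqrtmx (S *m S) = S.
Proof.
move=> pS; rewrite /sqrtmx; case: xgetP => [T _ [pT eT]|/(_ S) []//].
exact: psdmx_sqrt_unique.
Qed.

(** Polynomials in [B] with nonnegative coefficients. They commute, are stable under products and
    are positive semidefinite along with [B]; this replaces diagonalisation in the construction of
    square roots. *)
Inductive pow_cone n (B : 'M[R]_n) : 'M[R]_n -> Prop :=
| PowCone0 : pow_cone B 0
| PowConeD i c M : 0 <= c -> pow_cone B M -> pow_cone B (c *: B ^+ i + M).

Lemma pow_coneD n (B M N : 'M[R]_n) : pow_cone B M -> pow_cone B N ->
  pow_cone B (M + N).
Proof.
move=> cM cN; elim: cM => [|i c M' c0 _ ih]; first by rewrite add0r.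
by rewrite -addrA; apply: PowConeD.
Qed.

Lemma pow_coneZ n (B M : 'M[R]_n) a : 0 <= a -> pow_cone B M -> pow_cone B (a *: M).
Proof.
move=> a0; elim=> [|i c M' c0 _ ih]; first by rewrite scaler0; exact: PowCone0.
by rewrite scalerDr scalerA; apply: PowConeD => //; exact: mulr_ge0.
Qed.

Lemma pow_coneM n (B M N : 'M[R]_n) : pow_cone B M -> pow_cone B N ->
  pow_cone B (M *m N).
Proof.
move=> cM cN; elim: cM => [|i c M' c0 _ ih]; first by rewrite mul0mx; exact: PowCone0.
rewrite mulmxDl; apply: pow_coneD => //; rewrite -scalemxAl; apply: pow_coneZ => //.
elim: cN => [|j b N' b0 _ ihN]; first by rewrite mulmx0; exact: PowCone0.
by rewrite mulmxDr -scalemxAr mulmxE -exprD; exact: PowConeD.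
Qed.

Lemma pow_cone_comm n (B M N : 'M[R]_n) : pow_cone B M -> pow_cone B N ->
  M *m N = N *m M.
Proof.
move=> cM cN; elim: cM => [|i c M' _ _ ih]; first by rewrite mul0mx mulmx0.
rewrite mulmxDl mulmxDr ih; congr (_ + _); rewrite -scalemxAl -scalemxAr; congr (_ *: _).
elim: cN => [|j b N' _ _ ihN]; first by rewrite mul0mx mulmx0.
rewrite mulmxDl mulmxDr ihN; congr (_ + _); rewrite -scalemxAl -scalemxAr.
by rewrite !mulmxE -!exprD addnC.
Qed.

Lemma psdmx0 n : psdmx (0 : 'M[R]_n).
Proof. by split=> [|v]; rewrite ?trmx0 // /qform mulmx0 mul0mx mxE. Qed.

(** An even power is the square of a symmetric matrix, an odd one is a congruence B^j B B^j. *)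
Lemma psdmxX n (B : 'M[R]_n) i : psdmx B -> psdmx (B ^+ i).
Proof.
move=> pB.
have sX j : (B ^+ j)^T = B ^+ j.
  elim: j => [|j ih]; first by rewrite expr0 trmx1.
  by rewrite [in LHS]exprS -mulmxE trmx_mul ih pB.1 mulmxE -exprSr.
rewrite -(odd_double_half i) -addnn; case: (odd i) => /=.
  have := psdmx_congr (B ^+ i./2) pB; rewrite sX !mulmxE -exprSr -exprD.
  by rewrite addSn add1n.
have := psdmx_tr_mul (B ^+ i./2); by rewrite sX mulmxE -exprD.
Qed.

Lemma pow_cone_psd n (B M : 'M[R]_n) : psdmx B -> pow_cone B M -> psdmx M.
Proof.
move=> pB; elim=> [|i c N c0 _ ih]; first exact: psdmx0.
by apply: psdmxD => //; apply: psdmxZ => //; exact: psdmxX.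
Qed.

(* [sqrt_iter B] increases to the matrix Z with (1 - Z)^2 = 1 - B; its increments are
   polynomials in B with nonnegative coefficients, hence positive semidefinite. *)
Fixpoint sqrt_iter n (B : 'M[R]_n) j : 'M[R]_n :=
  if j is j'.+1 then 2^-1 *: (B + sqrt_iter B j' *m sqrt_iter B j') else 0.

Lemma pow_cone_id n (B : 'M[R]_n) : pow_cone B B.
Proof.
have := @PowConeD n B 1 1 _ ler01 (PowCone0 B).
by rewrite scale1r addr0 expr1.
Qed.

Lemma sqrt_iter_cone n (B : 'M[R]_n) j : pow_cone B (sqrt_iter B j).
Proof.
elim: j => [|j ih] /=; first exact: PowCone0.
apply: pow_coneZ; first by rewrite invr_ge0.
by apply: pow_coneD; [exact: pow_cone_id|exact: pow_coneM].
Qed.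

Lemma sqrt_iter_incr_cone n (B : 'M[R]_n) j :
  pow_cone B (sqrt_iter B j.+1 - sqrt_iter B j).
Proof.
elim: j => [|j ih]; first by rewrite subr0; exact: (sqrt_iter_cone B 1).
set Y := sqrt_iter B j.+1 in ih *; set Z := sqrt_iter B j in ih.
(* Since [Y] and [Z] commute, Y^2 - Z^2 = (Y - Z)(Y + Z), so nonnegative coefficients pass from one
   increment to the next. *)
have -> : sqrt_iter B j.+2 - Y = 2^-1 *: ((Y - Z) *m (Y + Z)).
  rewrite {2}/Y /= -/Y -/Z -scalerBr opprD addrACA subrr add0r; congr (_ *: _).
  rewrite mulmxBl !mulmxDr (pow_cone_comm (sqrt_iter_cone B j) (sqrt_iter_cone B j.+1)).
  by rewrite -/Y -/Z opprD addrA addrK.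
apply: pow_coneZ; first by rewrite invr_ge0.
by apply: pow_coneM => //; apply: pow_coneD; exact: sqrt_iter_cone.
Qed.

(** If 0 <= Z <= 1 then Z^2 <= Z <= 1 by [psdmx_sqr_le], and the mean of B and Z^2 stays below 1. *)
Lemma sqrt_iter_le n (B : 'M[R]_n) j v : psdmx B ->
  (forall v, qform B v <= qform 1%:M v) -> qform (sqrt_iter B j) v <= qform 1%:M v.
Proof.
move=> pB hB; elim: j v => [|j ih] v /=.
  by rewrite [X in X <= _]/qform mulmx0 mul0mx [X in X <= _]mxE; exact: (psdmx1 n).2.
have pZ := pow_cone_psd pB (sqrt_iter_cone B j).
rewrite qform_scalemx qform_addmx.
have -> : qform (sqrt_iter B j *m sqrt_iter B j) v = qform 1%:M (sqrt_iter B j *m v).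
  by rewrite -qform_congr mulmx1 pZ.1.
have := @psdmx_sqr_le n _ 1 v pZ; rewrite mul1r.
have h w : qform (sqrt_iter B j) w <= 1 * qform 1%:M w by rewrite mul1r.
by move=> /(_ h); have := ih v; have := hB v; lra.
Qed.

Lemma symmx_entry n (A : 'M[R]_n) i j : A^T = A ->
  A i j = 2^-1 * (qform A (delta_mx i 0 + delta_mx j 0) - qform A (delta_mx i 0)
     - qform A (delta_mx j 0)).
Proof. by move=> sA; rewrite qformD // bform_delta; field. Qed.

(** Every quadratic form of the iterates is nondecreasing and bounded, hence convergent;
    polarisation recovers an entry from three of them. *)
Lemma sqrt_iter_cvg n (B : 'M[R]_n) i j : psdmx B ->
  (forall v, qform B v <= qform 1%:M v) ->
  cvgn (fun m => sqrt_iter B m i j).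
Proof.
move=> pB hB.
have cq v : cvgn (fun m => qform (sqrt_iter B m) v).
  apply: nondecreasing_is_cvgn.
    apply/nondecreasing_seqP => m; rewrite -subr_ge0 -qform_submx.
    exact: (pow_cone_psd pB (sqrt_iter_incr_cone B m)).2.
  by exists (qform 1%:M v) => _ [m _ <-]; exact: sqrt_iter_le.
rewrite (_ : (fun m => _) = fun m => 2^-1 * (qform (sqrt_iter B m) (delta_mx i 0 + delta_mx j 0)
   - qform (sqrt_iter B m) (delta_mx i 0) - qform (sqrt_iter B m) (delta_mx j 0))); last first.
  apply/funext => m; apply: symmx_entry.
  exact: (pow_cone_psd pB (sqrt_iter_cone B m)).1.
apply: is_cvgMr; apply: is_cvgB; last exact: cq.
by apply: is_cvgB; exact: cq.
Qed.

Definition mx_cvg n m (u : nat -> 'M[R]_(n, m)) (A : 'M[R]_(n, m)) :=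
  forall i j, (fun p => u p i j) @ \oo --> A i j.

Lemma mx_cvgM n m p (u : nat -> 'M[R]_(n, m)) (v : nat -> 'M[R]_(m, p)) A B :
  mx_cvg u A -> mx_cvg v B -> mx_cvg (fun q => u q *m v q) (A *m B).
Proof.
move=> cu cv i j; rewrite mxE.
rewrite (_ : (fun q => _) = (fun q => \sum_k u q i k * v q k j)); last first.
  by apply/funext => q; rewrite mxE.
apply: (@cvg_big _ _ _ _ _ _ _ _ _ (fun k q => u q i k * v q k j)) => [|k _]; first exact: add_continuous.
by apply: cvgM; [exact: cu|exact: cv].
Qed.

Lemma mx_cvgD n m (u v : nat -> 'M[R]_(n, m)) A B :
  mx_cvg u A -> mx_cvg v B -> mx_cvg (fun q => u q + v q) (A + B).
Proof.
move=> cu cv i j; rewrite mxE.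
rewrite (_ : (fun q => _) = (fun q => u q i j + v q i j)); last first.
  by apply/funext => q; rewrite mxE.
by apply: cvgD; [exact: cu|exact: cv].
Qed.

Lemma mx_cvgZ n m c (u : nat -> 'M[R]_(n, m)) A :
  mx_cvg u A -> mx_cvg (fun q => c *: u q) (c *: A).
Proof.
move=> cu i j; rewrite mxE.
rewrite (_ : (fun q => _) = (fun q => c * u q i j)); last first.
  by apply/funext => q; rewrite mxE.
by apply: cvgMr; exact: cu.
Qed.

Lemma mx_cvg_cst n m (A : 'M[R]_(n, m)) : mx_cvg (fun=> A) A.
Proof. by move=> i j; exact: cvg_cst. Qed.

Lemma mx_cvg_uniq n m (u : nat -> 'M[R]_(n, m)) A B :
  mx_cvg u A -> mx_cvg u B -> A = B.
Proof.
move=> cA cB; apply/matrixP => i j.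
exact: (cvg_unique (@Rhausdorff R) (cA i j) (cB i j)).
Qed.

Lemma mx_cvg_qform n (u : nat -> 'M[R]_n) A v :
  mx_cvg u A -> (fun p => qform (u p) v) @ \oo --> qform A v.
Proof.
move=> cA; have c1 := mx_cvgM (mx_cvgM (@mx_cvg_cst _ _ v^T) cA) (@mx_cvg_cst _ _ v).
exact: c1.
Qed.

Lemma psdmx_lim n (u : nat -> 'M[R]_n) A : (forall p, psdmx (u p)) -> mx_cvg u A ->
  psdmx A.
Proof.
move=> pu cu; split=> [|v].
  apply: (mx_cvg_uniq _ cu) => i j; rewrite mxE.
  rewrite (_ : (fun p => _) = (fun p => u p j i)); first exact: cu.
  by apply/funext => p; rewrite -[in LHS](pu p).1 mxE.
have c := mx_cvg_qform (v := v) cu.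
rewrite -(cvg_lim (@Rhausdorff R) c); apply: limr_ge; first by apply/cvg_ex; exists (qform A v).
by near=> p; exact: (pu p).2.
Unshelve. all: by end_near. Qed.

Lemma sqrt_iter_spec n (B : 'M[R]_n) : psdmx B ->
  (forall v, qform B v <= qform 1%:M v) ->
  exists Z, [/\ mx_cvg (sqrt_iter B) Z, psdmx (1%:M - Z) &
    (1%:M - Z) *m (1%:M - Z) = 1%:M - B].
Proof.
move=> pB hB.
pose Z := \matrix_(i, j) lim ((fun m => sqrt_iter B m i j) @ \oo).
have cZ : mx_cvg (sqrt_iter B) Z.
  by move=> i j; rewrite mxE; exact: sqrt_iter_cvg.
exists Z; split=> //.
  have h p : psdmx (1%:M + (-1) *: sqrt_iter B p).
    have pZ := pow_cone_psd pB (sqrt_iter_cone B p).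
    rewrite scaleN1r; split=> [|v]; first by rewrite linearB /= trmx1 pZ.1.
    by rewrite qform_submx subr_ge0; exact: sqrt_iter_le.
  have := psdmx_lim h (mx_cvgD (@mx_cvg_cst _ _ _) (@mx_cvgZ _ _ (-1) _ _ cZ)).
  by rewrite scaleN1r.
have e : Z = 2^-1 *: (B + Z *m Z).
  apply: (@mx_cvg_uniq _ _ (fun m => sqrt_iter B m.+1)).
    by move=> i j; have := cZ i j; rewrite -cvg_shiftS.
  by apply: mx_cvgZ; apply: mx_cvgD; [exact: mx_cvg_cst|exact: mx_cvgM].
have e2 : Z *m Z = 2 *: Z - B.
  rewrite [in RHS]e scalerA divff ?pnatr_eq0 // scale1r addrC addKr //.
rewrite mulmxBr mulmxBl mul1mx mulmx1 mulmxBl mul1mx e2 scaler_nat mulr2n.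
by apply/matrixP => i j; rewrite !mxE; ring.
Qed.

(** An explicit bound on the quadratic form of A over unit vectors; the added 1 keeps it positive
    for A = 0, so that A can be divided by it. *)
Definition abs_sum n (A : 'M[R]_n) : R := 1 + \sum_i \sum_j `|A i j|.

Lemma abs_sum_gt0 n (A : 'M[R]_n) : 0 < abs_sum A.
Proof.
by rewrite ltr_pwDl // sumr_ge0 // => i _; rewrite sumr_ge0.
Qed.

Lemma qform_le_abs_sum n (A : 'M[R]_n) v : qform A v <= abs_sum A * qform 1%:M v.
Proof.
have e : qform A v = \sum_i \sum_j v i 0 * A i j * v j 0.
  rewrite /qform -mulmxA mxE; apply: eq_bigr => i _; rewrite !mxE mulr_sumr.
  by apply: eq_bigr => j _; rewrite mulrA.
have sq i : v i 0 ^+ 2 <= qform 1%:M v.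
  rewrite qformE bform1E (bigD1 i) //= -expr2 lerDl sumr_ge0 // => j _.
  by rewrite -expr2 sqr_ge0.
rewrite e mulrDl mul1r; apply: ler_wpDl; first exact: (psdmx1 n).2.
rewrite mulr_suml; apply: ler_sum => i _; rewrite mulr_suml; apply: ler_sum => j _.
apply: le_trans (ler_norm _) _; rewrite !normrM mulrAC [leLHS]mulrC.
apply: ler_wpM2l => //.
have nK (x : R) : x ^+ 2 = `|x| ^+ 2 by rewrite real_normK ?num_real.
have := sq i; have := sq j; rewrite (nK (v i 0)) (nK (v j 0)).
set a := `|v i 0|; set b := `|v j 0|; have := sqr_ge0 (a - b).
by nra.
Qed.

(** With c = [abs_sum A], the square root is sqrt c (1 - Z) where (1 - Z)^2 = A / c. The
    approximations are explicit in A, which gives the measurability of [sqrtmx], itself defined by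
    choice. *)
Definition sqrtmx_approx n (A : 'M[R]_n) m : 'M[R]_n :=
  Num.sqrt (abs_sum A) *: (1%:M + (-1) *: sqrt_iter (1%:M - (abs_sum A)^-1 *: A) m).

Lemma sqrtmx_spec n (A : 'M[R]_n) : psdmx A ->
  [/\ psdmx (sqrtmx A), sqrtmx A *m sqrtmx A = A &
      mx_cvg (sqrtmx_approx A) (sqrtmx A)].
Proof.
move=> pA; have c0 := abs_sum_gt0 A; set c := abs_sum A in c0.
set B := 1%:M - c^-1 *: A.
have pB : psdmx B.
  split=> [|v]; first by rewrite linearB linearZ /= trmx1 pA.1.
  rewrite qform_submx qform_scalemx subr_ge0 ler_pdivrMl //.
  exact: qform_le_abs_sum.
have hB v : qform B v <= qform 1%:M v.
  rewrite qform_submx qform_scalemx gerBl mulr_ge0 ?pA.2 //.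
  by rewrite invr_ge0 ltW.
have [Z [cZ pZ eZ]] := sqrt_iter_spec pB hB.
have e : (Num.sqrt c *: (1%:M - Z)) *m (Num.sqrt c *: (1%:M - Z)) = A.
  rewrite -scalemxAl -scalemxAr scalerA -expr2 sqr_sqrtr ?ltW // eZ /B opprB addrC subrK.
  by rewrite scalerA divff ?scale1r // gt_eqF.
have pS : psdmx (Num.sqrt c *: (1%:M - Z)) by apply: psdmxZ => //; exact: sqrtr_ge0.
have es : sqrtmx A = Num.sqrt c *: (1%:M - Z) by rewrite -[in LHS]e sqrtmx_eq.
rewrite es; split=> //.
apply: mx_cvgZ; rewrite -[- Z]scaleN1r.
apply: mx_cvgD; [exact: mx_cvg_cst|exact: mx_cvgZ].
Qed.

Lemma inj_unitmx n (A : 'M[R]_n) : (forall v : 'cV[R]_n, A *m v = 0 -> v = 0) ->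
  A \in unitmx.
Proof.
move=> h; rewrite -unitmx_tr -row_free_unit -kermx_eq0; apply/rowV0P => v /sub_kermxP e.
rewrite -[v]trmxK; have /h -> : A *m v^T = 0.
  by rewrite -[A]trmxK -trmx_mul e trmx0.
by rewrite trmx0.
Qed.

Lemma pdmx_unit n (A : 'M[R]_n) : pdmx A -> A \in unitmx.
Proof.
move=> [sA pA]; apply: inj_unitmx => v e; apply/eqP; apply/negPn/negP => /pA.
by rewrite /qform -mulmxA e mulmx0 mxE ltxx.
Qed.

Lemma invmx_sym n (A : 'M[R]_n) : A^T = A -> (invmx A)^T = invmx A.
Proof. by move=> sA; rewrite trmx_inv sA. Qed.

Lemma qform_inv n (A : 'M[R]_n) v : pdmx A -> qform (invmx A) v = qform A (invmx A *m v).
Proof.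
move=> pA; rewrite -qform_congr (invmx_sym pA.1) mulVmx ?mul1mx //.
exact: pdmx_unit.
Qed.

Lemma pdmx_inv n (A : 'M[R]_n) : pdmx A -> pdmx (invmx A).
Proof.
move=> pA; split=> [|v v0]; first exact: invmx_sym pA.1.
rewrite qform_inv //; apply: pA.2; apply: contra v0 => /eqP e.
by rewrite -[v](mulKVmx (pdmx_unit pA)) e mulmx0.
Qed.

Lemma pdmx_congr n m (A : 'M[R]_n) (B : 'M[R]_(n, m)) : pdmx A ->
  (forall v : 'cV[R]_m, B *m v = 0 -> v = 0) -> pdmx (B^T *m A *m B).
Proof.
move=> pA iB; split=> [|v v0]; first by rewrite !trmx_mul trmxK pA.1 mulmxA.
by rewrite qform_congr; apply: pA.2; apply: contra v0 => /eqP /iB ->.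
Qed.

Lemma psdmx_unit_pd n (A : 'M[R]_n) : psdmx A -> A \in unitmx -> pdmx A.
Proof.
move=> pA uA; split=> [|v v0]; first exact: pA.1.
rewrite lt_neqAle pA.2 andbT eq_sym; apply: contra v0 => /eqP /(psdmx_qform0 pA) e.
by rewrite -[v](mulKmx uA) e mulmx0.
Qed.

Lemma pdmx_loewner n (A B : 'M[R]_n) : pdmx A -> loewner_le A B -> pdmx B.
Proof.
move=> [sA pA] [sAB pAB]; have sB : B^T = B.
  by rewrite -[B](subrK A) linearD /= sAB sA.
split=> // v v0; apply: lt_le_trans (pA v v0) _.
by apply: loewner_qform.
Qed.

Lemma sqrtmx_pd n (W : 'M[R]_n) : pdmx W -> sqrtmx W \in unitmx.
Proof.
move=> pW; have [pS eS _] := sqrtmx_spec (pdmx_psd pW).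
have := pdmx_unit pW; rewrite -[X in X \in _ -> _]eS unitmx_mul => /andP[] //.
Qed.

Lemma invsqrtmx_spec n (W : 'M[R]_n) : pdmx W ->
  (invsqrtmx W)^T = invsqrtmx W /\ invsqrtmx W *m invsqrtmx W = invmx W.
Proof.
move=> pW; have [pS eS _] := sqrtmx_spec (pdmx_psd pW).
split; first by rewrite /invsqrtmx invmx_sym ?pS.1.
have uS := sqrtmx_pd pW.
rewrite -[in RHS]eS; apply: (can_inj (mulKmx (pdmx_unit pW))).
rewrite eS mulmxV ?(pdmx_unit pW) // -[X in X *m _]eS /invsqrtmx.
by rewrite -!mulmxA (mulmxA (sqrtmx W) (invmx _)) mulmxV // mul1mx mulmxV.
Qed.

Lemma trace_mul_ge0 n (A B : 'M[R]_n) : psdmx A -> psdmx B -> 0 <= \tr (A *m B).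
Proof.
move=> pA pB; have [pS eS _] := sqrtmx_spec pB.
rewrite -eS mulmxA mxtrace_mulC mulmxA -{1}pS.1; apply: psdmx_trace_ge0.
exact: psdmx_congr.
Qed.

(** With S the square root of E, E(v) = |S v|^2; Cauchy-Schwarz on coordinate i of S v gives the
    factor |S e_i|^2, and these add up to tr E. *)
Lemma qform_le_trace1 n (E : 'M[R]_n) v : psdmx E -> qform E v <= \tr E * qform 1%:M v.
Proof.
move=> pE; have [pS eS _] := sqrtmx_spec pE; set S := sqrtmx E in pS eS.
have -> : qform E v = qform 1%:M (S *m v) by rewrite -qform_congr mulmx1 pS.1 eS.
rewrite -eS /mxtrace mulr_suml [X in X <= _]qformE bform1E; apply: ler_sum => i _.
have -> : (S *m v) i 0 = bform 1%:M (S *m delta_mx i 0) v.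
  rewrite bform1E mxE; apply: eq_bigr => j _; rewrite -colE mxE.
  by rewrite -[in RHS]pS.1 mxE.
have -> : (S *m S) i i = qform 1%:M (S *m delta_mx i 0).
  by rewrite -qform_congr mulmx1 pS.1 qformE bform_delta.
by rewrite -expr2; apply: cauchy_schwarz; exact: psdmx1.
Qed.

(** The previous bound for S^-1 E S^-1 at S v, with S the square root of A. For E = G - H x it turns
    the trace gap into a Loewner bound. *)
Lemma qform_le_trace n (A E : 'M[R]_n) v : pdmx A -> psdmx E ->
  qform E v <= \tr (invmx A *m E) * qform A v.
Proof.
move=> pA pE; have [pS eS _] := sqrtmx_spec (pdmx_psd pA); set S := sqrtmx A in pS eS.
have uS : S \in unitmx by exact: sqrtmx_pd.
have sI : (invmx S)^T = invmx S by rewrite invmx_sym ?pS.1.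
have := qform_le_trace1 (S *m v) (psdmx_congr (invmx S) pE).
rewrite !qform_congr mulKmx // -qform_congr mulmx1 pS.1 eS.
rewrite sI mxtrace_mulC mulmxA.
have -> // : invmx S *m invmx S = invmx A.
apply: (can_inj (mulKmx (pdmx_unit pA))).
by rewrite mulmxV ?(pdmx_unit pA) // -eS -!mulmxA (mulmxA S (invmx _)) mulmxV // mul1mx mulmxV.
Qed.

(** With y = B^-1 x, the number b = x^T B^-1 x is the A-product of A^-1 x and y. Hence b^2 <= (x^T
    A^-1 x)(y^T A y), where y^T A y <= y^T B y = b. *)
Lemma loewner_inv n (A B : 'M[R]_n) : pdmx A -> loewner_le A B ->
  loewner_le (invmx B) (invmx A).
Proof.
move=> pA hAB; have pB := pdmx_loewner pA hAB.
have [pA' pB'] := (pdmx_inv pA, pdmx_inv pB).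
apply/(loewnerP pB'.1 pA'.1) => x.
set y := invmx B *m x.
have e1 : bform A (invmx A *m x) y = qform (invmx B) x.
  rewrite qformE /bform /y trmx_mul pA'.1 -!mulmxA; congr (_ 0 0); congr (_ *m _).
  by rewrite !mulmxA mulVmx ?mul1mx // pdmx_unit.
have e2 : qform B y = qform (invmx B) x by rewrite -qform_inv.
have := cauchy_schwarz (invmx A *m x) y (pdmx_psd pA).
rewrite e1 -qform_inv //.
have := loewner_qform y hAB; rewrite e2.
have := (pdmx_psd pB').2 x; have := (pdmx_psd pA').2 x; have := (pdmx_psd pA).2 y.
set a := qform (invmx A) x; set b := qform (invmx B) x; set c := qform A y.
move=> c0 a0 b0 cb h.
have h2 : b * b <= a * b by rewrite -expr2; apply: le_trans h _; exact: ler_wpM2l.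
have [->|b1] := eqVneq b 0; first by [].
by move: h2; rewrite ler_pM2r // lt_neqAle eq_sym b1.
Qed.

(** For w = (A + E)^-1 g, using the model A + E instead of A leaves at most the fraction h / (1 + h)
    of g in the norm of A^-1. If a, b, c are the values at w of A, E and E A^-1 E, then b <= h a, c
    <= h b, and g has squared norm a + 2 b + c. *)
Lemma newton_contract n (A E : 'M[R]_n) h w : pdmx A -> psdmx E -> 0 <= h ->
  (forall v, qform E v <= h * qform A v) ->
  qform A w <= qform (invmx A) ((A + E) *m w) /\
  (1 + h) ^+ 2 * qform (invmx A) (E *m w) <= h ^+ 2 * qform (invmx A) ((A + E) *m w).
Proof.
move=> pA pE h0 hE; have pA' := pdmx_inv pA.
have e1 : qform (invmx A) (A *m w) = qform A w.
  by rewrite qform_inv // mulKmx // pdmx_unit.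
have e2 : bform (invmx A) (A *m w) (E *m w) = qform E w.
  by rewrite /bform trmx_mul pA.1 -!mulmxA mulKVmx ?pdmx_unit // mulmxA.
have e3 : qform (invmx A) (E *m w) = bform E w (invmx A *m (E *m w)).
  by rewrite /qform /bform trmx_mul pE.1 !mulmxA.
have := cauchy_schwarz w (invmx A *m (E *m w)) pE; rewrite -e3.
have := hE (invmx A *m (E *m w)); rewrite -qform_inv //.
have := hE w; have := (pdmx_psd pA').2 (E *m w); have := pE.2 w.
have := (pdmx_psd pA).2 w.
rewrite mulmxDl qformD ?pA'.1 // e1 e2.
set a := qform A w; set b := qform E w; set c := qform (invmx A) (E *m w).
set e := qform E _ => a0 b0 c0 ba ec cs.
have cb : c <= h * b.
  have [->|c1] := eqVneq c 0; first exact: mulr_ge0.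
  have cp : 0 < c by rewrite lt_neqAle eq_sym c1.
  rewrite -(ler_pM2r cp) -expr2 (le_trans cs) //.
  have -> : h * b * c = b * (h * c) by ring.
  exact: ler_wpM2l.
split; first lra.
rewrite sqrrD expr1n !mul1r !mulrDl !mulrDr mul1r.
have : h * c <= h ^+ 2 * b by rewrite expr2 -mulrA ler_wpM2l.
have : h * b <= h * (h * a) by rewrite ler_wpM2l.
rewrite mulrA -expr2; nra.
Qed.

(** Completing the square in c: the minimiser is N^-1 U^T G v, and the first two terms are the
    minimum. *)
Lemma qform_proj n k (G : 'M[R]_n) (U : 'M[R]_(n, k)) (N : 'M[R]_k) v c :
  pdmx G -> pdmx N -> U^T *m G *m U = N ->
  qform G (v - U *m c) = qform G v - qform (invmx N) (U^T *m G *m v)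
     + qform N (c - invmx N *m (U^T *m G *m v)).
Proof.
move=> pG pN eN; set w := U^T *m G *m v.
rewrite !qformD ?pG.1 ?pN.1 // !qformN !bformNr -qform_inv //.
have -> : bform N c (invmx N *m w) = bform G v (U *m c).
  rewrite (bformC v) ?pG.1 // /bform -mulmxA mulKVmx ?pdmx_unit //.
  by rewrite /w trmx_mul !mulmxA.
have -> : qform G (U *m c) = qform N c by rewrite -qform_congr eN.
ring.
Qed.

Lemma qform_proj_min n k (G : 'M[R]_n) (U : 'M[R]_(n, k)) (N : 'M[R]_k) v c :
  pdmx G -> pdmx N -> U^T *m G *m U = N ->
  qform G (v - U *m (invmx N *m (U^T *m G *m v))) <= qform G (v - U *m c).
Proof.
move=> pG pN eN; rewrite !(qform_proj _ _ pG pN eN) lerD2l subrr qform0.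
exact: (pdmx_psd pN).2.
Qed.

(** * Loewner bounds through a block BFGS update *)

Section BlockBfgs.
Variables (n k : nat) (G A : 'M[R]_n) (U : 'M[R]_(n, k)) (N W : 'M[R]_k).
Hypotheses (pG : pdmx G) (pA : pdmx A) (pN : pdmx N) (pW : pdmx W).
Hypotheses (eN : U^T *m G *m U = N) (eW : U^T *m A *m U = W).

Lemma block_bfgs_sym : (block_bfgs G A U)^T = block_bfgs G A U.
Proof.
have h (B : 'M[R]_n) (X : 'M[R]_k) : B^T = B -> X^T = X ->
   (B *m U *m X *m U^T *m B)^T = B *m U *m X *m U^T *m B.
  by move=> sB sX; rewrite !trmx_mul trmxK sB sX !mulmxA.
rewrite /block_bfgs eN eW linearD linearB /= pG.1.
by rewrite (h G) ?(h A) ?pG.1 ?pA.1 // invmx_sym ?pN.1 ?pW.1.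
Qed.

(* [v - U *m a v] and [v - U *m b v] are the components of v that are orthogonal to the
   range of U for G and for A. *)
Let a (v : 'cV[R]_n) := invmx N *m (U^T *m G *m v).
Let b (v : 'cV[R]_n) := invmx W *m (U^T *m A *m v).

(** The G-part of the update keeps the squared G-distance from v to the range of U; the A-part
    restores the squared A-length of the A-projection of v on that range. *)
Lemma qform_block_bfgs v :
  qform (block_bfgs G A U) v = qform G (v - U *m a v) + qform A v - qform A (v - U *m b v).
Proof.
rewrite (qform_proj _ _ pG pN eN) (qform_proj _ _ pA pW eW) /a /b !subrr !qform0 !addr0.
rewrite /block_bfgs eN eW qform_addmx qform_submx.
have h (B : 'M[R]_n) (X : 'M[R]_k) : B^T = B ->
   qform (B *m U *m X *m U^T *m B) v = qform X (U^T *m B *m v).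
  by move=> sB; rewrite -qform_congr trmx_mul trmxK sB !mulmxA.
rewrite (h G) ?(h A) ?pG.1 ?pA.1 //; ring.
Qed.

(** The G-residual of v is at least as long for G as for A, and for A it is at least as long as the
    A-residual, which is the shortest. *)
Lemma block_bfgs_lower : loewner_le A G -> loewner_le A (block_bfgs G A U).
Proof.
move=> AG; apply/(loewnerP pA.1 block_bfgs_sym) => v; rewrite qform_block_bfgs.
have := loewner_qform (v - U *m a v) AG.
have := qform_proj_min v (a v) pA pW eW; rewrite -/(b v); lra.
Qed.

(** The G-residual is shortest for G, so its G-length is at most that of the A-residual, hence at
    most eta times the A-length of the latter. The excess eta - 1 is absorbed because the A-residual
    is no longer than v. *)
Lemma block_bfgs_upper eta : 1 <= eta -> loewner_le G (eta *: A) ->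
  loewner_le (block_bfgs G A U) (eta *: A).
Proof.
move=> eta1 GA; have sA : (eta *: A)^T = eta *: A by rewrite linearZ /= pA.1.
apply/(loewnerP block_bfgs_sym sA) => v; rewrite qform_block_bfgs.
have := qform_proj_min v (b v) pG pN eN; rewrite -/(a v).
have := loewner_qform (v - U *m b v) GA; rewrite !qform_scalemx.
have := qform_proj_min v 0 pA pW eW; rewrite -/(b v) mulmx0 subr0.
set q := qform A (v - _); set q' := qform A v.
have : 0 <= eta - 1 by lra.
move=> h1 h2 h3 h4; have : (eta - 1) * q <= (eta - 1) * q' by exact: ler_wpM2l.
lra.
Qed.

End BlockBfgs.

(** * Updates along scaled directions *)

Section ScaledBlockBfgs.
Variables (n k : nat) (G A L : 'M[R]_n) (V U : 'M[R]_(n, k)).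
Hypotheses (pG : pdmx G) (pA : pdmx A) (GL : invmx G = L^T *m L).
Hypothesis injV : forall v : 'cV[R]_k, V *m v = 0 -> v = 0.
Hypothesis eU : U = L^T *m V.

Lemma scaling_unit : L \in unitmx.
Proof.
have : invmx G \in unitmx by rewrite unitmx_inv pdmx_unit.
by rewrite GL unitmx_mul => /andP[].
Qed.

Lemma scaling_orth : L *m G *m L^T = 1%:M.
Proof.
apply: (can_inj (mulmxK scaling_unit)); rewrite mul1mx -!mulmxA -GL mulmxV ?mulmx1 //.
exact: pdmx_unit.
Qed.

Lemma scaled_inj (v : 'cV[R]_k) : U *m v = 0 -> v = 0.
Proof.
rewrite eU -mulmxA => e; apply: injV.
have uL : L^T \in unitmx by rewrite unitmx_tr scaling_unit.
by rewrite -[V *m v](mulKmx uL) e mulmx0.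
Qed.

(** The purpose of the scaled directions: this Gram matrix is free of [G], so that in the trace
    formula below the draw enters only through the projector of [V]. *)
Lemma scaled_gram : U^T *m G *m U = V^T *m V.
Proof.
rewrite eU trmx_mul trmxK.
have -> : V^T *m L *m G *m (L^T *m V) = V^T *m (L *m G *m L^T) *m V by rewrite !mulmxA.
by rewrite scaling_orth mulmx1.
Qed.

Lemma scaled_pdG : pdmx (V^T *m V).
Proof. by rewrite -scaled_gram; apply: pdmx_congr => //; exact: scaled_inj. Qed.

Lemma scaled_pdA : pdmx (U^T *m A *m U).
Proof. by apply: pdmx_congr => //; exact: scaled_inj. Qed.

Lemma update_scaling_inv :
  invmx (block_bfgs G A U) = (update_scaling L A V)^T *m update_scaling L A V.
Proof.
have pN := scaled_pdG; have pW := scaled_pdA; have eN := scaled_gram.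
have eW : V^T *m L *m A *m L^T *m V = U^T *m A *m U.
  by rewrite eU trmx_mul trmxK !mulmxA.
move: pN pW eW eN; move eV : (V^T *m V) => N; move eUW : (U^T *m A *m U) => W.
move=> pN pW eW eN.
have [sX XX] := invsqrtmx_spec pN; have [sY YY] := invsqrtmx_spec pW.
have uX : invsqrtmx N \in unitmx by rewrite unitmx_inv sqrtmx_pd.
have uW := pdmx_unit pW; have uN := pdmx_unit pN; have uG := pdmx_unit pG.
have sW : (invmx W)^T = invmx W by rewrite invmx_sym ?pW.1.
have eLV : V^T *m L = U^T by rewrite eU trmx_mul trmxK.
(* As U^T K = 0, the cross terms of the product below vanish and leave the inverse BFGS
   formula U W^-1 U^T + K^T G^-1 K. *)
pose K := 1%:M - A *m U *m invmx W *m U^T.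
have eL : update_scaling L A V = L *m K + V *m (invsqrtmx N *m invsqrtmx W *m U^T).
  rewrite /update_scaling eW eV -(mulmxA _ V^T) eLV -(mulmxA (L *m A)) -eU.
  rewrite /K mulmxBr mulmx1 -addrA; congr (_ + _).
  rewrite mulmxBl mulmxBl [LHS]addrC; congr (_ + _); last by rewrite !mulmxA.
  congr (- _).
  by rewrite -(mulmxA _ (invsqrtmx W) (invsqrtmx W)) YY !mulmxA.
have KU : K^T *m U = 0.
  have -> : K^T = 1%:M - U *m invmx W *m (U^T *m A).
    by rewrite /K linearB /= trmx1 !trmx_mul trmxK sW pA.1 !mulmxA.
  by rewrite mulmxBl mul1mx -(mulmxA _ (U^T *m A)) eUW -mulmxA mulVmx // mulmx1 subrr.
have UK : U^T *m K = 0 by rewrite -[LHS]trmxK trmx_mul trmxK KU trmx0.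
have eI : (update_scaling L A V)^T *m update_scaling L A V
    = U *m invmx W *m U^T + K^T *m invmx G *m K.
  rewrite eL; set Z := _ *m U^T.
  have -> : (L *m K + V *m Z)^T = K^T *m L^T + Z^T *m V^T.
    by rewrite linearD /= !trmx_mul.
  rewrite mulmxDl (mulmxDr (K^T *m L^T)) (mulmxDr (Z^T *m V^T)).
  have -> : K^T *m L^T *m (L *m K) = K^T *m invmx G *m K by rewrite GL !mulmxA.
  have -> : K^T *m L^T *m (V *m Z) = K^T *m (L^T *m V) *m Z by rewrite !mulmxA.
  have -> : Z^T *m V^T *m (L *m K) = Z^T *m (V^T *m L *m K) by rewrite !mulmxA.
  rewrite eLV UK -eU KU mulmx0 mul0mx addr0 add0r addrC; congr (_ + _).
  rewrite -(mulmxA Z^T) (mulmxA V^T) eV.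
  have -> : N *m Z = invmx (invsqrtmx N) *m (invsqrtmx W *m U^T).
    apply: (can_inj (mulKmx uX)); rewrite mulKVmx //.
    rewrite /Z -!mulmxA; apply: (can_inj (mulKmx uX)).
    rewrite (mulmxA (invsqrtmx N) (invsqrtmx N)) XX mulKmx //.
  rewrite /Z trmx_mul trmxK trmx_mul sX sY -!mulmxA (mulKVmx uX).
  by rewrite (mulmxA (invsqrtmx W)) YY.
(* The inverse BFGS formula is checked by multiplication: [K] kills the A-term of the update and
   fixes the remaining part, which U^T annihilates. *)
have e1 : K *m block_bfgs G A U = G - G *m U *m invmx N *m U^T *m G.
  rewrite /block_bfgs eN eUW mulmxDr.
  have -> : K *m (A *m U *m invmx W *m U^T *m A) = 0.
    have -> : K *m (A *m U *m invmx W *m U^T *m A) = K *m (A *m U) *m (invmx W *m U^T *m A).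
      by rewrite !mulmxA.
    suff -> : K *m (A *m U) = 0 by rewrite mul0mx.
    rewrite /K mulmxBl mul1mx -(mulmxA _ U^T) (mulmxA U^T) eUW -mulmxA mulVmx // mulmx1.
    by rewrite subrr.
  rewrite addr0 /K mulmxBl mul1mx.
  suff h : U^T *m (G - G *m U *m invmx N *m U^T *m G) = 0.
    by rewrite -(mulmxA (A *m U *m invmx W) U^T) h mulmx0 subr0.
  have -> : G *m U *m invmx N *m U^T *m G = G *m U *m (invmx N *m (U^T *m G)).
    by rewrite !mulmxA.
  by rewrite mulmxBr (mulmxA U^T) (mulmxA U^T) eN mulKVmx // subrr.
(* The block secant equation: the update agrees with A on the range of U. *)
have e2 : U^T *m block_bfgs G A U = U^T *m A.
  rewrite /block_bfgs eN eUW mulmxDr mulmxBr.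
  have h (B : 'M[R]_n) (X : 'M[R]_k) : U^T *m (B *m U *m X *m U^T *m B) =
    (U^T *m B *m U) *m (X *m (U^T *m B)) by rewrite !mulmxA.
  by rewrite !h eN eUW !mulKVmx // subrr add0r.
have e3 : K^T *m (1%:M - U *m (invmx N *m U^T *m G)) = K^T.
  by rewrite mulmxBr mulmx1 mulmxA KU mul0mx subr0.
have eB : (U *m invmx W *m U^T + K^T *m invmx G *m K) *m block_bfgs G A U = 1%:M.
  rewrite mulmxDl -(mulmxA _ U^T) e2 -(mulmxA _ K) e1.
  have -> : G - G *m U *m invmx N *m U^T *m G = G *m (1%:M - U *m (invmx N *m U^T *m G)).
    by rewrite mulmxBr mulmx1 !mulmxA.
  rewrite -(mulmxA K^T) (mulKmx uG) e3 /K linearB /= trmx1 !trmx_mul trmxK sW pA.1.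
  by rewrite !mulmxA addrC subrK.
have [_ uB] := mulmx1_unit eB.
by rewrite eI; apply: (can_inj (mulmxK uB)); rewrite mulVmx // eB.
Qed.

(** Cyclicity of the trace and V^T L = U^T turn the G-term into tr(Q Pi); the A-term reduces to the
    trace of the identity of size k. *)
Lemma block_bfgs_trace :
  let Q := L *m G *m invmx A *m G *m L^T in
  let Pi := V *m invmx (V^T *m V) *m V^T in
  \tr (invmx A *m block_bfgs G A U) = \tr (invmx A *m G) - \tr (Q *m Pi) + k%:R.
Proof.
have pW := scaled_pdA; have uW := pdmx_unit pW; have uA := pdmx_unit pA.
move: pW uW; rewrite /= /block_bfgs scaled_gram; move eUW : (U^T *m A *m U) => W pW uW.
have eLV : V^T *m L = U^T by rewrite eU trmx_mul trmxK.
rewrite mulmxDr mulmxBr raddfD raddfB /=.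
congr (_ - _ + _).
  have -> : L *m G *m invmx A *m G *m L^T *m (V *m invmx (V^T *m V) *m V^T) =
    L *m (G *m invmx A *m (G *m (L^T *m V) *m invmx (V^T *m V) *m V^T)) by rewrite !mulmxA.
  rewrite -eU [RHS]mxtrace_mulC.
  have -> : G *m invmx A *m (G *m U *m invmx (V^T *m V) *m V^T) *m L =
    G *m invmx A *m (G *m U *m invmx (V^T *m V)) *m (V^T *m L) by rewrite !mulmxA.
  have -> : G *m invmx A *m (G *m U *m invmx (V^T *m V)) *m (V^T *m L) =
    G *m (invmx A *m (G *m U *m invmx (V^T *m V) *m U^T)) by rewrite eLV !mulmxA.
  by rewrite [RHS]mxtrace_mulC !mulmxA.
have -> : A *m U *m invmx W *m U^T *m A = A *m (U *m (invmx W *m (U^T *m A))).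
  by rewrite !mulmxA.
by rewrite mulKmx // mxtrace_mulC -mulmxA eUW mulVmx // mxtrace1.
Qed.

Lemma scaled_trace : \tr (L *m G *m invmx A *m G *m L^T) = \tr (invmx A *m G).
Proof.
rewrite mxtrace_mulC !mulmxA -GL mulVmx ?mul1mx //; exact: pdmx_unit.
Qed.

Lemma scaled_psd : psdmx (L *m G *m invmx A *m G *m L^T).
Proof.
have := psdmx_congr (G *m L^T) (pdmx_psd (pdmx_inv pA)).
by rewrite trmx_mul trmxK pG.1 !mulmxA.
Qed.

End ScaledBlockBfgs.

End BilinearForms.

(** * Hessian and Newton-type steps *)

Section Derivatives.
Context {R : realType} {d : nat}.
Implicit Types (f : 'cV[R]_d -> R) (x v s : 'cV[R]_d).

Lemma is_derive_line (W : normedModType R) (g : 'cV[R]_d -> W) x s (t : R) :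
  derivable g (x + t *: s) s ->
  is_derive t (1 : R) (fun u : R => g (x + u *: s)) ('D_s g (x + t *: s)).
Proof.
move=> dg.
have e : (fun h : R => h^-1 *: (((fun u : R => g (x + u *: s)) \o shift t) (h *: 1) - g (x + t *: s)))
  = (fun h => h^-1 *: ((g \o shift (x + t *: s)) (h *: s) - g (x + t *: s))).
  apply/funext => h /=; congr (_ *: (g _ - _)).
  by rewrite /= scalerDl [_ *: 1]mulr1 addrCA.
by split; rewrite /derivable /derive e.
Qed.

Lemma col_sum_delta v : v = \sum_i v i 0 *: delta_mx i 0.
Proof.
apply/matrixP => i j; rewrite ord1 summxE (bigD1 i) //= !mxE !eqxx mulr1.
rewrite big1 ?addr0 // => k ki; rewrite !mxE eq_sym (negbTE ki) mulr0 //.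
Qed.

Lemma derive_sum_delta (W : normedModType R) (g : 'cV[R]_d -> W) x v :
  differentiable g x -> 'D_v g x = \sum_i v i 0 *: 'D_(delta_mx i 0) g x.
Proof.
move=> dg; rewrite deriveE // {1}[v]col_sum_delta linear_sum.
by apply: eq_bigr => i _; rewrite linearZ /= deriveE.
Qed.

Lemma derive_grad f x v : differentiable f x -> 'D_v f x = bform 1%:M (grad f x) v.
Proof.
move=> df; rewrite derive_sum_delta // bform1E; apply: eq_bigr => i _.
by rewrite mxE mulrC.
Qed.

Lemma derive_hess f x v : differentiable (grad f) x -> 'D_v (grad f) x = hess f x *m v.
Proof.
move=> dg; rewrite derive_sum_delta //; apply/matrixP => i j; rewrite ord1.
by rewrite summxE mxE; apply: eq_bigr => k _; rewrite !mxE mulrC.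
Qed.

Lemma is_derive_bform1 (h : R -> 'cV[R]_d) u (t : R) (dh : 'cV[R]_d) :
  is_derive t (1 : R) h dh ->
  is_derive t (1 : R) (fun r => bform 1%:M u (h r)) (bform 1%:M u dh).
Proof.
move=> [dvh eh].
have dvi i j := (derivable_mxP h t 1).1 dvh i j.
rewrite (_ : (fun r => _) = \sum_i (u i 0 *: (fun r => h r i 0))); last first.
  by apply/funext => r; rewrite bform1E fct_sumE.
apply: is_derive_eq.
  apply: is_derive_sum => i.
  by apply: is_deriveZ; apply: derivableP.
rewrite bform1E; apply: eq_bigr => i _; rewrite -eh derive_mx // mxE //.
Qed.

End Derivatives.

Section MatrixBounds.
Context {R : realType}.

(** [loewner_le] includes the symmetry of the difference. Through this lemma, self-concordance
    spreads the symmetry of the Hessian from one point to all others. *)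
Lemma trmx_cancel n (A H : 'M[R]_n) c : A^T = A ->
  (c *: A - (A - H))^T = c *: A - (A - H) -> H^T = H.
Proof.
move=> sA /matrixP h; apply/matrixP => i j; have := h i j; move/matrixP: sA => /(_ i j).
by rewrite !mxE => ->; lra.
Qed.

Lemma trmx_sub_sym n (A H : 'M[R]_n) : A^T = A -> H^T = H -> (A - H)^T = A - H.
Proof. by move=> sA sH; rewrite linearB /= sA sH. Qed.

Lemma ler_norm_of_sqr (a b : R) : 0 <= b -> a ^+ 2 <= b ^+ 2 -> `|a| <= b.
Proof. by move=> b0 h; rewrite -ler_sqr ?nnegrE // real_normK ?num_real. Qed.

(** Polarising at t u + s and t u - s gives 2 t E(u, s) <= c (t^2 A(u) + A(s)) for every t; the best
    choice is t = E(u, s) / (c A(u)). *)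
Lemma bform_bound n (A E : 'M[R]_n) (c : R) (u s : 'cV[R]_n) : A^T = A -> E^T = E -> 0 <= c ->
  (forall v, 0 <= qform A v) -> (forall v, `|qform E v| <= c * qform A v) ->
  bform E u s ^+ 2 <= c ^+ 2 * (qform A u * qform A s).
Proof.
move=> sA sE c0 pA hE.
have key t : 2 * t * bform E u s <= c * (t ^+ 2 * qform A u + qform A s).
  have h1 := le_trans (ler_norm _) (hE (t *: u + s)).
  have h2 := le_trans (ler_norm _) (eq_ind_r (fun z => z <= _) (hE (t *: u - s)) (normrN _)).
  rewrite !qformD // !qformN !bformNr !bformZl !qformZ in h1 h2.
  by move: h1 h2; nra.
have [ca|ca] := eqVneq (c * qform A u) 0.
  have cs0 : 0 <= c * qform A s by exact: mulr_ge0.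
  suff -> : bform E u s = 0 by rewrite expr0n /= !mulr_ge0 // exprn_ge0.
  (* When c A(u) = 0 the right side no longer depends on t, and this t puts the left side one above
     it. *)
  apply/eqP/negPn/negP => b0; have := key ((c * qform A s + 1) / (2 * bform E u s)).
  have -> t : c * (t ^+ 2 * qform A u + qform A s) = c * qform A s.
    by rewrite mulrDr mulrCA ca mulr0 add0r.
  have -> : 2 * ((c * qform A s + 1) / (2 * bform E u s)) * bform E u s = c * qform A s + 1.
    by field.
  by lra.
have cap : 0 < c * qform A u by rewrite lt_neqAle eq_sym ca mulr_ge0 ?pA.
have := key (bform E u s / (c * qform A u)).
set b := bform E u s; set a := qform A u in cap *; set q := qform A s.
have cp : c != 0 by move: ca; rewrite mulf_eq0 negb_or => /andP[].
have ap : a != 0 by move: ca; rewrite mulf_eq0 negb_or => /andP[].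
have -> : 2 * (b / (c * a)) * b = 2 * b ^+ 2 / (c * a) by field; rewrite cp ap.
have -> : c * ((b / (c * a)) ^+ 2 * a + q) = b ^+ 2 / (c * a) + c * q by field; rewrite cp ap.
move=> h; have : b ^+ 2 / (c * a) <= c * q by move: h; rewrite -mulrA; lra.
by rewrite ler_pdivrMr // => h2; have -> : c ^+ 2 * (a * q) = c * q * (c * a) by ring.
Qed.

Lemma invmxZ_unit n (A : 'M[R]_n) c : c != 0 -> A \in unitmx -> invmx (c *: A) = c^-1 *: invmx A.
Proof.
move=> c0 uA; have uc : c *: A \in unitmx by rewrite unitmxZ // unitfE.
apply: (can_inj (mulKmx uc)); rewrite mulmxV // -scalemxAl -scalemxAr mulmxV //.
by rewrite scalerA divff // scale1r.
Qed.

End MatrixBounds.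

(* [H] and [g] stand for the Hessian and the gradient of [f]; [mvt] is all that relates them. *)
Section SelfConcordance.
Context {R : realType} {d : nat}.
Variables (H : 'cV[R]_d -> 'M[R]_d) (g : 'cV[R]_d -> 'cV[R]_d) (M : R).
Definition lnorm (z v : 'cV[R]_d) : R := Num.sqrt (qform (H z) v).
Definition grad_norm (z : 'cV[R]_d) : R := Num.sqrt (qform (invmx (H z)) (g z)).

Hypothesis pdH : forall x, pdmx (H x).
Hypothesis M0 : 0 <= M.
Hypothesis scH : forall x y z w : 'cV[R]_d,
  loewner_le (H y - H x) ((M * lnorm z (y - x)) *: H w).
Hypothesis mvt : forall u x s, exists2 t : R, 0 <= t <= 1 &
  bform 1%:M u (g (x + s)) - bform 1%:M u (g x) = bform (H (x + t *: s)) u s.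

Let sH x : (H x)^T = H x. Proof. exact: (pdH x).1. Qed.

Lemma lnorm_sqr x v : lnorm x v ^+ 2 = qform (H x) v.
Proof. by rewrite sqr_sqrtr // (pdmx_psd (pdH x)).2. Qed.

Lemma lnorm_ge0 x v : 0 <= lnorm x v.
Proof. exact: sqrtr_ge0. Qed.

Lemma grad_norm_sqr x : grad_norm x ^+ 2 = qform (invmx (H x)) (g x).
Proof. by rewrite sqr_sqrtr // (pdmx_psd (pdmx_inv (pdH x))).2. Qed.

(** Both comparisons take z = x, so one factor c serves both; w is y or x according to the Hessian
    that has to appear on the right. *)
Lemma selfconc_stable x y : let c := 1 + M * lnorm x (y - x) in
  loewner_le (H y) (c *: H x) /\ loewner_le (H x) (c *: H y).
Proof.
move=> c; have sZ c' z : (c' *: H z)^T = c' *: H z by rewrite linearZ /= sH.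
split; [apply/(loewnerP (sH _) (sZ _ _))|apply/(loewnerP (sH _) (sZ _ _))] => v;
  rewrite qform_scalemx /c.
  have := loewner_qform v (scH x y x x); rewrite qform_submx qform_scalemx.
  by move: (qform (H y) v) (qform (H x) v) => a b; lra.
have -> : lnorm x (y - x) = lnorm x (x - y).
  by rewrite /lnorm -opprB qformN.
have := loewner_qform v (scH y x x y); rewrite qform_submx qform_scalemx.
by move: (qform (H y) v) (qform (H x) v) => a b; lra.
Qed.

Lemma selfconc_diff_bound x y u s :
  `|bform (H y) u s - bform (H x) u s| <=
  M * lnorm x (y - x) * (lnorm x u * lnorm x s).
Proof.
have r0 := lnorm_ge0 x (y - x).
have c0 : 0 <= M * lnorm x (y - x) by exact: mulr_ge0.
rewrite -bform_oppmx -bform_addmx; apply: ler_norm_of_sqr.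
  by rewrite !mulr_ge0 ?lnorm_ge0.
rewrite exprMn [X in _ <= _ * X]exprMn !lnorm_sqr.
apply: (bform_bound _ _ (sH x) _ c0).
- exact: trmx_sub_sym (sH y) (sH x).
- exact: (pdmx_psd (pdH x)).2.
move=> v; rewrite ler_norml; apply/andP; split.
  have := loewner_qform v (scH y x x x).
  have -> : lnorm x (x - y) = lnorm x (y - x).
    by rewrite /lnorm -opprB qformN.
  rewrite !qform_submx qform_scalemx.
  by move: (qform (H y) v) (qform (H x) v) => a b; lra.
have := loewner_qform v (scH x y x x); rewrite !qform_submx qform_scalemx.
by move: (qform (H y) v) (qform (H x) v) => a b; lra.
Qed.

(** With w = G^-1 g(x) and E = G - H x, the new gradient is E w plus the variation of the Hessian
    along the step, applied to w. The first is at most h / (1 + h) times lambda(x) by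
    [newton_contract], the second at most M r times lambda(x), both in the dual norm at x. Passing
    to the norm at x' costs sqrt(1 + M r). *)
Lemma newton_step (x : 'cV[R]_d) (G : 'M[R]_d) (h : R) :
  pdmx G -> loewner_le (H x) G -> 0 <= h ->
  (forall v, qform (G - H x) v <= h * qform (H x) v) ->
  let x' := x - invmx G *m g x in
  let r := lnorm x (x' - x) in
  r <= grad_norm x /\
  grad_norm x' <= Num.sqrt (1 + M * r) * (h / (1 + h) + M * r) * grad_norm x.
Proof.
move=> pG AG h0 hE x' r; set A := H x in AG hE *; set E := G - A in hE.
have pA : pdmx A := pdH x; have pA' := pdmx_inv pA.
set gx := g x; set w := invmx G *m gx; set lam := grad_norm x.
have es : x' - x = - w by rewrite /x' addrAC subrr add0r.
have Gw : G *m w = gx by rewrite mulKVmx // pdmx_unit.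
have lam0 : 0 <= lam := sqrtr_ge0 _.
have AE : A + E = G by rewrite /E addrC subrK.
have [] := newton_contract w pA AG h0 hE.
rewrite -/E AE Gw -grad_norm_sqr -/lam => c1 c2.
have er : r ^+ 2 = qform A w by rewrite lnorm_sqr es qformN.
have r0 : 0 <= r := lnorm_ge0 _ _.
have rl : r <= lam by rewrite -ler_sqr ?nnegrE // er.
split=> //.
have Mr0 : 0 <= M * r by exact: mulr_ge0.
have h10 : 0 < 1 + h by lra.
pose kap := h / (1 + h); have k0 : 0 <= kap by rewrite divr_ge0 // ltW.
have Ew : qform (invmx A) (E *m w) <= (kap * lam) ^+ 2.
  have -> : (kap * lam) ^+ 2 = h ^+ 2 * lam ^+ 2 / (1 + h) ^+ 2.
    by rewrite /kap; field; rewrite gt_eqF.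
  by rewrite ler_pdivlMr ?exprn_gt0 // mulrC.
set g' := g x'.
(* The intermediate point of [mvt] depends on u, so the new gradient is bounded through its pairing
   with each fixed u. *)
have main u : bform 1%:M u g' <= lnorm x u * ((kap + M * r) * lam).
  have [t /andP[t0 t1]] := mvt u x (- w).
  rewrite -/x' -/g' -/gx => eM.
  have hb := selfconc_diff_bound x (x + t *: - w) u (- w).
  have en : lnorm x (x + t *: - w - x) = t * r.
    rewrite addrAC subrr add0r /r es /lnorm qformZ sqrtrM ?sqr_ge0 //.
    by rewrite sqrtr_sqr ger0_norm.
  have er' : lnorm x (- w) = r by rewrite /r es.
  rewrite en er' -/A in hb.
  have e1 : bform 1%:M u gx = bform A u w + bform E u w.
    by rewrite -bform_addmx AE -Gw /bform mulmx1 mulmxA.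
  have e2 : bform E u w = bform A u (invmx A *m (E *m w)).
    by rewrite /bform -[in RHS]mulmxA mulKVmx ?pdmx_unit // mulmxA.
  have nu0 := lnorm_ge0 x u.
  have h3 : `|bform E u w| <= lnorm x u * (kap * lam).
    rewrite e2; apply: ler_norm_of_sqr; first by rewrite mulr_ge0 // mulr_ge0.
    apply: le_trans (cauchy_schwarz _ _ (pdmx_psd pA)) _.
    rewrite exprMn lnorm_sqr -/A; apply: ler_wpM2l; first exact: (pdmx_psd pA).2.
    by rewrite -qform_inv.
  have h4 : M * (t * r) * (lnorm x u * r) <= lnorm x u * (M * r * lam).
    have -> : M * (t * r) * (lnorm x u * r) = lnorm x u * (M * r * (t * r)) by ring.
    apply: ler_wpM2l => //; apply: ler_wpM2l => //.
    by apply: le_trans rl; rewrite -[leRHS]mul1r; apply: ler_wpM2r.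
  have := ler_norm (bform E u w); have := ler_norm (- bform E u w); rewrite normrN.
  have := le_trans (ler_norm _) hb.
  rewrite !bformNr in eM *; rewrite e1 in eM.
  rewrite mulrDl mulrDr; move: h3 h4 eM; lra.
have hg : qform (invmx A) g' <= ((kap + M * r) * lam) ^+ 2.
  (* This u pairs with g' to n^2, the squared dual norm of g', and has A-norm n itself; so n^2 <= n
     C. *)
  have := main (invmx A *m g').
  have -> : bform 1%:M (invmx A *m g') g' = qform (invmx A) g'.
    by rewrite /bform mulmx1 trmx_mul invmx_sym ?pA.1.
  have : lnorm x (invmx A *m g') ^+ 2 = qform (invmx A) g' by rewrite lnorm_sqr -qform_inv.
  have := lnorm_ge0 x (invmx A *m g').
  set n := lnorm x _; set C := _ * lam => n0 <- nC.
  have C0 : 0 <= C by rewrite mulr_ge0 // addr_ge0.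
  rewrite ler_sqr ?nnegrE //.
  have [->//|n1] := eqVneq n 0.
  have np : 0 < n by rewrite lt_neqAle eq_sym n1.
  by move: nC; rewrite expr2 ler_pM2l.
have [_ st] := selfconc_stable x x'; rewrite -/r in st.
set c := 1 + M * r in st *.
have cp : 0 < c by rewrite /c; lra.
have pA1 := pdH x'.
have := loewner_qform g' (loewner_inv pA st).
rewrite invmxZ_unit ?gt_eqF ?pdmx_unit // qform_scalemx ler_pdivrMl // => h5.
have D0 : 0 <= (kap + M * r) * lam by rewrite mulr_ge0 // addr_ge0.
apply: le_trans (ler_norm _) _; apply: ler_norm_of_sqr.
  by rewrite -mulrA mulr_ge0 ?sqrtr_ge0.
rewrite grad_norm_sqr -mulrA exprMn sqr_sqrtr; last exact: ltW.
by apply: le_trans h5 _; apply: ler_wpM2l => //; exact: ltW.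
Qed.

End SelfConcordance.

(** * Hessians of strongly convex, self-concordant functions *)

Section Objective.
Context {R : realType} {d : nat}.
Implicit Types (x v s : 'cV[R]_d).
Variables (f : 'cV[R]_d -> R).
Hypothesis f2 : twice_differentiable f.

Lemma is_derive_grad_line u x s (t : R) :
  is_derive t (1 : R) (fun r : R => bform 1%:M u (grad f (x + r *: s)))
    (bform (hess f (x + t *: s)) u s).
Proof.
have -> : bform (hess f (x + t *: s)) u s = bform 1%:M u (hess f (x + t *: s) *m s).
  by rewrite /bform mulmx1 mulmxA.
apply: (is_derive_bform1 (h := fun r : R => grad f (x + r *: s))).
rewrite -derive_hess; last exact: f2.2.
by apply: is_derive_line; apply: diff_derivable; exact: f2.2.
Qed.

Lemma grad_mvt u x s : exists2 t : R, 0 <= t <= 1 &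
  bform 1%:M u (grad f (x + s)) - bform 1%:M u (grad f x) =
  bform (hess f (x + t *: s)) u s.
Proof.
have [] := @MVT_segment R (fun r : R => bform 1%:M u (grad f (x + r *: s)))
   (fun t => bform (hess f (x + t *: s)) u s) 0 1 ler01.
- by move=> t _; exact: is_derive_grad_line.
- apply: continuous_subspaceT => t; apply: differentiable_continuous.
  apply/derivable1_diffP; have [] := is_derive_grad_line u x s t.
  by [].
move=> t; rewrite in_itv /= => ht; rewrite !scale0r addr0 scale1r subr0 mulr1 => e.
by exists t.
Qed.

Lemma derive_line_ge (g : R -> R) (dg c : R) :
  is_derive (0 : R) (1 : R) g dg -> (forall t, 0 < t < 1 -> c * t <= g t - g 0) -> c <= dg.
Proof.
move=> [dvg eg] h; rewrite -eg /derive.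
have h1 := cvg_at_right_filter.
have cv := dvg; rewrite /derivable in cv.
have cr : (fun h0 : R => h0^-1 *: ((g \o shift 0) (h0 *: 1) - g 0)) @ 0^'+ -->
  lim ((fun h0 : R => h0^-1 *: ((g \o shift 0) (h0 *: 1) - g 0)) @ 0^').
  exact: cvg_dnbhs_at_right.
apply: (cvgr_to_ge cr); near=> t.
have t0 : 0 < t by near: t; exact: nbhs_right_gt.
have t1 : t < 1 by near: t; exact: nbhs_right_lt.
have := h t; rewrite t0 t1 => /(_ isT) ht.
by rewrite /= addr0 [_ *: 1]mulr1 ler_pdivlMl // mulrC.
Unshelve. all: by end_near. Qed.

Lemma strongly_convex_grad mu x y : strongly_convex f mu ->
  bform 1%:M (grad f y) (x - y) <= f x - f y - mu / 2 * norm2 (x - y) ^+ 2.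
Proof.
move=> [mu0 sc].
pose N := norm2 (x - y) ^+ 2.
(* The term in u^2 absorbs the quadratic part of theta (1 - theta), so that [hh] is a bound linear
   in t; it does not change the derivative at 0. *)
have id1 : is_derive (0 : R) (1 : R) (fun u : R => - f (y + u *: (x - y)) + u ^+ 2 * (mu / 2 * N))
    (- bform 1%:M (grad f y) (x - y) + 0).
  set c := mu / 2 * N.
  have i1 : is_derive (0 : R) (1 : R) (fun u : R => f (y + u *: (x - y))) (bform 1%:M (grad f y) (x - y)).
    have := @is_derive_line _ _ _ f y (x - y) 0; rewrite scale0r addr0 derive_grad; last exact: f2.1.
    by apply; apply: diff_derivable; exact: f2.1.
  have i2 : is_derive (0 : R) (1 : R) (c *: ((id : R -> R) * (id : R -> R))) (c *: (0 *: 1 + 0 *: 1)).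
    by apply: is_deriveZ; apply: is_deriveM.
  have i3 := is_deriveD (is_deriveN i1) i2.
  rewrite (_ : (fun u : R => _) = - (fun u : R => f (y + u *: (x - y))) + c *: ((id : R -> R) * (id : R -> R))).
    by apply: (is_derive_eq i3); rewrite !scale0r addr0 scaler0.
  by apply/funext => u /=; rewrite expr2 [in LHS]mulrC.
have hh (t : R) : 0 < t < 1 ->
  - (f x - f y - mu / 2 * N) * t <= - f (y + t *: (x - y)) + t ^+ 2 * (mu / 2 * N) + f y.
  move=> /andP[t0 t1].
  have := sc x y t; rewrite (ltW t0) (ltW t1) => /(_ isT); rewrite -/N.
  have -> : t *: x + (1 - t) *: y = y + t *: (x - y).
    by apply/matrixP => i j; rewrite !mxE; ring.
  move: (f (y + t *: (x - y))) (f x) (f y) => a b c; clearbody N; lra.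
have := @derive_line_ge _ _ (- (f x - f y - mu / 2 * N)) id1.
rewrite addr0 lerN2; apply => t /hh.
by rewrite scale0r addr0 expr0n /= mul0r addr0 opprK.
Qed.

(** The gradient inequalities from x to x + t v and back add up to strong monotonicity: the gradient
    increment paired with v is at least mu t |v|^2. Its slope at t = 0 is the Hessian form. *)
Lemma hess_lower mu x v : strongly_convex f mu ->
  mu * qform 1%:M v <= qform (hess f x) v.
Proof.
move=> sc.
have id1 := is_derive_grad_line v x v 0.
rewrite scale0r addr0 in id1.
apply: (derive_line_ge id1) => t /andP[t0 t1].
have h1 := strongly_convex_grad (x + t *: v) x sc.
have h2 := strongly_convex_grad x (x + t *: v) sc.
rewrite !norm2_sqr in h1 h2.
have e1 : x + t *: v - x = t *: v by rewrite addrC addKr.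
have e2 : x - (x + t *: v) = - (t *: v) by rewrite opprD addNKr.
rewrite e1 in h1; rewrite e2 in h2.
rewrite qformN qformZ bformNr bformZr in h2; rewrite qformZ bformZr in h1.
rewrite scale0r addr0 (bformC _ _ (trmx1 _ _)) (bformC v _ (trmx1 _ _)).
rewrite -(ler_pM2l t0); move: h1 h2.
set q := qform _ v; set a := bform _ _ v; set b := bform _ _ v; nra.
Qed.

Section SelfConcordant.
Variables (M mu : R) (x0 : 'cV[R]_d).
Hypothesis fsc : strongly_convex f mu.
Hypothesis fM : strongly_self_concordant f M.
Hypothesis sx0 : (hess f x0)^T = hess f x0.

Lemma hess_sym x : (hess f x)^T = hess f x.
Proof.
have [s _] := fM.2 x x0 x0 x0; exact: trmx_cancel sx0 s.
Qed.

Lemma hess_pd x : pdmx (hess f x).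
Proof.
split=> [|v v0]; first exact: hess_sym.
apply: lt_le_trans (hess_lower x v fsc).
by rewrite mulr_gt0 ?fsc.1 // (pdmx1 d).2.
Qed.

End SelfConcordant.

End Objective.

(** * Deterministic bounds along a full-rank path *)

Section Rate.
Context {R : realType}.
Variables (eta0 e0 : R).
Hypotheses (eta1 : 1 <= eta0) (e00 : 0 <= e0) (e0eta : e0 * eta0 <= 16^-1).

(* A crude linear rate, valid along every full-rank path, that makes the local gradient
   norms summable. *)
Definition rate : R := 1 - 2 / (3 * eta0).
Definition lam_bound t : R := e0 * rate ^+ t.
Definition lam_sum t : R := \sum_(s < t) lam_bound s.
(** A step multiplies the Loewner ratio by at most (1 + m_s)^2 <= exp(2 m_s); these factors are
    accumulated with [lam_bound] in place of m_s. *)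
Definition eta_bound t : R := eta0 * expR (2 * lam_sum t).

Fact eta00 : 0 < eta0. Proof. exact: lt_le_trans ltr01 eta1. Qed.

Lemma rate_itv : 0 <= rate <= 1.
Proof.
have E1 := eta1; have h : 0 < 3 * eta0 by lra.
apply/andP; split; last by rewrite gerBl divr_ge0 // ltW.
by rewrite subr_ge0 ler_pdivrMr //; lra.
Qed.

Lemma lam_bound_ge0 t : 0 <= lam_bound t.
Proof. by have /andP[r0 _] := rate_itv; rewrite mulr_ge0 // exprn_ge0. Qed.

Lemma lam_bound_le t : lam_bound t <= e0.
Proof.
by have /andP[r0 r1] := rate_itv; rewrite ler_piMr // exprn_ile1.
Qed.

Lemma lam_sumE t : lam_sum t = 3 / 2 * (e0 * eta0) * (1 - rate ^+ t).
Proof.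
elim: t => [|t ih]; first by rewrite /lam_sum big_ord0 expr0 subrr mulr0.
rewrite /lam_sum big_ord_recr /= -/(lam_sum t) ih /lam_bound exprS /rate.
by field; rewrite gt_eqF // eta00.
Qed.

Lemma lam_sum_ge0 t : 0 <= lam_sum t.
Proof. by apply: sumr_ge0 => i _; exact: lam_bound_ge0. Qed.

Lemma lam_sum_le t : lam_sum t <= 3 / 2 * (e0 * eta0).
Proof.
have /andP[r0 r1] := rate_itv; rewrite lam_sumE; apply: ler_piMr.
  by apply: mulr_ge0 => //; apply: mulr_ge0 => //; exact: ltW eta00.
by rewrite lerBlDr lerDl exprn_ge0.
Qed.

Lemma eta_bound_ge1 t : 1 <= eta_bound t.
Proof.
rewrite -[1]mulr1; apply: ler_pM => //.
by rewrite -expR0 ler_expR mulr_ge0 // lam_sum_ge0.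
Qed.

(** With a = 1 / eta0, the bound 1/16 gives m <= a / 16 and 2 [lam_sum] <= 3/16, so 1 / eta_t >=
    13/16 a by exp(-x) >= 1 - x. Hence the second factor is at most 1 - 3/4 a, and 1 + m / 2 costs
    at most a / 32, which still leaves 2/3 a. *)
Lemma rate_contract m t : 0 <= m -> m <= e0 -> (1 + m / 2) * (1 - (eta_bound t)^-1 + m) <= rate.
Proof.
move=> m0 me.
have E0 := eta00; have E1 := eta1; have E2 := e00; have E3 := e0eta.
have S1 : 2 * lam_sum t <= 3 / 16 by have := lam_sum_le t; lra.
set a := eta0^-1.
have a0 : 0 < a by rewrite invr_gt0.
have a1 : a <= 1 by rewrite invf_le1.
have ea : e0 <= a / 16.
  by rewrite /a [leRHS]mulrC ler_pdivlMr.
have ie : 13 / 16 * a <= (eta_bound t)^-1.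
  rewrite /eta_bound invfM -/a mulrC; apply: ler_wpM2l; first exact: ltW.
  rewrite -expRN; apply: le_trans (expR_ge1Dx _); lra.
have -> : rate = 1 - 2 / 3 * a by rewrite /rate /a; field; rewrite gt_eqF.
have u0 : 0 <= (eta_bound t)^-1 by rewrite invr_ge0; apply: le_trans (eta_bound_ge1 t).
move: ie; set u := (eta_bound t)^-1 => ie.
have h1 : (1 + m / 2) * (1 - u + m) <= (1 + m / 2) * (1 - 3 / 4 * a).
  by apply: ler_wpM2l; lra.
apply: le_trans h1 _; nra.
Qed.

End Rate.

(** * One step, and runs with injective blocks *)

Section Step.
Context {R : realType} {d k : nat}.
Variables (H : 'cV[R]_d -> 'M[R]_d) (g : 'cV[R]_d -> 'cV[R]_d) (M : R).
Hypothesis pdH : forall x, pdmx (H x).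
Hypothesis M0 : 0 <= M.
Hypothesis scH : forall x y z w : 'cV[R]_d,
  loewner_le (H y - H x) ((M * lnorm H z (y - x)) *: H w).
Hypothesis mvt : forall u x s, exists2 t : R, 0 <= t <= 1 &
  bform 1%:M u (g (x + s)) - bform 1%:M u (g x) = bform (H (x + t *: s)) u s.

Definition good_state (eta : R) (x : 'cV[R]_d) (G L : 'M[R]_d) :=
  [/\ pdmx G, loewner_le (H x) G, loewner_le G (eta *: H x) & invmx G = L^T *m L].

Definition trace_gap (x : 'cV[R]_d) (G : 'M[R]_d) : R := \tr (invmx (H x) *m G) - d%:R.

Lemma trace_gapE x G : trace_gap x G = \tr (invmx (H x) *m (G - H x)).
Proof. by rewrite mulmxBr mulVmx ?pdmx_unit // raddfB /= mxtrace1. Qed.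

Lemma trace_gap_ge0 x G : loewner_le (H x) G -> 0 <= trace_gap x G.
Proof.
move=> h; rewrite trace_gapE; apply: trace_mul_ge0 => //.
exact: pdmx_psd (pdmx_inv (pdH x)).
Qed.

Lemma trace_gap_le eta x G : loewner_le G (eta *: H x) -> trace_gap x G <= d%:R * (eta - 1).
Proof.
move=> h; have := trace_mul_ge0 (pdmx_psd (pdmx_inv (pdH x))) h.
rewrite mulmxBr raddfB /= -scalemxAr mulVmx ?pdmx_unit // mxtraceZ mxtrace1.
by rewrite /trace_gap mulrBr mulr1 subr_ge0 [eta * _]mulrC => h2; rewrite lerD2r.
Qed.

Section OneStep.
Variables (x : 'cV[R]_d) (G L : 'M[R]_d) (V : 'M[R]_(d, k)) (eta : R).
Hypothesis gs : good_state eta x G L.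
Hypothesis eta1 : 1 <= eta.
Hypothesis injV : forall v : 'cV[R]_k, V *m v = 0 -> v = 0.
Let x' := x - invmx G *m g x.
Let r := lnorm H x (x' - x).
Let c := 1 + M * r.
Let Gt := c *: G.
Let Lt := (Num.sqrt c)^-1 *: L.
Let A := H x'.
Let G' := block_bfgs Gt A (Lt^T *m V).
Let L' := update_scaling Lt A V.

Let c1 : 1 <= c.
Proof. by rewrite lerDl mulr_ge0 // sqrtr_ge0. Qed.

Let c0 : 0 < c. Proof. exact: lt_le_trans ltr01 c1. Qed.

Let pGt : pdmx Gt.
Proof. by case: gs => pG _ _ _; exact: pdmxZ. Qed.

Let GLt : invmx Gt = Lt^T *m Lt.
Proof.
case: gs => pG _ _ GL; rewrite /Gt invmxZ_unit ?gt_eqF ?pdmx_unit // GL /Lt.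
have -> : ((Num.sqrt c)^-1 *: L)^T = (Num.sqrt c)^-1 *: L^T by rewrite linearZ.
rewrite -scalemxAl -scalemxAr scalerA -invfM -expr2 sqr_sqrtr //.
exact: ltW.
Qed.

(** [newton_step] with two values of h. For h = eta - 1, h / (1 + h) = 1 - 1 / eta drives the crude
    rate on each path; for h the trace gap, h / (1 + h) <= h gives the bound whose expectation is
    taken. *)
Lemma step_newton :
  [/\ r <= grad_norm H g x,
   grad_norm H g x' <= Num.sqrt c * (1 - eta^-1 + M * r) * grad_norm H g x &
   grad_norm H g x' <= Num.sqrt c * (trace_gap x G + M * r) * grad_norm H g x].
Proof.
case: gs => pG HG GH _.
have e0 : 0 <= eta - 1 by rewrite subr_ge0.
have h1 v : qform (G - H x) v <= (eta - 1) * qform (H x) v.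
  have := loewner_qform v GH; rewrite qform_submx qform_scalemx.
  by move: (qform G v) (qform (H x) v) => a b; lra.
have h2 v : qform (G - H x) v <= trace_gap x G * qform (H x) v.
  by rewrite trace_gapE; exact: qform_le_trace.
have [rl n1] := newton_step pdH M0 scH mvt pG HG e0 h1.
have s0 := trace_gap_ge0 HG.
have [_ n2] := newton_step pdH M0 scH mvt pG HG s0 h2.
split=> //.
  apply: le_trans n1 _; rewrite -/x' -/r -/c.
  have -> // : (eta - 1) / (1 + (eta - 1)) = 1 - eta^-1.
  have eta0 : eta != 0 by rewrite gt_eqF // (lt_le_trans ltr01).
  have -> : 1 + (eta - 1) = eta by ring.
  by rewrite mulrBl mul1r divff.
apply: le_trans n2 _; rewrite -/x' -/r -/c.
apply: ler_wpM2r; first exact: sqrtr_ge0.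
apply: ler_wpM2l; first exact: sqrtr_ge0.
rewrite lerD2r ler_pdivrMr ?ltr_pwDl // mulrDr mulr1 lerDl.
exact: mulr_ge0.
Qed.

(** H x' <= c H x <= c G: the correction factor [c] of the method serves this inequality. *)
Let AGt : loewner_le A Gt.
Proof.
case: gs => pG HG GH _.
have [h1 _] := selfconc_stable pdH scH x x'.
apply/(loewnerP (pdH x').1 pGt.1) => v.
have := loewner_qform v h1; rewrite -/r -/c /Gt !qform_scalemx => /le_trans; apply.
by apply: ler_wpM2l; [exact: ltW|exact: loewner_qform].
Qed.

(** One factor [c] is the rescaling of G, the other the passage from H x to H x'. *)
Let GtA : loewner_le Gt ((c ^+ 2 * eta) *: A).
Proof.
case: gs => pG HG GH _.
have [_ h1] := selfconc_stable pdH scH x x'.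
have sA : ((c ^+ 2 * eta) *: A)^T = (c ^+ 2 * eta) *: A by rewrite linearZ /= (pdH x').1.
apply/(loewnerP pGt.1 sA) => v; rewrite /Gt !qform_scalemx expr2 -!mulrA.
apply: ler_wpM2l; first exact: ltW.
have := loewner_qform v GH; rewrite qform_scalemx => /le_trans; apply.
rewrite mulrCA; apply: ler_wpM2l; first exact: le_trans ler01 eta1.
by have := loewner_qform v h1; rewrite qform_scalemx.
Qed.

Lemma step_good : good_state (c ^+ 2 * eta) x' G' L'.
Proof.
have pU := scaled_pdG pGt GLt injV (erefl _).
have pW := scaled_pdA pGt (pdH x') GLt injV (erefl _).
have eU := scaled_gram pGt GLt (erefl (Lt^T *m V)).
have low := block_bfgs_lower pGt (pdH x') pU pW eU (erefl _) AGt.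
split.
- exact: pdmx_loewner (pdH x') low.
- exact: low.
- apply: (block_bfgs_upper pGt (pdH x') pU pW eU (erefl _) _ GtA).
  by rewrite -[1]mulr1; apply: ler_pM => //; rewrite expr2 -[1]mulr1 ler_pM.
- exact: (update_scaling_inv pGt (pdH x') GLt injV (erefl _)).
Qed.

(** The matrix Q of the overview. It is formed without [V], hence before the block of this step is
    drawn. *)
Definition step_weight := Lt *m Gt *m invmx A *m Gt *m Lt^T.

Lemma step_weight_psd : psdmx step_weight.
Proof. by apply: scaled_psd => //; exact: pdH. Qed.

Lemma step_weight_trace : \tr step_weight = \tr (invmx A *m Gt).
Proof. by apply: scaled_trace. Qed.

Lemma step_weight_trace_le : \tr step_weight <= c ^+ 2 * \tr (invmx (H x) *m G).
Proof.
case: gs => pG HG GH _.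
have [_ h1] := selfconc_stable pdH scH x x'.
have := loewner_inv (pdH x) h1; rewrite -/r -/c invmxZ_unit ?gt_eqF ?pdmx_unit // => h2.
have := trace_mul_ge0 h2 (pdmx_psd pG).
rewrite mulmxBl raddfB /= -scalemxAl mxtraceZ subr_ge0 ler_pdivrMl // => h3.
rewrite step_weight_trace /Gt -scalemxAr mxtraceZ expr2 -mulrA.
by apply: ler_wpM2l => //; exact: ltW.
Qed.

Lemma step_trace_gap : trace_gap x' G' =
  \tr step_weight - \tr (step_weight *m (V *m invmx (V^T *m V) *m V^T)) + k%:R - d%:R.
Proof.
rewrite /trace_gap (block_bfgs_trace pGt (pdH x') GLt injV (erefl _)).
by rewrite step_weight_trace.
Qed.

End OneStep.

(** [bfgs_step] for abstract [H] and [g], with projections instead of a match so that it unfolds on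
    a state that is not a constructor; [bfgs_runE] identifies the runs. *)
Definition qn_step (s : @bfgs_state R d) (V : 'M[R]_(d, k)) : @bfgs_state R d :=
  let x' := state_x s - invmx (state_G s) *m g (state_x s) in
  let c := 1 + M * lnorm H (state_x s) (x' - state_x s) in
  BfgsState x' (block_bfgs (c *: state_G s) (H x') (((Num.sqrt c)^-1 *: state_L s)^T *m V))
    (update_scaling ((Num.sqrt c)^-1 *: state_L s) (H x') V).

Fixpoint qn_run (s0 : bfgs_state) (V : nat -> 'M[R]_(d, k)) (t : nat) : bfgs_state :=
  if t is t'.+1 then qn_step (qn_run s0 V t') (V t') else s0.

(** The state at time t ignores the blocks from t on; this is the form in which independence is used
    later. *)
Lemma qn_run_ext s0 V V' t : (forall s, (s < t)%N -> V s = V' s) ->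
  qn_run s0 V t = qn_run s0 V' t.
Proof.
elim: t => [//|t ih] h /=; rewrite ih ?h // => s st.
by apply: h; exact: ltnW.
Qed.

Definition state_gap (s : bfgs_state) : R := trace_gap (state_x s) (state_G s).
Definition state_lam (s : bfgs_state) : R := grad_norm H g (state_x s).
Definition state_weight (s : bfgs_state) : 'M[R]_d :=
  step_weight (state_x s) (state_G s) (state_L s).
Definition state_good eta (s : bfgs_state) :=
  good_state eta (state_x s) (state_G s) (state_L s).

Lemma state_lam_ge0 s : 0 <= state_lam s. Proof. exact: sqrtr_ge0. Qed.

Lemma good_state_mono eta eta' x G L : eta <= eta' -> good_state eta x G L -> good_state eta' x G L.
Proof.
move=> ee [pG HG GH GL]; split=> //.
have sA : (eta' *: H x)^T = eta' *: H x by rewrite linearZ /= (pdH x).1.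
apply/(loewnerP pG.1 sA) => v.
have := loewner_qform v GH; rewrite !qform_scalemx => /le_trans; apply.
by apply: ler_wpM2r => //; exact: (pdmx_psd (pdH x)).2.
Qed.

Lemma sqrt_1D_le (a : R) : 0 <= a -> Num.sqrt (1 + a) <= 1 + a / 2.
Proof.
move=> a0; apply: le_trans (ler_norm _) _; apply: ler_norm_of_sqr; first lra.
by rewrite sqr_sqrtr; nra.
Qed.

Definition row_proj (V : 'M[R]_(d, k)) : 'M[R]_d := V *m invmx (V^T *m V) *m V^T.

Lemma qn_step_bounds eta s V : state_good eta s -> 1 <= eta ->
  (forall v : 'cV[R]_k, V *m v = 0 -> v = 0) ->
  let m := M * state_lam s in
  [/\ state_good ((1 + m) ^+ 2 * eta) (qn_step s V),
      state_lam (qn_step s V) <= (1 + m / 2) * (1 - eta^-1 + m) * state_lam s,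
      state_lam (qn_step s V) <= (1 + m / 2) * (state_gap s + m) * state_lam s &
      state_gap (qn_step s V) = \tr (state_weight s) - \tr (state_weight s *m row_proj V)
         + k%:R - d%:R].
Proof.
move=> gs eta1 injV m.
have gs' : good_state eta (state_x s) (state_G s) (state_L s) := gs.
have /= [rl n1 n2] := step_newton gs' eta1.
have /= g2 := step_good gs' eta1 injV.
have /= tg := step_trace_gap gs' injV.
have lam0 := state_lam_ge0 s.
have m0 : 0 <= m by exact: mulr_ge0.
move: rl n1 n2 g2; set r := lnorm H _ _ => rl n1 n2 g2.
have r0 : 0 <= r by exact: sqrtr_ge0.
have Mrm : M * r <= m by exact: ler_wpM2l.
have Mr0 : 0 <= M * r by exact: mulr_ge0.
have e0 : 0 < eta by exact: lt_le_trans ltr01 eta1.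
have gap0 : 0 <= state_gap s by case: gs => _ HG _ _; exact: trace_gap_ge0.
have sqc : Num.sqrt (1 + M * r) <= 1 + m / 2.
  by apply: (le_trans (sqrt_1D_le Mr0)); lra.
have ie : eta^-1 <= 1 by rewrite invf_le1.
have fin kap : 0 <= kap ->
   Num.sqrt (1 + M * r) * (kap + M * r) * state_lam s <= (1 + m / 2) * (kap + m) * state_lam s.
  move=> k0; apply: ler_wpM2r => //; apply: ler_pM.
  - exact: sqrtr_ge0.
  - exact: addr_ge0.
  - exact: sqc.
  - by rewrite lerD2l.
split.
- apply: good_state_mono g2; apply: ler_wpM2r; first exact: ltW.
  by rewrite ler_sqr ?nnegrE ?addr_ge0 // lerD2l.
- by apply: le_trans n1 _; apply: fin; rewrite subr_ge0.
- by apply: le_trans n2 _; exact: fin.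
- exact: tg.
Qed.

Lemma state_weight_bounds eta s : state_good eta s -> 1 <= eta ->
  psdmx (state_weight s) /\
  \tr (state_weight s) <= (1 + M * state_lam s) ^+ 2 * (state_gap s + d%:R).
Proof.
move=> gs eta1; have gs' : good_state eta (state_x s) (state_G s) (state_L s) := gs.
have /= [rl _ _] := step_newton gs' eta1.
split; first exact: (step_weight_psd gs').
have /= wt := step_weight_trace_le gs'; apply: le_trans wt _.
move: rl; set r := lnorm H _ _ => rl; have r0 : 0 <= r by exact: sqrtr_ge0.
have gap0 : 0 <= state_gap s by case: gs => _ HG _ _; exact: trace_gap_ge0.
have -> : \tr (invmx (H (state_x s)) *m state_G s) = state_gap s + d%:R.
  by rewrite /state_gap /trace_gap subrK.
apply: ler_wpM2r; first by rewrite addr_ge0.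
have Mr0 : 0 <= M * r by exact: mulr_ge0.
have Mrm : M * r <= M * state_lam s by exact: ler_wpM2l.
by rewrite ler_sqr ?nnegrE ?addr_ge0 // ?lerD2l //; exact: le_trans Mr0 Mrm.
Qed.

Section Run.
Variables (s0 : @bfgs_state R d) (eta0 e0 : R).
Hypotheses (eta1 : 1 <= eta0) (s0_good : state_good eta0 s0).
Hypotheses (lam0 : M * state_lam s0 <= e0) (e0eta : e0 * eta0 <= 16^-1).

Let e00 : 0 <= e0. Proof. by apply: le_trans lam0; apply: mulr_ge0 => //; exact: state_lam_ge0. Qed.

Variable V : nat -> 'M[R]_(d, k).
Hypothesis injV : forall t (v : 'cV[R]_k), V t *m v = 0 -> v = 0.

(** The two bounds need each other: the decrease of lambda uses the Loewner ratio at time t, and the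
    growth of that ratio is governed by the sum of the earlier lambdas. *)
Lemma run_bounds t : state_good (eta_bound eta0 e0 t) (qn_run s0 V t) /\
  M * state_lam (qn_run s0 V t) <= lam_bound eta0 e0 t.
Proof.
elim: t => [|t [gt mt]].
  by rewrite /eta_bound /lam_sum /lam_bound big_ord0 mulr0 expR0 mulr1 expr0 mulr1.
have [g1 l1 _ _] := qn_step_bounds gt (eta_bound_ge1 eta1 e00 t) (@injV t).
set s := qn_run s0 V t in gt mt g1 l1 *.
have sl0 := state_lam_ge0 s.
set m := M * state_lam s in mt g1 l1.
have m0 : 0 <= m by exact: mulr_ge0.
split.
  apply: good_state_mono g1; rewrite /eta_bound /lam_sum big_ord_recr /= -/(lam_sum eta0 e0 t).
  rewrite mulrDr expRD mulrCA; apply: ler_wpM2l; first exact: le_trans ler01 eta1.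
  rewrite mulrC; apply: ler_wpM2l; first exact: expR_ge0.
  have -> : 2 * lam_bound eta0 e0 t = lam_bound eta0 e0 t + lam_bound eta0 e0 t by ring.
  have h1 : 1 + m <= expR (lam_bound eta0 e0 t).
    by apply: le_trans (expR_ge1Dx m) _; rewrite ler_expR.
  by rewrite expRD -expr2 ler_sqr ?nnegrE ?expR_ge0 ?addr_ge0.
have mE := lam_bound_le eta1 e00 t.
have := ler_wpM2l M0 l1; move/le_trans; apply.
rewrite mulrCA -/m /lam_bound exprS [leRHS]mulrCA.
have rc := rate_contract eta1 e00 e0eta t m0 (le_trans mt mE).
have /andP[r0 r1] := rate_itv eta1.
apply: le_trans (ler_wpM2r m0 rc) _.
exact: ler_wpM2l.
Qed.

End Run.
End Step.

(** * Measurability of the iterates *)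

Section MeasurableMatrices.
Context {disp : measure_display} {T : measurableType disp} {R : realType}.

Definition mx_measurable n m (A : T -> 'M[R]_(n, m)) :=
  forall i j, measurable_fun [set: T] (fun w => A w i j).

Lemma mx_measurable_cst n m (A : 'M[R]_(n, m)) : mx_measurable (fun=> A).
Proof. by move=> i j; exact: measurable_cst. Qed.

Lemma mx_measurableD n m (A B : T -> 'M[R]_(n, m)) :
  mx_measurable A -> mx_measurable B -> mx_measurable (fun w => A w + B w).
Proof.
move=> mA mB i j; under eq_fun do rewrite mxE.
by apply: measurable_funD; [exact: mA|exact: mB].
Qed.

Lemma mx_measurableZ n m (c : T -> R) (A : T -> 'M[R]_(n, m)) :
  measurable_fun setT c -> mx_measurable A -> mx_measurable (fun w => c w *: A w).
Proof.
move=> mc mA i j; under eq_fun do rewrite mxE.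
by apply: measurable_funM => //; exact: mA.
Qed.

Lemma mx_measurableN n m (A : T -> 'M[R]_(n, m)) :
  mx_measurable A -> mx_measurable (fun w => - A w).
Proof.
move=> mA; under [X in mx_measurable X]eq_fun do rewrite -scaleN1r.
by apply: mx_measurableZ => //; exact: measurable_cst.
Qed.

Lemma mx_measurableB n m (A B : T -> 'M[R]_(n, m)) :
  mx_measurable A -> mx_measurable B -> mx_measurable (fun w => A w - B w).
Proof. by move=> mA mB; apply: mx_measurableD => //; exact: mx_measurableN. Qed.

Lemma mx_measurableM n m p (A : T -> 'M[R]_(n, m)) (B : T -> 'M[R]_(m, p)) :
  mx_measurable A -> mx_measurable B -> mx_measurable (fun w => A w *m B w).
Proof.
move=> mA mB i j; under eq_fun do rewrite mxE.
apply: (measurable_sum _ (h := fun k w => A w i k * B w k j)) => k.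
by apply: measurable_funM; [exact: mA|exact: mB].
Qed.

Lemma mx_measurable_tr n m (A : T -> 'M[R]_(n, m)) :
  mx_measurable A -> mx_measurable (fun w => (A w)^T).
Proof. by move=> mA i j; under eq_fun do rewrite mxE; exact: mA. Qed.

Lemma measurable_det n (A : T -> 'M[R]_n) :
  mx_measurable A -> measurable_fun setT (fun w => \det (A w)).
Proof.
move=> mA; rewrite /determinant.
apply: (measurable_sum _ (h := fun (s : 'S_n) w => (-1) ^+ s * \prod_i A w i (s i))) => s.
apply: measurable_funM; first exact: measurable_cst.
by apply: (measurable_prod (h := fun i w => A w i (s i))) => i _; exact: mA.
Qed.

(** Inversion is continuous only away from 0; on the measurable set f = 0 its value is 0 by
    convention. *)
Lemma measurable_inv_fun (f : T -> R) :
  measurable_fun setT f -> measurable_fun setT (fun w => (f w)^-1).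
Proof.
move=> mf.
have -> : (fun w => (f w)^-1) = (fun w => if f w == 0 then 0 else (f w)^-1).
  by apply/funext => w; case: eqP => // ->; rewrite invr0.
have m0 : measurable [set w | f w = 0] by rewrite -[X in measurable X]setTI; exact: (mf measurableT [set 0] (measurable_set1 0)).
apply: measurable_fun_if => //.
- by apply: measurable_fun_eqr => //; exact: measurable_cst.
- rewrite setTI; apply: (@measurable_comp _ _ _ _ _ _ [set r : R | r != 0]) => //.
  + exact: open_measurable.
  + by move=> _ [w /= /negbT h <-].
  + apply: open_continuous_measurable_fun => //; apply/in_setP => x /= x0.
    exact: inv_continuous.
  + exact: measurable_funS mf.
Qed.

(** The adjugate formula where the determinant is nonzero, and the matrix itself elsewhere, the
    default of [invmx]: measurability is wanted on all paths, singular ones included. *)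
Lemma mx_measurable_inv n (A : T -> 'M[R]_n) :
  mx_measurable A -> mx_measurable (fun w => invmx (A w)).
Proof.
move=> mA i j.
have -> : (fun w => invmx (A w) i j) =
   (fun w => if \det (A w) == 0 then A w i j else (\det (A w))^-1 * \adj (A w) i j).
  apply/funext => w; rewrite /invmx unitmxE unitfE.
  by case: eqP => // _; rewrite mxE.
have md := measurable_det mA.
apply: measurable_fun_ifT; first by apply: measurable_fun_eqr => //; exact: measurable_cst.
  exact: mA.
apply: measurable_funM; first exact: measurable_inv_fun.
under eq_fun do rewrite mxE.
apply: measurable_funM; first exact: measurable_cst.
by apply: measurable_det => k l; under eq_fun do rewrite !mxE; exact: mA.
Qed.

Lemma measurable_mxtrace n (A : T -> 'M[R]_n) :
  mx_measurable A -> measurable_fun setT (fun w => \tr (A w)).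
Proof.
by move=> mA; apply: (measurable_sum _ (h := fun k w => A w k k)) => k; exact: mA.
Qed.

Lemma measurable_qform n (A : T -> 'M[R]_n) (v : T -> 'cV[R]_n) :
  mx_measurable A -> mx_measurable v -> measurable_fun setT (fun w => qform (A w) (v w)).
Proof.
move=> mA mv; rewrite /qform.
have := mx_measurableM (mx_measurableM (mx_measurable_tr mv) mA) mv.
by move=> /(_ 0 0).
Qed.

Lemma measurable_sqrt_fun (f : T -> R) :
  measurable_fun setT f -> measurable_fun setT (fun w => Num.sqrt (f w)).
Proof.
move=> mf; apply: (measurableT_comp (f := @Num.sqrt R)) => //.
by apply: continuous_measurable_fun; exact: sqrt_continuous.
Qed.

Lemma mx_measurable_sqrt n (A : T -> 'M[R]_n) : (forall w, psdmx (A w)) ->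
  mx_measurable A -> mx_measurable (fun w => sqrtmx (A w)).
Proof.
move=> pA mA i j.
apply: (@measurable_fun_cvg _ _ _ _ (fun m w => sqrtmx_approx (A w) m i j)); last first.
  by move=> w _; have [_ _] := sqrtmx_spec (pA w); exact.
have mabs : measurable_fun setT (fun w => abs_sum (A w)).
  apply: measurable_funD; first exact: measurable_cst.
  apply: (measurable_sum _ (h := fun i w => \sum_j `|A w i j|)) => k.
  apply: (measurable_sum _ (h := fun j w => `|A w k j|)) => l.
  by apply: measurableT_comp => //; exact: mA.
move=> m; apply: mx_measurableZ; first exact: measurable_sqrt_fun.
apply: mx_measurableD; first exact: mx_measurable_cst.
apply: mx_measurableZ; first exact: measurable_cst.
have mB : mx_measurable (fun w => 1%:M - (abs_sum (A w))^-1 *: A w).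
  apply: mx_measurableB; first exact: mx_measurable_cst.
  by apply: mx_measurableZ => //; exact: measurable_inv_fun.
elim: m => [|m ih] /=; first exact: mx_measurable_cst.
apply: mx_measurableZ; first exact: measurable_cst.
by apply: mx_measurableD => //; exact: mx_measurableM.
Qed.

(** Measurability of x is entrywise, so the open set where a < g is covered by those boxes with
    rational centre and radius 1 / (N + 1) that it contains. They are countably many, and each is a
    finite conjunction of conditions on coordinates. *)
Lemma measurable_continuous_col n (g : 'cV[R]_n -> R) (x : T -> 'cV[R]_n) :
  continuous g -> mx_measurable x -> measurable_fun setT (fun w => g (x w)).
Proof.
move=> cg mx; apply: (measurability _ (RGenOInfty.measurableE R)).
move=> _ [_ [a ->] <-]; rewrite setTI.
pose O : set 'cV[R]_n := [set v | a < g v].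
pose box (p : 'cV[rat]_n * nat) : set 'cV[R]_n :=
  [set v | forall i, `|v i 0 - ratr (p.1 i 0)| < p.2.+1%:R^-1].
pose F p : set T := if `[< box p `<=` O >] then x @^-1` box p else set0.
have -> : (fun w => g (x w)) @^-1` `]a, +oo[%classic = \bigcup_p F p.
  apply/seteqP; split => [w|w [p _]]; last first.
    rewrite /F; case: asboolP => // h /h /=; by rewrite /O /= in_itv /= andbT.
  rewrite /= in_itv /= andbT => aw.
  have : nbhs (x w) O.
    have : \forall v \near x w, a < g v by apply: (cvgr_gt _ (cg (x w))).
    by [].
  move=> /nbhs_ballP[e /= e0 he].
  (* The rational centre will be within 1 / (N + 1) < e / 2 of x w, so the whole box stays within e
     of it. *)
  have [N hN] : exists N : nat, N.+1%:R^-1 < e / 2.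
    have e2 : 0 < e / 2 by rewrite divr_gt0.
    exists (Num.trunc (e / 2)^-1); rewrite invf_plt ?posrE //.
    by rewrite truncnS_gt.
  have N0 : 0 < (N.+1%:R^-1 : R) by rewrite invr_gt0.
  have rq (i : 'I_n) : exists q : rat, `|x w i 0 - ratr q| < N.+1%:R^-1.
    have lt : x w i 0 < x w i 0 + N.+1%:R^-1 by rewrite ltrDl.
    have [q] := rat_in_itvoo lt; rewrite in_itv /= => /andP[q1 q2]; exists q.
    by rewrite distrC ger0_norm ?subr_ge0 ?ltW // ltrBlDl.
  pose q : 'cV[rat]_n := \col_i projT1 (cid (rq i)).
  exists (q, N) => //; rewrite /F asboolT; last first.
    move=> v bv; apply: he; split => // i j; rewrite ord1.
    have := bv i; rewrite /= /q mxE; case: (cid _) => r /= hr hv.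
    rewrite /ball /= (_ : x w i 0 - v i 0 = (x w i 0 - ratr r) - (v i 0 - ratr r)); last by ring.
    apply: le_lt_trans (ler_normB _ _) _.
    by rewrite (splitr e); apply: ltrD; [exact: lt_trans hr hN|exact: lt_trans hv hN].
  by move=> i /=; rewrite /q mxE; case: (cid _) => r /=.
apply: countable_bigcupT_measurable; first exact: countableP.
move=> p; rewrite /F; case: asboolP => // _.
have -> : x @^-1` box p = \bigcap_(i in [set: 'I_n]) [set w | `|x w i 0 - ratr (p.1 i 0)| < p.2.+1%:R^-1].
  by apply/seteqP; split => [w h i _|w h i]; [exact: h|exact: (h i I)].
apply: fin_bigcap_measurable => // i _.
have mi : measurable_fun setT (fun w => `|x w i 0 - ratr (p.1 i 0)| < p.2.+1%:R^-1).
  apply: measurable_fun_ltr; last exact: measurable_cst.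
  apply: (measurableT_comp (f := @Num.norm _ R)) => //.
  by apply: measurable_funB; [exact: mx|exact: measurable_cst].
have mb : measurable [set true] by [].
by have := mi measurableT _ mb; rewrite setTI.
Qed.

End MeasurableMatrices.

(** * Gradient and Hessian along measurable maps *)

Section MeasurableDerivatives.
Context {R : realType} {d : nat}.
Variable f : 'cV[R]_d -> R.
Hypothesis f2 : twice_differentiable f.
Context {disp : measure_display} {T : measurableType disp}.

Lemma grad_coord_continuous i : continuous (fun x => grad f x i 0).
Proof.
move=> x; apply: (continuous_comp (f := grad f) (g := fun v : 'cV[R]_d => v i 0)).
  exact: differentiable_continuous (f2.2 x).
exact: coord_continuous.
Qed.

Lemma mx_measurable_grad (x : T -> 'cV[R]_d) :
  mx_measurable x -> mx_measurable (fun w => grad f (x w)).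
Proof.
move=> mx i j; rewrite ord1.
exact: (measurable_continuous_col (@grad_coord_continuous i) mx).
Qed.

(** Hessian entries as limits of difference quotients with step 1 / (n + 1): their measurability
    then follows from the continuity of the gradient. *)
Lemma hess_lim x i j :
  (fun n => n.+1%:R * (grad f (n.+1%:R^-1 *: delta_mx j 0 + x) i 0 - grad f x i 0))
    @ \oo --> hess f x i j.
Proof.
have dg : derivable (grad f) x (delta_mx j 0) by apply: diff_derivable; exact: f2.2.
have -> : hess f x i j = 'D_(delta_mx j 0) (fun y => grad f y i 0) x.
  by rewrite /hess [LHS]mxE derive_mx // [LHS]mxE.
have dv := (derivable_mxP _ _ _).1 dg i 0.
have c0 : (fun n => (n.+1%:R^-1 : R)) @ \oo --> 0^'.
  move=> A hA.
  have h2 : \forall n \near \oo, (n.+1%:R^-1 != 0 :> R) -> A n.+1%:R^-1 := cvg_harmonic hA.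
  by apply: filterS h2 => n; apply; rewrite invr_eq0 pnatr_eq0.
rewrite /derive; move: dv; rewrite /derivable; set q := (fun h : R => _) => dv.
rewrite (_ : (fun n => _) = q \o (fun n => n.+1%:R^-1)).
  exact: (cvg_comp _ _ c0 dv).
by apply/funext => n /=; rewrite /q invrK.
Qed.

Lemma mx_measurable_hess (x : T -> 'cV[R]_d) :
  mx_measurable x -> mx_measurable (fun w => hess f (x w)).
Proof.
move=> mx i j; apply: measurable_fun_cvg; last first.
  by move=> w _; exact: hess_lim.
move=> m; apply: measurable_funM; first exact: measurable_cst.
apply: measurable_funB; last exact: mx_measurable_grad.
apply: (mx_measurable_grad (x := fun w => m.+1%:R^-1 *: delta_mx j 0 + x w)).
by apply: mx_measurableD => //; exact: mx_measurable_cst.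
Qed.

End MeasurableDerivatives.

(** * Measurability of updates and runs *)

Section MeasurableRun.
Context {R : realType} {d k : nat}.
Context {disp : measure_display} {T : measurableType disp}.

Lemma mx_measurable_block_bfgs (G A : T -> 'M[R]_d) (V : T -> 'M[R]_(d, k)) :
  mx_measurable G -> mx_measurable A -> mx_measurable V ->
  mx_measurable (fun w => block_bfgs (G w) (A w) (V w)).
Proof.
move=> mG mA mV; have mVt := mx_measurable_tr mV.
have h (B : T -> 'M[R]_d) : mx_measurable B -> mx_measurable (fun w =>
    B w *m V w *m invmx ((V w)^T *m B w *m V w) *m (V w)^T *m B w).
  move=> mB; apply: mx_measurableM => //; apply: mx_measurableM => //.
  apply: mx_measurableM; first exact: mx_measurableM.
  by apply: mx_measurable_inv; apply: mx_measurableM => //; exact: mx_measurableM.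
apply: mx_measurableD; last exact: h.
by apply: mx_measurableB => //; exact: h.
Qed.

Lemma mx_measurable_update_scaling (L A : T -> 'M[R]_d) (V : T -> 'M[R]_(d, k)) :
  (forall w, psdmx (A w)) ->
  mx_measurable L -> mx_measurable A -> mx_measurable V ->
  mx_measurable (fun w => update_scaling (L w) (A w) (V w)).
Proof.
move=> pA mL mA mV; have mVt := mx_measurable_tr mV; have mLt := mx_measurable_tr mL.
pose W w := (V w)^T *m L w *m A w *m (L w)^T *m V w.
have mW : mx_measurable W by do 4!apply: mx_measurableM => //.
have pW w : psdmx (W w).
  have := psdmx_congr ((L w)^T *m V w) (pA w); rewrite trmx_mul trmxK /W !mulmxA //.
have mWi : mx_measurable (fun w => invsqrtmx (W w)).
  by apply: mx_measurable_inv; exact: mx_measurable_sqrt.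
have mVi : mx_measurable (fun w => invsqrtmx ((V w)^T *m V w)).
  apply: mx_measurable_inv; apply: mx_measurable_sqrt.
    by move=> w; exact: psdmx_tr_mul.
  exact: mx_measurableM.
apply: mx_measurableD => //; do 3!apply: mx_measurableM => //.
apply: mx_measurableB; first exact: mx_measurableM.
by do 4!apply: mx_measurableM => //.
Qed.

Variables (H : 'cV[R]_d -> 'M[R]_d) (g : 'cV[R]_d -> 'cV[R]_d) (M : R).
Hypothesis pdH : forall x, pdmx (H x).
Hypothesis mH : forall x : T -> 'cV[R]_d, mx_measurable x -> mx_measurable (fun w => H (x w)).
Hypothesis mg : forall x : T -> 'cV[R]_d, mx_measurable x -> mx_measurable (fun w => g (x w)).

Definition state_measurable (s : T -> @bfgs_state R d) :=
  [/\ mx_measurable (fun w => state_x (s w)), mx_measurable (fun w => state_G (s w)) &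
     mx_measurable (fun w => state_L (s w))].

Lemma measurable_lnorm (x v : T -> 'cV[R]_d) : mx_measurable x -> mx_measurable v ->
  measurable_fun setT (fun w => lnorm H (x w) (v w)).
Proof.
by move=> mx mv; apply: measurable_sqrt_fun; apply: measurable_qform => //; exact: mH.
Qed.

Lemma measurable_state_lam (s : T -> @bfgs_state R d) : state_measurable s ->
  measurable_fun setT (fun w => state_lam H g (s w)).
Proof.
move=> [mx _ _]; apply: measurable_sqrt_fun; apply: measurable_qform; last exact: mg.
by apply: mx_measurable_inv; exact: mH.
Qed.

Lemma measurable_state_gap (s : T -> @bfgs_state R d) : state_measurable s ->
  measurable_fun setT (fun w => state_gap H (s w)).
Proof.
move=> [mx mG _]; apply: measurable_funB; last exact: measurable_cst.
apply: measurable_mxtrace; apply: mx_measurableM => //.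
by apply: mx_measurable_inv; exact: mH.
Qed.

Section Step.
Variable s : T -> @bfgs_state R d.
Hypothesis ms : state_measurable s.
Let x' w := state_x (s w) - invmx (state_G (s w)) *m g (state_x (s w)).
Let c w := 1 + M * lnorm H (state_x (s w)) (x' w - state_x (s w)).

Let mx' : mx_measurable x'.
Proof.
case: ms => mx mG mL.
by apply: mx_measurableB => //; apply: mx_measurableM; [exact: mx_measurable_inv|exact: mg].
Qed.

Let mc : measurable_fun setT c.
Proof.
case: ms => mx mG mL; apply: measurable_funD; first exact: measurable_cst.
apply: measurable_funM; first exact: measurable_cst.
by apply: measurable_lnorm => //; exact: mx_measurableB.
Qed.

Let mLt : mx_measurable (fun w => (Num.sqrt (c w))^-1 *: state_L (s w)).
Proof.
case: ms => mx mG mL.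
by apply: mx_measurableZ => //; apply: measurable_inv_fun; exact: measurable_sqrt_fun.
Qed.

Let mGt : mx_measurable (fun w => c w *: state_G (s w)).
Proof. by case: ms => mx mG mL; exact: mx_measurableZ. Qed.

Lemma state_measurable_step (V : T -> 'M[R]_(d, k)) : mx_measurable V ->
  state_measurable (fun w => qn_step H g M (s w) (V w)).
Proof.
move=> mV; have mA := mH mx'; split => /=.
- exact: mx'.
- apply: mx_measurable_block_bfgs => //.
  by apply: mx_measurableM => //; exact: mx_measurable_tr.
- by apply: mx_measurable_update_scaling => // w; apply: pdmx_psd.
Qed.

Lemma mx_measurable_weight : mx_measurable (fun w => state_weight H g M (s w)).
Proof.
have mA := mx_measurable_inv (mH mx').
have mLtt := mx_measurable_tr mLt.
by do 4!apply: mx_measurableM => //.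
Qed.

End Step.

Lemma state_measurable_run (s0 : @bfgs_state R d) (V : T -> nat -> 'M[R]_(d, k)) t :
  (forall n, mx_measurable (fun w => V w n)) ->
  state_measurable (fun w => qn_run H g M s0 (V w) t).
Proof.
move=> mV; elim: t => [|t ih] /=.
  by split; exact: mx_measurable_cst.
exact: state_measurable_step.
Qed.

End MeasurableRun.

(** * Gaussian paths *)

Section GaussianPaths.
Context {R : realType} {I : choiceType}.

Definition cylinder (s : seq I) (B : I -> set R) : set (I -> R) :=
  \bigcap_(i in [set` s]) [set g | B i (g i)].

Definition cylinders : set (set (I -> R)) :=
  [set A | exists s B, [/\ uniq s, forall i, measurable (B i) & A = cylinder s B]].

(** The canonical sample space: all families of entries with the product sigma-algebra, on which
    permutations and sign changes of the entries act. *)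
Definition paths := g_sigma_algebraType cylinders.

Lemma cylindersI : setI_closed cylinders.
Proof.
move=> _ _ [s [B [us mB ->]]] [s' [B' [us' mB' ->]]].
exists (undup (s ++ s')), (fun i => (if i \in s then B i else setT) `&` (if i \in s' then B' i else setT)).
split; first exact: undup_uniq.
  by move=> i; apply: measurableI; case: ifP.
apply/seteqP; split => [g [h h'] i|g h].
  rewrite /= mem_undup mem_cat => _; split; case: ifP => // si; [exact: h|exact: h'].
by split => i /= si; have := h i; rewrite /= mem_undup mem_cat si ?orbT => /(_ isT) [].
Qed.

Lemma cylindersT : cylinders setT.
Proof.
exists [::], (fun=> setT); split => //.
by apply/seteqP; split => // g _ i.
Qed.

Lemma measurable_coord i : measurable_fun [set: paths] (fun g : paths => g i).
Proof.
move=> _ Y mY; rewrite setTI; apply: sub_sigma_algebra.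
exists [:: i], (fun=> Y); split => //.
by apply/seteqP; split => [g h j|g]; [rewrite /= inE => /eqP ->|move=> /(_ i); apply; rewrite /= inE].
Qed.

Lemma measurable_path d (T : measurableType d) (X : I -> T -> R) :
  (forall i, measurable_fun setT (X i)) ->
  measurable_fun [set: T] (fun w => (fun i => X i w) : paths).
Proof.
move=> mX; apply: (@measurability _ _ T paths setT _ cylinders (erefl _)).
move=> _ [_ [s [B [us mB ->]]] <-]; rewrite setTI.
have -> : (fun w => (fun i => X i w) : paths) @^-1` cylinder s B =
  \bigcap_(i in [set` s]) (X i @^-1` B i) by [].
apply: fin_bigcap_measurable => // i _.
by rewrite -[X in measurable X]setTI; exact: mX.
Qed.

(** Independence and the standard normal law of each member in a single condition, the value of [P]
    on cylinders. *)
Definition gaussian_family d (T : measurableType d) (P : probability T R) (X : I -> T -> R) :=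
  (forall i, measurable_fun setT (X i)) /\
  forall s B, uniq s -> (forall i, measurable (B i)) ->
    P (\bigcap_(i in [set` s]) (X i @^-1` B i)) = (\prod_(i <- s) normal_prob 0 1 (B i))%E.

(** Cylinders are stable under intersection and generate the sigma-algebra, so a probability on
    [paths] is determined by its values on them. *)
Lemma gaussian_law d d' (T : measurableType d) (T' : measurableType d')
  (P : probability T R) (P' : probability T' R) X X' (A : set paths) :
  gaussian_family P X -> gaussian_family P' X' -> measurable A ->
  P ((fun w => (fun i => X i w)) @^-1` A) = P' ((fun w => (fun i => X' i w)) @^-1` A).
Proof.
move=> [mX hX] [mX' hX'] mA.
pose Y : {mfun T >-> paths} := mfun_Sub (mem_set (measurable_path mX)).
pose Y' : {mfun T' >-> paths} := mfun_Sub (mem_set (measurable_path mX')).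
apply: (@measure_unique _ R paths cylinders (fun=> setT) (erefl _) cylindersI _ _ (distribution P Y) (distribution P' Y') _ _ A mA) => //.
- by move=> _; exact: cylindersT.
- by apply/seteqP; split => // x _; exists 0%N.
- move=> _ [s [B [us mB ->]]].
  have := hX s B us mB; rewrite -(hX' s B us mB); exact.
- by move=> _; exact: (le_lt_trans (@probability_le1 _ _ _ (distribution P Y) setT measurableT) (ltry _)).
Qed.

Lemma gaussian_family_coord d (T : measurableType d) (P : probability T R) X
  (mX : forall i, measurable_fun setT (X i)) :
  gaussian_family P X ->
  gaussian_family (distribution P (mfun_Sub (mem_set (measurable_path mX)))) (fun i (g : paths) => g i).
Proof.
move=> [_ hX]; split=> [i|s B us mB]; first exact: measurable_coord.
exact: hX.
Qed.

Lemma normal_probN (A : set R) : measurable A ->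
  normal_prob 0 1 (-%R @^-1` A) = normal_prob 0 1 A :> \bar R.
Proof.
move=> mA; rewrite /normal_prob.
have pdfN x : normal_pdf 0 1 (- x) = normal_pdf 0 1 x :> R.
  by rewrite !normal_pdfE ?oner_eq0 //= /normal_fun !subr0 sqrrN.
have -> : (\int[lebesgue_measure]_(x in A) (normal_pdf 0 1 x)%:E =
  \int[pushforward lebesgue_measure (-%R : _ -> measurableTypeR R)]_(x in A) (normal_pdf 0 1 x)%:E)%E.
  by apply: eq_measure_integral => B mB _; exact/esym/lebesgue_measureN.
rewrite ge0_integral_pushforward //=.
- by apply: eq_integral => x _; rewrite /= pdfN.
- by apply: measurable_funS (measurableT) _ _ => //; apply/measurable_EFinP; exact: measurable_normal_pdf.
- by move=> x _; rewrite lee_fin normal_pdf_ge0.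
Qed.

Lemma normal_prob_set1 (z : R) : normal_prob 0 1 [set z] = 0 :> \bar R.
Proof. by rewrite /normal_prob integral_set1. Qed.

Lemma gaussian_signed_perm (P : probability paths R) (eps : I -> bool) (pi : I -> I) :
  involutive pi ->
  gaussian_family P (fun i (g : paths) => g i) ->
  gaussian_family P (fun i (g : paths) => (-1) ^+ eps i * g (pi i)).
Proof.
move=> piK [_ h]; split=> [i|s B us mB].
  apply: measurable_funM; first exact: measurable_cst.
  exact: measurable_coord.
have msgn (b : bool) : measurable_fun setT (fun x : R => (-1) ^+ b * x).
  by apply: measurable_funM; [exact: measurable_cst|exact: measurable_id].
(* The event on the transformed entries is again a cylinder, over [map pi s]: [B'] moves each
   condition to the entry it constrains and undoes the sign. *)
pose B' j := (fun x => (-1) ^+ eps (pi j) * x) @^-1` (B (pi j)).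
have mB' j : measurable (B' j).
  by rewrite -[X in measurable X]setTI; exact: msgn.
have eB i : normal_prob 0 1 (B' (pi i)) = normal_prob 0 1 (B i) :> \bar R.
  rewrite /B' piK; case: (eps i).
    rewrite -[RHS]normal_probN //; congr (normal_prob _ _ _).
    by apply/seteqP; split => x /=; rewrite expr1 mulN1r.
  congr (normal_prob _ _ _).
  by apply/seteqP; split => x /=; rewrite expr0 mul1r.
have := h (map pi s) B'; rewrite map_inj_uniq; last exact: inv_inj.
move=> /(_ us mB'); rewrite big_map; under eq_bigr do rewrite eB.
move=> <-; congr (P _); apply/seteqP; split => g /= hg.
  by move=> _ /= /mapP[i si ->]; rewrite /B' /= piK; exact: hg.
move=> i /= si; have := hg (pi i); rewrite /= map_f // => /(_ isT).
by rewrite /B' /= piK.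
Qed.

Lemma gaussian_resample (P : probability paths R) (p : I) :
  gaussian_family P (fun i (g : paths) => g i) ->
  gaussian_family (P \x normal_prob 0 1)%E
    (fun i (gz : paths * R) => if i == p then gz.2 else gz.1 i).
Proof.
move=> [_ h]; split=> [i|s B us mB].
  case: (i == p); first exact: measurable_snd.
  by apply: (measurableT_comp (f := fun g : paths => g i)); [exact: measurable_coord|exact: measurable_fst].
(* If the cylinder does not look at p, the fresh coordinate is unconstrained; otherwise the
   condition at p falls on it and leaves the list. Both events are rectangles. *)
have [ps|ps] := boolP (p \in s); last first.
  have -> : \bigcap_(i in [set` s]) (fun gz : paths * R => if i == p then gz.2 else gz.1 i) @^-1` B i
     = (\bigcap_(i in [set` s]) (fun g : paths => g i) @^-1` B i) `*` setT.
    apply/seteqP; split => [[g z] hg|[g z] /= [hg _] i si]; last first.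
      rewrite /=; case: eqP => [ip|_]; last exact: hg.
      by move: ps; rewrite -ip si.
    split => // i si; have := hg i si; rewrite /=; case: eqP => // ip.
    by move: ps; rewrite -ip si.
  transitivity (P (\bigcap_(i in [set` s]) (fun g : paths => g i) @^-1` B i) * normal_prob 0 1 [set: R])%E.
    apply: product_measure1E => //.
    apply: fin_bigcap_measurable => // i _; rewrite -[X in measurable X]setTI.
    exact: measurable_coord.
  by rewrite probability_setT mule1 h.
have -> : \bigcap_(i in [set` s]) (fun gz : paths * R => if i == p then gz.2 else gz.1 i) @^-1` B i
   = (\bigcap_(i in [set` rem p s]) (fun g : paths => g i) @^-1` B i) `*` B p.
  apply/seteqP; split => [[g z] hg|[g z] /= [hg hz] i si]; last first.
    rewrite /=; case: eqP => [->//|/eqP ip].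
    by apply: hg; rewrite /= mem_rem_uniq // inE ip.
  split => [i|]; last by have := hg p ps; rewrite /= eqxx.
  rewrite /= mem_rem_uniq // inE => /andP[ip si].
  by have := hg i si; rewrite /= (negbTE ip).
transitivity (P (\bigcap_(i in [set` rem p s]) (fun g : paths => g i) @^-1` B i) * normal_prob 0 1 (B p))%E.
  apply: product_measure1E; last exact: mB.
  apply: fin_bigcap_measurable => // i _; rewrite -[X in measurable X]setTI.
  exact: measurable_coord.
rewrite h ?rem_uniq // [RHS](perm_big (p :: rem p s)) ?perm_to_rem //= big_cons muleC.
by [].
Qed.

(* Resampling the coordinate [p] does not change the law, so a set whose fibres
   along [p] have at most one point is negligible. *)
Lemma gaussian_fibre_null (P : probability paths R) (p : I) (A : set paths) :
  gaussian_family P (fun i (g : paths) => g i) -> measurable A ->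
  (forall g : paths, exists z0, forall z, A (fun i => if i == p then z else g i) -> z = z0) ->
  P A = 0.
Proof.
move=> gP mA hA.
have := gaussian_law gP (gaussian_resample p gP) mA.
have -> : (fun w : paths => (fun i => w i)) @^-1` A = A by [].
move=> ->; rewrite /= /product_measure1.
apply: integral0_eq => g _.
apply/eqP; rewrite eq_le measure_ge0 andbT.
have [z0 hz] := hA g.
rewrite -(normal_prob_set1 z0); apply: le_measure; rewrite ?inE //.
  apply: measurable_xsection.
  rewrite -[X in measurable X]setTI.
  exact: (measurable_path (gaussian_resample p gP).1).
by move=> z; rewrite /xsection /= inE /= => /hz ->.
Qed.

End GaussianPaths.

(** The determinant is affine in its last diagonal entry, with the leading minor as slope: the
    cofactors of the last row do not see that row. *)
Lemma det_corner (F : comPzRingType) m (A B : 'M[F]_m.+1) :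
  (forall i j, (i, j) != (ord_max, ord_max) -> A i j = B i j) ->
  \det A - \det B = (A ord_max ord_max - B ord_max ord_max) *
     \det (\matrix_(i < m, j < m) A (widen_ord (leqnSn m) i) (widen_ord (leqnSn m) j)).
Proof.
move=> hAB; rewrite !(expand_det_row _ ord_max) -sumrB (bigD1 ord_max) //= big1 ?addr0.
  have cof : cofactor A ord_max ord_max = cofactor B ord_max ord_max.
    rewrite /cofactor; congr (_ * \det _); apply/matrixP => i j; rewrite !mxE hAB //.
    by rewrite xpair_eqE negb_and (eq_sym _ ord_max) neq_lift.
  rewrite -cof -mulrBl; congr (_ * _).
  rewrite /cofactor addnn -signr_odd odd_double expr0 mul1r; congr (\det _).
  apply/matrixP => i j; rewrite !mxE; congr (A _ _); apply/val_inj; rewrite /= /bump leqNgt ltn_ord //.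
move=> j jm; rewrite hAB; last by rewrite xpair_eqE eqxx.
suff -> : cofactor A ord_max j = cofactor B ord_max j by rewrite subrr.
rewrite /cofactor; congr (_ * \det _); apply/matrixP => i l; rewrite !mxE hAB //.
by rewrite xpair_eqE negb_and (eq_sym _ ord_max) neq_lift.
Qed.

(** * Almost sure full rank of the blocks *)

Section FullRank.
Context {R : realType} {d k : nat}.
Hypothesis kd : (k <= d)%N.

Notation path := (@paths R (nat * 'I_d * 'I_k)%type).

Definition path_mx (g : path) (t : nat) : 'M[R]_(d, k) := \matrix_(i, j) g (t, i, j).

Lemma mx_measurable_path_mx t : mx_measurable (fun g : path => path_mx g t).
Proof.
move=> i j; have -> : (fun g : path => path_mx g t i j) = (fun g : path => g (t, i, j)).
  by apply/funext => g; rewrite mxE.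
exact: measurable_coord.
Qed.

(** For m = k, invertibility of this corner makes the whole block injective; smaller m serve the
    induction. *)
Definition leading (m : nat) (mk : (m <= k)%N) (t : nat) (g : path) : 'M[R]_m :=
  \matrix_(i, j) g (t, widen_ord (leq_trans mk kd) i, widen_ord mk j).

Lemma mx_measurable_leading m (mk : (m <= k)%N) t : mx_measurable (leading mk t).
Proof.
move=> i j; have -> : (fun g : path => leading mk t g i j) =
    (fun g : path => g (t, widen_ord (leq_trans mk kd) i, widen_ord mk j)).
  by apply/funext => g; rewrite mxE.
exact: measurable_coord.
Qed.

Lemma measurable_eq0 disp (T : measurableType disp) (h : T -> R) :
  measurable_fun setT h -> measurable [set w | h w = 0].
Proof.
by move=> mh; rewrite -[X in measurable X]setTI; exact: (mh measurableT [set 0] (measurable_set1 0)).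
Qed.

Variable (P : probability path R).
Hypothesis gP : gaussian_family P (fun i (g : path) => g i).

(** By induction on the size: where the smaller minor is nonzero, the determinant is affine in the
    corner entry with nonzero slope, so each fibre along that entry has at most one zero and
    [gaussian_fibre_null] applies. *)
Lemma leading_null m (mk : (m <= k)%N) t : P [set g | \det (leading mk t g) = 0] = 0%E.
Proof.
elim: m mk => [|m ih] mk.
  have -> : [set g | \det (leading mk t g) = 0] = set0; last by rewrite measure0.
  by apply/seteqP; split => // g /=; rewrite det_mx00 => /eqP; rewrite oner_eq0.
have mk' : (m <= k)%N := ltnW mk.
set p := (t, widen_ord (leq_trans mk kd) ord_max, widen_ord mk ord_max).
pose Z m (mk : (m <= k)%N) := [set g : path | \det (leading mk t g) = 0].
have mZ n (nk : (n <= k)%N) : measurable (Z n nk).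
  by apply: measurable_eq0; apply: measurable_det; exact: mx_measurable_leading.
have e0 : P (Z _ mk `\` Z _ mk') = 0%E.
  apply: (gaussian_fibre_null (p := p) gP); first exact: measurableD.
  move=> g.
  pose c := \det (leading mk' t g).
  pose gz z : path := fun i => if i == p then z else g i.
  have ec z : \det (leading mk' t (gz z)) = c.
    congr (\det _); apply/matrixP => i j; rewrite !mxE /gz /p.
    case: eqP => // -[im _].
    by have := ltn_ord i; rewrite im ltnn.
  have ed z : \det (leading mk t (gz z)) = \det (leading mk t (gz 0)) + z * c.
    apply/eqP; rewrite addrC -subr_eq; apply/eqP; rewrite det_corner.
      rewrite !mxE /gz !eqxx subr0 -(ec z); congr (_ * \det _).
      apply/matrixP => i j; rewrite !mxE; congr (gz z (_, _, _)); exact/val_inj.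
    move=> i j ij; rewrite !mxE /gz /p; case: eqP => // -[im jm].
    by case/eqP: ij; congr (_, _); apply/val_inj.
  (* If c = 0 the fibre of the set difference is empty, and any witness will do. *)
  have [c0|c0] := eqVneq c 0.
    by exists 0 => z [_] /=; rewrite -/(gz z) /Z /= ec c0.
  exists (- \det (leading mk t (gz 0)) / c) => z [h _].
  have : \det (leading mk t (gz z)) = 0 by [].
  rewrite (ed z) => {}h; apply: (mulIf c0); rewrite divfK //; apply/eqP; rewrite -addr_eq0 addrC; exact/eqP.
apply/eqP; rewrite eq_le measure_ge0 andbT.
have -> : [set g | \det (leading mk t g) = 0] = Z _ mk by [].
apply: (@le_trans _ _ (P ((Z _ mk `\` Z _ mk') `|` Z _ mk'))).
  apply: le_measure; rewrite ?inE //.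
    by apply: measurableU => //; exact: measurableD.
  by move=> g Zg; have [Zg'|Zg'] := pselect (Z _ mk' g); [right|left].
apply: (le_trans (measureU2 _ _ _)) => //; first exact: measurableD.
have l0 : (P (Z _ mk `\` Z _ mk') <= 0)%E by rewrite e0.
have l1 : (P (Z _ mk') <= 0)%E by rewrite (ih mk').
by rewrite -[leRHS]adde0; apply: leeD; [exact: l0|exact: l1].
Qed.

Definition full_rank : set path :=
  [set g | forall t, \det (leading (leqnn k) t g) != 0].

Lemma full_rankE : full_rank = ~` \bigcup_t [set g | \det (leading (leqnn k) t g) = 0].
Proof.
apply/seteqP; split => [g h [t _ /= e]|g h t]; first by have := h t; rewrite e eqxx.
by apply/eqP => e; apply: h; exists t.
Qed.

Lemma measurable_full_rank : measurable full_rank.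
Proof.
rewrite full_rankE; apply/measurableC/bigcupT_measurable => t.
by apply: measurable_eq0; apply: measurable_det; exact: mx_measurable_leading.
Qed.

Lemma full_rank_null : P (~` full_rank) = 0%E.
Proof.
rewrite full_rankE setCK; apply/eqP; rewrite eq_le measure_ge0 andbT.
apply: (le_trans (measure_sigma_subadditive _ _ _ (fun x h => h))) => //.
- move=> t; apply: measurable_eq0; apply: measurable_det; exact: mx_measurable_leading.
- apply: bigcupT_measurable => t.
  by apply: measurable_eq0; apply: measurable_det; exact: mx_measurable_leading.
by rewrite eseries0 // => t _ _; exact: leading_null.
Qed.

Lemma full_rank_inj g t (v : 'cV[R]_k) : full_rank g -> path_mx g t *m v = 0 -> v = 0.
Proof.
move=> /(_ t) fr e; have u : leading (leqnn k) t g \in unitmx by rewrite unitmxE unitfE.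
rewrite -[v](mulKmx u); have -> : leading (leqnn k) t g *m v = 0; last by rewrite mulmx0.
apply/matrixP => i j; move/matrixP: e => /(_ (widen_ord (leq_trans (leqnn k) kd) i) j).
rewrite !mxE => e; rewrite -[RHS]e; apply: eq_bigr => l _; rewrite !mxE.
by congr (g (_, _, _) * _); apply/val_inj.
Qed.

End FullRank.

(** * Expected contraction *)

Section BoundedExpectation.
Context {disp : measure_display} {T : measurableType disp} {R : realType}.
Variables (mu : {measure set T -> \bar R}) (D : set T).
Hypotheses (mD : measurable D) (muD : mu D = 1%E).

(** The bound is asked on [D] only: the iterates are controlled on regular paths and nowhere
    else. *)
Definition bounded_mfun (h : T -> R) :=
  measurable_fun setT h /\ exists C, forall w, D w -> `|h w| <= C.

Definition expec (h : T -> R) : R := \int[mu]_(w in D) h w.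

Lemma bounded_mfun_integrable h : bounded_mfun h -> mu.-integrable D (EFin \o h).
Proof.
move=> [mh [C hC]]; apply: measurable_bounded_integrable => //.
- by rewrite muD ltry.
- exact: measurable_funTS.
- exists C; split; first exact: num_real.
  by move=> x Cx w /hC /le_trans; apply; exact: ltW.
Qed.

Lemma bounded_mfun_cst c : bounded_mfun (fun=> c).
Proof. by split; [exact: measurable_cst|exists `|c|]. Qed.

Lemma bounded_mfunD h1 h2 : bounded_mfun h1 -> bounded_mfun h2 ->
  bounded_mfun (fun w => h1 w + h2 w).
Proof.
move=> [m1 [C1 b1]] [m2 [C2 b2]]; split; first exact: measurable_funD.
exists (C1 + C2) => w Dw; apply: le_trans (ler_normD _ _) _.
by apply: lerD; [exact: b1|exact: b2].
Qed.

Lemma bounded_mfunM h1 h2 : bounded_mfun h1 -> bounded_mfun h2 ->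
  bounded_mfun (fun w => h1 w * h2 w).
Proof.
move=> [m1 [C1 b1]] [m2 [C2 b2]]; split; first exact: measurable_funM.
exists (C1 * C2) => w Dw; rewrite normrM.
by apply: ler_pM => //; [exact: b1|exact: b2].
Qed.

Lemma bounded_mfunZ c h : bounded_mfun h -> bounded_mfun (fun w => c * h w).
Proof. by move=> bh; apply: bounded_mfunM => //; exact: bounded_mfun_cst. Qed.

Lemma bounded_mfun_sum I (s : seq I) (h : I -> T -> R) :
  (forall i, bounded_mfun (h i)) -> bounded_mfun (fun w => \sum_(i <- s) h i w).
Proof.
move=> bh; elim: s => [|i s ih].
  by under eq_fun do rewrite big_nil; exact: bounded_mfun_cst.
by under eq_fun do rewrite big_cons; exact: bounded_mfunD.
Qed.

Lemma expec_cst c : expec (fun=> c) = c.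
Proof. by rewrite /expec Rintegral_cst // muD mulr1. Qed.

Lemma expecD h1 h2 : bounded_mfun h1 -> bounded_mfun h2 ->
  expec (fun w => h1 w + h2 w) = expec h1 + expec h2.
Proof. by move=> b1 b2; apply: RintegralD => //; exact: bounded_mfun_integrable. Qed.

Lemma expecZ c h : bounded_mfun h -> expec (fun w => c * h w) = c * expec h.
Proof. by move=> b; apply: RintegralZl => //; exact: bounded_mfun_integrable. Qed.

Lemma expec_sum I (s : seq I) (h : I -> T -> R) :
  (forall i, bounded_mfun (h i)) ->
  expec (fun w => \sum_(i <- s) h i w) = \sum_(i <- s) expec (h i).
Proof.
move=> bh; elim: s => [|i s ih].
  by rewrite big_nil; under [X in expec X]eq_fun do rewrite big_nil; exact: expec_cst.
rewrite big_cons -ih -expecD //; last exact: bounded_mfun_sum.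
by congr expec; apply/funext => w; rewrite big_cons.
Qed.

Lemma expec_le h1 h2 : bounded_mfun h1 -> bounded_mfun h2 ->
  (forall w, D w -> h1 w <= h2 w) -> expec h1 <= expec h2.
Proof. by move=> b1 b2 h; apply: le_Rintegral => //; exact: bounded_mfun_integrable. Qed.

Lemma expec_eq h1 h2 : (forall w, D w -> h1 w = h2 w) -> expec h1 = expec h2.
Proof. by move=> h; apply: eq_Rintegral => w /set_mem; exact: h. Qed.

Lemma expec_invariant (tau : T -> T) h : measurable_fun setT tau ->
  (forall A, measurable A -> mu (tau @^-1` A) = mu A) -> tau @^-1` D = D ->
  bounded_mfun h -> expec (h \o tau) = expec h.
Proof.
move=> mt inv Dt [mh [C hC]].
have mEh : measurable_fun setT (EFin \o h) by exact/measurable_EFinP.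
have bt : bounded_mfun (h \o tau).
  split; first exact: measurableT_comp.
  exists C => w Dw; apply: hC.
  by rewrite -[D (tau w)]/((tau @^-1` D) w) Dt.
have it : mu.-integrable (tau @^-1` D) ((EFin \o h) \o tau).
  rewrite Dt; exact: (bounded_mfun_integrable bt).
have := integral_pushforward mt mEh it mD.
rewrite Dt => e.
rewrite /expec /Rintegral -[in LHS]e; congr fine.
by apply: eq_measure_integral => A mA _; exact: inv.
Qed.

End BoundedExpectation.

(** * Row symmetries of a block *)

Section RowActions.
Context {R : realType} {d k : nat}.
Notation path := (@paths R (nat * 'I_d * 'I_k)%type).
Variables (t0 : nat) (pi : 'I_d -> 'I_d) (eps : 'I_d -> bool).
Hypothesis piK : involutive pi.

Definition row_act_index (p : nat * 'I_d * 'I_k) : nat * 'I_d * 'I_k :=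
  if p.1.1 == t0 then (p.1.1, pi p.1.2, p.2) else p.

(** Row i of block [t0] becomes row [pi i] up to the sign [eps i]; all other blocks stay, so the
    states up to time [t0] are not affected. *)
Definition row_act (g : path) : path :=
  fun p => (-1) ^+ ((p.1.1 == t0) && eps p.1.2) * g (row_act_index p).

Lemma row_act_indexK : involutive row_act_index.
Proof.
move=> [[t i] j]; rewrite /row_act_index /=; case tt0: (t == t0) => /=; rewrite tt0 //=.
by rewrite piK.
Qed.

Lemma row_act_other g t : t != t0 -> path_mx (row_act g) t = path_mx g t.
Proof.
move=> tt0; apply/matrixP => i j; rewrite !mxE /row_act /row_act_index /= (negbTE tt0).
by rewrite expr0 mul1r.
Qed.

Lemma row_act_same g i j : path_mx (row_act g) t0 i j = (-1) ^+ eps i * path_mx g t0 (pi i) j.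
Proof. by rewrite !mxE /row_act /row_act_index /= eqxx. Qed.

(** A signed permutation of the rows is an orthogonal transformation. *)
Lemma row_act_gram g t :
  (path_mx (row_act g) t)^T *m path_mx (row_act g) t = (path_mx g t)^T *m path_mx g t.
Proof.
have [->|tt0] := eqVneq t t0; last by rewrite row_act_other.
apply/matrixP => a b; rewrite !mxE [RHS](reindex_inj (inv_inj piK)).
apply: eq_bigr => i _; rewrite ![(path_mx _ _)^T _ _]mxE !row_act_same.
rewrite mulrACA -expr2 sqrr_sign mul1r //.
Qed.

Lemma row_act_proj g i j : row_proj (path_mx (row_act g) t0) i j =
  (-1) ^+ eps i * (-1) ^+ eps j * row_proj (path_mx g t0) (pi i) (pi j).
Proof.
rewrite /row_proj row_act_gram; set N := invmx _.
have e (V : 'M[R]_(d, k)) a b : (V *m N *m V^T) a b = \sum_c (\sum_c' V a c' * N c' c) * V b c.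
  by rewrite !mxE; apply: eq_bigr => c _; rewrite !mxE.
rewrite !e mulr_sumr; apply: eq_bigr => c _; rewrite row_act_same.
under eq_bigr do rewrite row_act_same -mulrA.
by rewrite -mulr_sumr mulrACA.
Qed.

Lemma measurable_row_act : measurable_fun setT row_act.
Proof.
apply: (measurable_path (X := fun p (g : path) => (-1) ^+ ((p.1.1 == t0) && eps p.1.2) * g (row_act_index p))).
move=> p; apply: measurable_funM; first exact: measurable_cst.
exact: measurable_coord.
Qed.

Lemma row_act_law (P : probability path R) :
  gaussian_family P (fun i (g : path) => g i) ->
  forall A, measurable A -> P (row_act @^-1` A) = P A.
Proof.
move=> gP A mA.
have gP' := gaussian_signed_perm (fun p => (p.1.1 == t0) && eps p.1.2) row_act_indexK gP.
exact: (gaussian_law gP' gP mA).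
Qed.

End RowActions.

Section Regular.
Context {R : realType} {d k : nat}.
Notation path := (@paths R (nat * 'I_d * 'I_k)%type).

(** Stated with Gram matrices so that the row actions preserve it; [full_rank], which singles out
    the first k rows, does not suit the change of variables. *)
Definition regular : set path :=
  [set g | forall t, \det ((path_mx g t)^T *m path_mx g t) != 0].

Lemma regularE : regular = ~` \bigcup_t [set g : path | \det ((path_mx g t)^T *m path_mx g t) = 0].
Proof.
apply/seteqP; split => [g h [t _ /= e]|g h t]; first by have := h t; rewrite e eqxx.
by apply/eqP => e; apply: h; exists t.
Qed.

Lemma measurable_regular : measurable regular.
Proof.
rewrite regularE; apply/measurableC/bigcupT_measurable => t.
apply: measurable_eq0; apply: measurable_det.
by apply: mx_measurableM; [apply: mx_measurable_tr|]; exact: mx_measurable_path_mx.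
Qed.

Lemma regular_inj g t (v : 'cV[R]_k) : regular g -> path_mx g t *m v = 0 -> v = 0.
Proof.
move=> /(_ t) fr e; have u : (path_mx g t)^T *m path_mx g t \in unitmx by rewrite unitmxE unitfE.
by rewrite -[v](mulKmx u) -mulmxA e !mulmx0.
Qed.

Lemma regular_row_act t0 pi eps : involutive pi ->
  row_act t0 pi eps @^-1` regular = regular.
Proof.
by move=> piK; apply/seteqP; split => g h t; have := h t; rewrite (row_act_gram t0 eps piK).
Qed.

Variable P : probability path R.
Hypothesis gP : gaussian_family P (fun i (g : path) => g i).
Hypothesis kd : (k <= d)%N.

Lemma regular_null : P (~` regular) = 0%E.
Proof.
apply/eqP; rewrite eq_le measure_ge0 andbT -(full_rank_null kd gP).
apply: le_measure; rewrite ?inE; [exact: measurableC measurable_regular|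
  exact: measurableC (measurable_full_rank kd)|].
apply: subsetC => g fr t; rewrite -unitfE -unitmxE.
apply: pdmx_unit; rewrite -[(path_mx g t)^T]mulmx1.
by apply: pdmx_congr => [|v]; [exact: pdmx1|exact: full_rank_inj fr].
Qed.

Lemma regular_prob : P regular = 1%E.
Proof.
have := probability_setC P measurable_regular.
rewrite regular_null => /esym/eqP; rewrite sube_eq ?fin_num_measure ?fin_num_adde_defr //.
by rewrite add0e => /eqP <-.
Qed.

End Regular.

(** * Scalar inequalities *)

Section Scalars.
Context {R : realType}.

Lemma psdmx_entry_le n (E : 'M[R]_n) i j : psdmx E -> `|E i j| <= \tr E.
Proof.
move=> pE; have h l : 0 <= E l l by rewrite -bform_delta; exact: pE.2.
have ht l : E l l <= \tr E by rewrite /mxtrace (bigD1 l) //= lerDl sumr_ge0.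
apply: ler_norm_of_sqr; first exact: psdmx_trace_ge0.
have := cauchy_schwarz (delta_mx i 0) (delta_mx j 0) pE.
rewrite !qformE !bform_delta => /le_trans; apply.
by rewrite expr2; apply: ler_pM.
Qed.

(** Used with a = 1 - k/d, D = d and q = d^2 / (d - k). The relation 2 D = 2 q a factors a out of
    the second term as well, and (1 + m)^2 + 2 q m (1 + m/2) <= (1 + (1 + q) m)^2 yields the
    exponential. *)
Lemma contraction_scalar (a D q m l gap : R) : 0 < a -> 0 < D -> 0 <= q -> 2 * D = 2 * q * a ->
  1 <= 2 * D -> 0 <= m -> m <= l -> 0 <= gap ->
  a * ((1 + m) ^+ 2 * (gap + D) - D) + 2 * D * ((1 + m / 2) * (gap + m) * m)
    <= a * expR ((2 + 2 * q) * l) * (gap + 2 * D * m).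
Proof.
move=> a0 D0 q0 eD D1 m0 ml g0.
set Th := gap + 2 * D * m.
have Th0 : 0 <= Th by rewrite addr_ge0 // !mulr_ge0 // ltW.
(* This is what the weight 2 D of m in [Th] is for: (1 + m)^2 - 1 <= 2 m (1 + m)^2. *)
have h1 : (1 + m) ^+ 2 * (gap + D) - D <= (1 + m) ^+ 2 * Th.
  rewrite /Th -subr_ge0.
  have -> : (1 + m) ^+ 2 * (gap + 2 * D * m) - ((1 + m) ^+ 2 * (gap + D) - D) =
    D * m ^+ 2 * (3 + 2 * m) by ring.
  by rewrite !mulr_ge0 ?addr_ge0 ?exprn_ge0 ?mulr_ge0 // ltW.
have h2 : (1 + m / 2) * (gap + m) * m <= (1 + m / 2) * Th * m.
  apply: ler_wpM2r => //; apply: ler_wpM2l; first by rewrite addr_ge0 // divr_ge0.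
  by rewrite /Th lerD2l; apply: ler_peMl.
have h3 : (1 + m) ^+ 2 + 2 * q * (m * (1 + m / 2)) <= expR ((2 + 2 * q) * l).
  apply: (@le_trans _ _ (expR ((2 + 2 * q) * m))); last first.
    by rewrite ler_expR; apply: ler_wpM2l => //; rewrite addr_ge0 // mulr_ge0.
  have -> : (2 + 2 * q) * m = (1 + q) * m + (1 + q) * m by ring.
  rewrite expRD -expr2.
  have h : 0 <= 1 + (1 + q) * m by rewrite addr_ge0 // mulr_ge0 // addr_ge0.
  apply: (@le_trans _ _ ((1 + (1 + q) * m) ^+ 2)); last first.
    by rewrite ler_sqr ?nnegrE ?expR_ge0 //; exact: expR_ge1Dx.
  rewrite -subr_ge0.
  have -> : (1 + (1 + q) * m) ^+ 2 - ((1 + m) ^+ 2 + 2 * q * (m * (1 + m / 2))) = q * (1 + q) * m ^+ 2.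
    by field.
  by rewrite !mulr_ge0 ?addr_ge0 ?exprn_ge0.
apply: (@le_trans _ _ (a * (((1 + m) ^+ 2 + 2 * q * (m * (1 + m / 2))) * Th))); last first.
  by rewrite -[leRHS]mulrA; apply: ler_wpM2l; [exact: ltW|exact: ler_wpM2r].
have -> : a * (((1 + m) ^+ 2 + 2 * q * (m * (1 + m / 2))) * Th) =
   a * ((1 + m) ^+ 2 * Th) + 2 * D * ((1 + m / 2) * Th * m) by rewrite eD; ring.
apply: lerD; first by apply: ler_wpM2l => //; exact: ltW.
by apply: ler_wpM2l => //; apply: mulr_ge0 => //; exact: ltW.
Qed.

Lemma block_ratio_le (d k : nat) : (1 <= k)%N -> (k < d)%N ->
  (d%:R - k%:R) / d%:R ^+ 2 <= 4^-1 :> R.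
Proof.
move=> k1 kd; have d0 : 0 < (d%:R : R) by rewrite ltr0n; exact: leq_ltn_trans kd.
rewrite ler_pdivrMr ?exprn_gt0 //.
have k1R : 1 <= k%:R :> R by rewrite ler1n.
have := sqr_ge0 (d%:R - 2 : R); rewrite sqrrB; nra.
Qed.

(** The origin of the constant 1/16 in the crude rate: ln 2 <= 1, and d - k <= d - 1 <= d^2 / 4. *)
Lemma ln2_block_ratio_le (d k : nat) : (1 <= k)%N -> (k < d)%N ->
  ln 2 / 4 * ((d%:R - k%:R) / d%:R ^+ 2) <= 16^-1 :> R.
Proof.
move=> k1 kd; have ln0 : 0 <= ln (2 : R) / 4 by rewrite divr_ge0 // ln_ge0 // ler1n.
have ln1 : ln (2 : R) <= 1 by have := @le_ln1Dx R 1; rewrite -[1 + 1]/(2 : R) => ->.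
have := ler_wpM2l ln0 (block_ratio_le k1 kd); lra.
Qed.

End Scalars.

(** * Contraction of the potential in expectation *)

Section ExpectedContraction.
Context {R : realType} {d k : nat}.
Notation path := (@paths R (nat * 'I_d * 'I_k)%type).
Variables (H : 'cV[R]_d -> 'M[R]_d) (g : 'cV[R]_d -> 'cV[R]_d) (M : R).
Hypothesis pdH : forall x, pdmx (H x).
Hypothesis M0 : 0 <= M.
Hypothesis scH : forall x y z w : 'cV[R]_d,
  loewner_le (H y - H x) ((M * lnorm H z (y - x)) *: H w).
Hypothesis mvt : forall u x s, exists2 t : R, 0 <= t <= 1 &
  bform 1%:M u (g (x + s)) - bform 1%:M u (g x) = bform (H (x + t *: s)) u s.
Hypothesis mH : forall x : path -> 'cV[R]_d, mx_measurable x -> mx_measurable (fun w => H (x w)).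
Hypothesis mg : forall x : path -> 'cV[R]_d, mx_measurable x -> mx_measurable (fun w => g (x w)).
Variables (s0 : @bfgs_state R d) (eta0 e0 : R).
Hypotheses (eta1 : 1 <= eta0) (s0_good : state_good H eta0 s0).
Hypotheses (lam0 : M * state_lam H g s0 <= e0) (e0eta : e0 * eta0 <= 16^-1).
Hypotheses (k1 : (1 <= k)%N) (kd : (k < d)%N).
Variable P : probability path R.
Hypothesis gP : gaussian_family P (fun i (w : path) => w i).

Notation E := (expec P regular).
Let mD := @measurable_regular R d k.
Let PD : P regular = 1%E. Proof. exact: regular_prob gP (ltnW kd). Qed.
Let e00 : 0 <= e0. Proof. by apply: le_trans lam0; apply: mulr_ge0 => //; exact: state_lam_ge0. Qed.

Definition path_state t (w : path) := qn_run H g M s0 (path_mx w) t.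
Notation st := path_state.
Notation gap t w := (state_gap H (st t w)).
Notation lam t w := (M * state_lam H g (st t w)).
Notation W t w := (state_weight H g M (st t w)).
Definition path_proj t (w : path) : 'M[R]_d := row_proj (path_mx w t).
Notation Pi t w := (path_proj t w).
Notation bm := (bounded_mfun regular).
Notation eb t := (eta_bound eta0 e0 t).
Notation lb t := (lam_bound eta0 e0 t).

Lemma path_state_measurable t : state_measurable (st t).
Proof.
apply: state_measurable_run => // n; exact: mx_measurable_path_mx.
Qed.

Lemma path_bounds t w : regular w -> state_good H (eb t) (st t w) /\ lam t w <= lb t.
Proof.
move=> rw; apply: (run_bounds pdH M0 scH mvt eta1 s0_good lam0 e0eta).
by move=> n v; exact: regular_inj.
Qed.

Let eb1 t : 1 <= eb t. Proof. exact: eta_bound_ge1. Qed.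

Lemma path_lam_ge0 t w : 0 <= lam t w.
Proof. by apply: mulr_ge0 => //; exact: state_lam_ge0. Qed.

Lemma path_gap_ge0 t w : regular w -> 0 <= gap t w.
Proof. by move=> /(path_bounds t)[[_ HG _ _] _]; exact: trace_gap_ge0. Qed.

Lemma bm_gap t : bm (fun w : path => gap t w).
Proof.
split; first exact: measurable_state_gap (path_state_measurable t).
exists (d%:R * (eb t - 1)) => w rw; rewrite ger0_norm ?path_gap_ge0 //.
by have [[_ _ GH _] _] := path_bounds t rw; exact: trace_gap_le.
Qed.

Lemma bm_lam t : bm (fun w : path => lam t w).
Proof.
split.
  apply: measurable_funM; first exact: measurable_cst.
  exact: measurable_state_lam (path_state_measurable t).
exists (lb t) => w rw; rewrite ger0_norm ?path_lam_ge0 //.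
by have [] := path_bounds t rw.
Qed.

Lemma path_weight_bounds t w : regular w ->
  psdmx (W t w) /\ \tr (W t w) <= (1 + lam t w) ^+ 2 * (gap t w + d%:R).
Proof. by move=> /(path_bounds t)[gs _]; exact: (state_weight_bounds pdH M0 scH mvt gs (eb1 t)). Qed.

Lemma bm_weight t i j : bm (fun w : path => W t w i j).
Proof.
have mW : mx_measurable (fun w : path => W t w).
  by apply: mx_measurable_weight => //; exact: path_state_measurable.
split; first exact: mW.
exists ((1 + lb t) ^+ 2 * (d%:R * (eb t - 1) + d%:R)) => w rw.
have [pW tW] := path_weight_bounds t rw.
apply: le_trans (psdmx_entry_le i j pW) _; apply: le_trans tW _.
have [[_ _ GH _] ml] := path_bounds t rw.
have m0 := path_lam_ge0 t w.
apply: ler_pM; first exact: sqr_ge0.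
- by apply: addr_ge0 => //; exact: path_gap_ge0.
- by rewrite ler_sqr ?nnegrE ?addr_ge0 ?lerD2l //; exact: le_trans m0 ml.
- by rewrite lerD2r; exact: trace_gap_le.
Qed.

Lemma path_proj_trace t w : regular w -> \tr (Pi t w) = k%:R.
Proof.
move=> rw; rewrite /path_proj /row_proj mxtrace_mulC mulmxA mulmxV ?mxtrace1 //.
by rewrite unitmxE unitfE.
Qed.

Lemma path_proj_psd t w : regular w -> psdmx (Pi t w).
Proof.
move=> rw; have u : (path_mx w t)^T *m path_mx w t \in unitmx by rewrite unitmxE unitfE.
have pN := pdmx_inv (psdmx_unit_pd (psdmx_tr_mul (path_mx w t)) u).
by have := psdmx_congr (path_mx w t)^T (pdmx_psd pN); rewrite trmxK.
Qed.

Lemma bm_proj t i j : bm (fun w : path => Pi t w i j).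
Proof.
split.
  have mV := @mx_measurable_path_mx R d k t.
  have mVt := mx_measurable_tr mV.
  have mN : mx_measurable (fun w : path => invmx ((path_mx w t)^T *m path_mx w t)).
    by apply: mx_measurable_inv; exact: mx_measurableM.
  exact: (mx_measurableM (mx_measurableM mV mN) mVt).
exists k%:R => w rw; rewrite -(path_proj_trace t rw).
exact: psdmx_entry_le (path_proj_psd t rw).
Qed.

Lemma path_weight_row_act t pi eps w : W t (row_act t pi eps w) = W t w.
Proof.
congr (state_weight _ _ _ _); apply: qn_run_ext => s st.
by apply: row_act_other; rewrite ltn_eqF.
Qed.

Lemma expec_row_act t pi eps h : involutive pi -> bm h -> E (h \o row_act t pi eps) = E h.
Proof.
move=> piK bh; apply: expec_invariant => //.
- exact: measurable_row_act.
- by move=> A mA; exact: (row_act_law t eps piK gP).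
- exact: regular_row_act.
Qed.

(** Flipping the sign of row i of block t reverses Pi_ji, keeps the weight and keeps the law, so the
    expectation equals its opposite. *)
Lemma expec_weight_proj_offdiag t i j : i != j -> E (fun w : path => W t w i j * Pi t w j i) = 0.
Proof.
move=> ij; pose h (w : path) := W t w i j * Pi t w j i; rewrite -/h.
have bh : bm h by apply: bounded_mfunM; [exact: bm_weight|exact: bm_proj].
have := expec_row_act t (pi := id) (fun l => l == i) (fun x => erefl) bh.
have -> : h \o row_act t id (fun l => l == i) = fun w => -1 * h w.
  apply/funext => w; rewrite /h /= path_weight_row_act /path_proj row_act_proj //.
  by rewrite eqxx eq_sym (negbTE ij) expr0 expr1 mul1r mulN1r mulrN mulN1r.
by rewrite (expecZ mD PD _ bh) => e; lra.
Qed.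

(** Exchanging rows i and j of block t exchanges the two diagonal entries of Pi while the weight
    stays. *)
Lemma expec_weight_proj_diag t i j :
  E (fun w : path => W t w i i * Pi t w j j) = E (fun w : path => W t w i i * Pi t w i i).
Proof.
pose h (w : path) := W t w i i * Pi t w i i; rewrite -[in RHS]/h.
have bh : bm h by apply: bounded_mfunM; [exact: bm_weight|exact: bm_proj].
rewrite -(expec_row_act t (pi := tperm i j) (fun=> false) (tpermK i j) bh).
congr expec; apply/funext => w; rewrite /h /= path_weight_row_act /path_proj row_act_proj; last exact: tpermK.
by rewrite tpermL expr0 !mul1r.
Qed.

Let d0 : (d%:R : R) != 0.
Proof. by rewrite pnatr_eq0 -lt0n; exact: leq_ltn_trans kd. Qed.

Lemma bm_weight_trace t : bm (fun w : path => \tr (W t w)).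
Proof. by apply: bounded_mfun_sum => i; exact: bm_weight. Qed.

Lemma bm_weight_proj t i j l m : bm (fun w : path => W t w i j * Pi t w l m).
Proof. by apply: bounded_mfunM; [exact: bm_weight|exact: bm_proj]. Qed.

(** For each i, the d expectations of W_ii Pi_jj are equal, and they add up to k E W_ii because Pi
    has trace k. *)
Lemma expec_weight_proj t :
  E (fun w : path => \tr (W t w *m Pi t w)) = k%:R / d%:R * E (fun w : path => \tr (W t w)).
Proof.
have -> : (fun w => \tr (W t w *m Pi t w)) = (fun w => \sum_i \sum_j W t w i j * Pi t w j i).
  by apply/funext => w; apply: eq_bigr => i _; rewrite mxE.
rewrite (expec_sum mD PD); last by move=> i; apply: bounded_mfun_sum => j; exact: bm_weight_proj.
rewrite (expec_sum mD PD); last by move=> i; exact: bm_weight.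
rewrite mulr_sumr; apply: eq_bigr => i _.
rewrite (expec_sum mD PD); last by move=> j; exact: bm_weight_proj.
rewrite (bigD1 i) //= big1 ?addr0; last first.
  by move=> j ji; apply: expec_weight_proj_offdiag; rewrite eq_sym.
apply: (mulfI d0); transitivity (k%:R * E (fun w : path => W t w i i)); last by field.
rewrite -(expecZ mD PD k%:R (bm_weight t i i)).
transitivity (\sum_j E (fun w : path => W t w i i * Pi t w j j)).
  under eq_bigr do rewrite expec_weight_proj_diag.
  by rewrite sumr_const card_ord mulr_natl.
rewrite -(expec_sum mD PD); last by move=> j; exact: bm_weight_proj.
apply: expec_eq => w rw; rewrite -mulr_sumr mulrC; congr (_ * _).
exact: path_proj_trace.
Qed.

Let kap : R := 1 - k%:R / d%:R.

Lemma expec_gap_step t : E (fun w : path => gap t.+1 w) = kap * (E (fun w : path => \tr (W t w)) - d%:R).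
Proof.
have bWP : bm (fun w : path => \tr (W t w *m Pi t w)).
  apply: bounded_mfun_sum => i.
  have -> : (fun w : path => (W t w *m Pi t w) i i) = fun w : path => \sum_j W t w i j * Pi t w j i.
    by apply/funext => w; rewrite mxE.
  by apply: bounded_mfun_sum => j; exact: bm_weight_proj.
have bW := bm_weight_trace t.
transitivity (E (fun w : path => \tr (W t w) + (-1 * \tr (W t w *m Pi t w) + (k%:R - d%:R)))).
  apply: expec_eq => w rw; have [gs _] := path_bounds t rw.
  have [_ _ _ ->] := qn_step_bounds pdH M0 scH mvt gs (eb1 t) (fun v => @regular_inj R d k w t v rw).
  by rewrite mulN1r !addrA.
have bN : bm (fun w : path => -1 * \tr (W t w *m Pi t w)) by exact: bounded_mfunZ.
have bC : bm (fun w : path => k%:R - d%:R : R) by exact: bounded_mfun_cst.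
rewrite (expecD mD PD bW (bounded_mfunD bN bC)) (expecD mD PD bN bC) (expecZ mD PD _ bWP).
rewrite [X in _ + (_ + X)](expec_cst mD PD) [X in -1 * X](expec_weight_proj t) /kap.
by field.
Qed.

(* The potential whose expectation decreases by 1 - k/d at each step, up to a factor
   exp (O (lambda_t)). *)
Definition path_theta t w : R := gap t w + 2 * d%:R * lam t w.

Lemma bm_theta t : bm (path_theta t).
Proof.
apply: bounded_mfunD; first exact: bm_gap.
by apply: bounded_mfunZ; exact: bm_lam.
Qed.

(** Chosen so that q (1 - k/d) = d. It is also the inverse of the ratio (d - k) / d^2 in the
    hypothesis on lambda(x_0), so the product of the two disappears from the final exponent. *)
Let q : R := d%:R ^+ 2 / (d%:R - k%:R).

Let dk : 0 < (d%:R - k%:R : R). Proof. by rewrite subr_gt0 ltr_nat. Qed.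

Let dpos : 0 < (d%:R : R). Proof. by rewrite ltr0n; exact: leq_ltn_trans kd. Qed.

Let kap0 : 0 < kap.
Proof. by rewrite subr_gt0 ltr_pdivrMr // mul1r ltr_nat. Qed.

(** The gap is replaced through its exact expectation, the lambda term by its bound on each path;
    under one expectation both are then compared pointwise by [contraction_scalar], whose exponent
    involves only the deterministic [lam_bound]. *)
Lemma expec_theta_step t : E (path_theta t.+1) <= kap * expR ((2 + 2 * q) * lb t) * E (path_theta t).
Proof.
have bg := bm_gap; have bl := bm_lam; have bW := bm_weight_trace t.
have bT := bm_theta t.
have b1 : bm (fun w : path => \tr (W t w) + - d%:R) by apply: bounded_mfunD => //; exact: bounded_mfun_cst.
have b2 : bm (fun w : path => 2 * d%:R * lam t.+1 w) by exact: bounded_mfunZ.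
have b3 : bm (fun w : path => kap * (\tr (W t w) + - d%:R)) by exact: bounded_mfunZ.
have -> : E (path_theta t.+1) = E (fun w : path => kap * (\tr (W t w) + - d%:R) + 2 * d%:R * lam t.+1 w).
  rewrite (expecD mD PD b3 b2) /path_theta (expecD mD PD (bg _) b2); congr (_ + _).
  rewrite expec_gap_step (expecZ mD PD _ b1) (expecD mD PD bW) ?(expec_cst mD PD) //.
  exact: bounded_mfun_cst.
rewrite -(expecZ mD PD _ bT); apply: (expec_le mD PD); first exact: bounded_mfunD.
  exact: bounded_mfunZ.
move=> w rw.
have [gs ml] := path_bounds t rw.
have [_ _ n2 _] := qn_step_bounds pdH M0 scH mvt gs (eb1 t) (fun v => @regular_inj R d k w t v rw).
have [_ tW] := path_weight_bounds t rw.
have g0 := path_gap_ge0 t rw; have m0 := path_lam_ge0 t w.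
have q0 : 0 <= q by rewrite divr_ge0 ?exprn_ge0 // ltW.
have eq2 : 2 * d%:R = 2 * q * kap.
  by rewrite /q /kap; field; rewrite d0 gt_eqF.
have d1 : 1 <= 2 * d%:R :> R by rewrite -natrM ler1n muln_gt0 /=; exact: leq_ltn_trans kd.
apply: le_trans (contraction_scalar kap0 dpos q0 eq2 d1 m0 ml g0).
apply: lerD; first by apply: ler_wpM2l; [exact: ltW|rewrite lerB].
apply: ler_wpM2l; first by rewrite mulr_ge0 // ltW.
have := ler_wpM2l M0 n2; move/le_trans; apply.
by rewrite mulrCA.
Qed.

Lemma expec_theta t :
  E (path_theta t) <= kap ^+ t * expR ((2 + 2 * q) * lam_sum eta0 e0 t) * (d%:R * eta0).
Proof.
elim: t => [|t ih].
  rewrite expr0 mul1r /lam_sum big_ord0 mulr0 expR0 mul1r -[leRHS](expec_cst mD PD).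
  apply: (expec_le mD PD); [exact: bm_theta|exact: bounded_mfun_cst|move=> w rw].
  rewrite /path_theta /path_state /=.
  have := @trace_gap_le R d H pdH eta0 (state_x s0) (state_G s0).
  case: s0_good => _ _ GH _ => /(_ GH); rewrite -/(state_gap H s0) => h.
  (* Then 2 d m_0 <= d, which is compensated by the - d in the bound d (eta0 - 1) on the initial
     gap. *)
  have e1 : e0 <= 2^-1.
    have := e0eta; have := e00; have := eta1; nra.
  have h2 : 2 * d%:R * (M * state_lam H g s0) <= 2 * d%:R * 2^-1.
    by apply: ler_wpM2l; [rewrite mulr_ge0 // ltW|exact: le_trans lam0 e1].
  rewrite mulrBr mulr1 in h.
  have -> : d%:R * eta0 = (d%:R * eta0 - d%:R) + 2 * d%:R * 2^-1 :> R by field.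
  exact: lerD.
apply: le_trans (expec_theta_step t) _.
rewrite /lam_sum big_ord_recr /= -/(lam_sum eta0 e0 t) mulrDr expRD exprS.
set A := expR (_ * lb t); set B := expR _.
have -> : kap * kap ^+ t * (B * A) * (d%:R * eta0) = kap * A * (kap ^+ t * B * (d%:R * eta0)) by ring.
by apply: ler_wpM2l => //; rewrite mulr_ge0 ?expR_ge0 // ltW.
Qed.

Definition path_ratio t w : R := state_lam H g (st t.+1 w) / state_lam H g (st t w).

Lemma path_ratio_le t w : regular w -> path_ratio t w <= (1 + e0 / 2) * path_theta t w.
Proof.
move=> rw; have [gs ml] := path_bounds t rw.
have [_ _ n2 _] := qn_step_bounds pdH M0 scH mvt gs (eb1 t) (fun v => @regular_inj R d k w t v rw).
have g0 := path_gap_ge0 t rw; have m0 := path_lam_ge0 t w.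
have me : lam t w <= e0 by apply: le_trans ml _; exact: lam_bound_le.
have d1 : 1 <= 2 * d%:R :> R by rewrite -natrM ler1n muln_gt0 /=; exact: leq_ltn_trans kd.
have T0 : 0 <= path_theta t w by rewrite addr_ge0 // mulr_ge0 // mulr_ge0.
have h1 : (1 + lam t w / 2) * (gap t w + lam t w) <= (1 + e0 / 2) * path_theta t w.
  apply: ler_pM.
  - by rewrite addr_ge0 // divr_ge0.
  - by rewrite addr_ge0.
  - by rewrite lerD2l ler_pM2r.
  - by rewrite /path_theta lerD2l ler_peMl.
(* When lambda(x_t) = 0 the ratio is 0 by the convention on inverses. *)
have [l0|l0] := eqVneq (state_lam H g (st t w)) 0.
  by rewrite /path_ratio l0 invr0 mulr0 mulr_ge0 // addr_ge0 // divr_ge0.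
have lp : 0 < state_lam H g (st t w) by rewrite lt_neqAle eq_sym l0; exact: state_lam_ge0.
rewrite /path_ratio ler_pdivrMr //; apply: le_trans n2 _.
by apply: ler_wpM2r => //; exact: ltW.
Qed.

Lemma path_ratio_ge0 t w : 0 <= path_ratio t w.
Proof. by apply: divr_ge0; exact: state_lam_ge0. Qed.

Lemma measurable_path_ratio t : measurable_fun setT (path_ratio t).
Proof.
apply: measurable_funM; first exact: measurable_state_lam (path_state_measurable t.+1).
apply: measurable_inv_fun; exact: measurable_state_lam (path_state_measurable t).
Qed.

Lemma bm_ratio t : bm (path_ratio t).
Proof.
split; first exact: measurable_path_ratio.
have [_ [C hC]] := bm_theta t.
exists ((1 + e0 / 2) * C) => w rw; rewrite ger0_norm ?path_ratio_ge0 //.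
apply: le_trans (path_ratio_le t rw) _; apply: ler_wpM2l.
  by rewrite addr_ge0 // divr_ge0.
by apply: le_trans (hC w rw); exact: ler_norm.
Qed.

(** It remains to bound (1 + e0/2) exp((2 + 2q) [lam_sum]) by 2. With del = (d - k) / d^2 <= 1/4 and
    q del = 1, the exponent is at most 3/4 ln 2 (1 + del) <= 15/16 ln 2, and e0/2 <= ln 2 / 32 fits
    in what is left. *)
Lemma expec_ratio t : e0 * eta0 <= ln 2 / 4 * ((d%:R - k%:R) / d%:R ^+ 2) ->
  E (path_ratio t) <= 2 * d%:R * eta0 * kap ^+ t.
Proof.
move=> he.
apply: (@le_trans _ _ (E (fun w : path => (1 + e0 / 2) * path_theta t w))).
  apply: (expec_le mD PD); [exact: bm_ratio|by apply: bounded_mfunZ; exact: bm_theta|].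
  by move=> w; exact: path_ratio_le.
rewrite (expecZ mD PD); last exact: bm_theta.
have c0 : 0 <= 1 + e0 / 2 by rewrite addr_ge0 // divr_ge0.
apply: le_trans (ler_wpM2l c0 (expec_theta t)) _.
have ed0 : 0 <= kap ^+ t * (d%:R * eta0).
  by rewrite mulr_ge0 ?exprn_ge0 ?mulr_ge0 // ltW // (lt_le_trans ltr01).
set Ex := expR _.
have -> : (1 + e0 / 2) * (kap ^+ t * Ex * (d%:R * eta0)) = (1 + e0 / 2) * Ex * (kap ^+ t * (d%:R * eta0)) by ring.
have -> : 2 * d%:R * eta0 * kap ^+ t = 2 * (kap ^+ t * (d%:R * eta0)) by ring.
apply: ler_wpM2r => //.
apply: (@le_trans _ _ (expR (e0 / 2) * Ex)).
  by apply: ler_wpM2r; [exact: expR_ge0|exact: expR_ge1Dx].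
rewrite /Ex -expRD -[leRHS]lnK ?posrE // ler_expR.
set del := (d%:R - k%:R) / d%:R ^+ 2 in he.
have del4 : del <= 4^-1 by exact: block_ratio_le.
have delp : 0 < del by rewrite divr_gt0 // exprn_gt0.
have qd : q * del = 1 by rewrite /q /del; field; rewrite d0 gt_eqF.
have q0 : 0 <= q by rewrite divr_ge0 ?exprn_ge0 // ltW.
have Ls := lam_sum_le eta1 e00 t.
have ln0 : 0 <= ln (2 : R) by rewrite ln_ge0 // ler1n.
have h1 : (2 + 2 * q) * lam_sum eta0 e0 t <= 15 / 16 * ln 2.
  apply: (@le_trans _ _ ((2 + 2 * q) * (3 / 2 * (ln 2 / 4 * del)))).
    apply: ler_wpM2l; first by rewrite addr_ge0 // mulr_ge0.
    apply: le_trans Ls _; apply: ler_wpM2l => //.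
  have -> : (2 + 2 * q) * (3 / 2 * (ln 2 / 4 * del)) = 3 / 4 * ln 2 * (del + q * del) by field.
  rewrite qd; have : ln (2 : R) * del <= ln 2 * 4^-1 by apply: ler_wpM2l.
  lra.
have h2 : e0 <= ln 2 / 16.
  have a1 : e0 <= e0 * eta0 by rewrite ler_peMr.
  have a2 : ln (2 : R) * del <= ln 2 * 4^-1 by apply: ler_wpM2l.
  apply: le_trans a1 _; apply: le_trans he _; lra.
lra.
Qed.

End ExpectedContraction.

(** * Transfer to the given probability space *)

Section Transfer.
Context {R : realType} {d k : nat}.
Context {disp : measure_display} {T : measurableType disp}.
Notation path := (@paths R (nat * 'I_d * 'I_k)%type).

Lemma bfgs_runE (f : 'cV[R]_d -> R) M s0 (V : nat -> 'M[R]_(d, k)) t :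
  bfgs_run f M s0 V t = qn_run (hess f) (grad f) M s0 V t.
Proof. by elim: t => //= t ->; case: (qn_run _ _ _ _ _ _). Qed.

Lemma iid_gaussian_family (P : probability T R) (U : nat -> 'I_d -> 'I_k -> {RV P >-> R}) :
  iid_gaussian_matrices U ->
  gaussian_family P (fun (p : nat * 'I_d * 'I_k) w => U p.1.1 p.1.2 p.2 w).
Proof.
move=> [law indep]; split=> [p|s B us mB]; first exact: measurable_funP.
by rewrite (indep s B us mB); apply: eq_bigr => p _; exact: law.
Qed.

(** Nonnegativity allows the change of variables and the removal of the null set of singular paths
    before any integrability is known; what remains is bounded, so its integral is finite. *)
Lemma expectation_regular (P : probability T R) (X : nat * 'I_d * 'I_k -> T -> R)
    (mX : forall p, measurable_fun setT (X p)) (h : path -> R) :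
  (k <= d)%N -> gaussian_family P X ->
  bounded_mfun regular h -> (forall w, 0 <= h w) ->
  'E_P[fun w => h (X ^~ w)]%E =
    (expec (distribution P (mfun_Sub (mem_set (measurable_path mX)))) regular h)%:E.
Proof.
move=> kd gX bh h0; have gP := gaussian_family_coord mX gX.
set Y := mfun_Sub _ in gP *.
have mEh : measurable_fun setT (EFin \o h) by apply/measurable_EFinP; exact: bh.1.
have hE0 y : (0 <= (EFin \o h) y)%E by rewrite lee_fin.
rewrite unlock; have := @ge0_integral_distribution _ _ _ _ _ P Y _ mEh hE0.
move=> <-.
rewrite (ge0_negligible_integral (measurableC (@measurable_regular R d k)) _ mEh) //; last first.
  exact: regular_null gP kd.
rewrite setTD setCK /expec /Rintegral fineK //.
apply: integrable_fin_num; first exact: measurable_regular.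
apply: bounded_mfun_integrable bh; first exact: measurable_regular.
exact: regular_prob gP kd.
Qed.

End Transfer.

Theorem theorem5p8 (R : realType) (d k : nat)
  (f : 'cV[R]_d -> R) (L mu M : R)
  (f_twice_diff : twice_differentiable f)
  (f_smooth : smooth f L)
  (f_strongly_convex : strongly_convex f mu)
  (f_self_concordant : strongly_self_concordant f M)
  (k_ge1 : (1 <= k)%N) (k_lt_d : (k < d)%N)
  (eta0 : R) (eta0_ge1 : 1 <= eta0)
  (x0 : 'cV[R]_d) (G0 L0 : 'M[R]_d)
  (G0_pd : pdmx G0)
  (x0_local : M * local_grad_norm f x0 <=
     ln 2 / 4 * ((d%:R - k%:R) / (eta0 * d%:R ^+ 2)))
  (G0_lower : loewner_le (hess f x0) G0)
  (G0_upper : loewner_le G0 (eta0 *: hess f x0))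
  (L0_scaling : invmx G0 = L0^T *m L0)
  (disp : measure_display) (T : measurableType disp) (P : probability T R)
  (U : nat -> 'I_d -> 'I_k -> {RV P >-> R})
  (U_gaussian : iid_gaussian_matrices U)
  (t : nat) :
  measurable_fun setT (gradient_ratio f M x0 G0 L0 U t) /\
  ('E_P[gradient_ratio f M x0 G0 L0 U t]
     <= (2 * d%:R * eta0 * (1 - k%:R / d%:R) ^+ t)%:E)%E.
Proof.
have gX := iid_gaussian_family U_gaussian; have [mX _] := gX.
(* Symmetry at x0 comes from that of [G0] and of G0 - hess f x0; self-concordance carries it to
   every other point. *)
have sx0 : (hess f x0)^T = hess f x0.
  have := G0_lower.1; rewrite linearB /= G0_pd.1 => /eqP.
  by rewrite (inj_eq (addrI _)) eqr_opp => /eqP.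
have pdH := hess_pd f_twice_diff f_strongly_convex f_self_concordant sx0.
have mvt := grad_mvt f_twice_diff.
pose Y := mfun_Sub (mem_set (measurable_path mX)).
have mH := @mx_measurable_hess R d f f_twice_diff _ (@paths R (nat * 'I_d * 'I_k)%type).
have mg := @mx_measurable_grad R d f f_twice_diff _ (@paths R (nat * 'I_d * 'I_k)%type).
pose s0 := BfgsState x0 G0 L0.
have M0 := f_self_concordant.1; have scH := f_self_concordant.2.
have s0_good : state_good (hess f) eta0 s0 by [].
have ratioE : gradient_ratio f M x0 G0 L0 U t =
    fun w => path_ratio (hess f) (grad f) M s0 t (fun p : nat * 'I_d * 'I_k => U p.1.1 p.1.2 p.2 w).
  by apply/funext => w; rewrite /gradient_ratio !bfgs_runE.
have mr := measurable_path_ratio M pdH mH mg s0 t.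
split.
  rewrite ratioE; exact: (measurableT_comp mr (measurable_path mX)).
rewrite ratioE.
set e0 := M * local_grad_norm f x0 in x0_local.
have eta00 : 0 < eta0 by exact: lt_le_trans ltr01 eta0_ge1.
have d0 : 0 < (d%:R : R) by rewrite ltr0n; exact: leq_ltn_trans k_lt_d.
(* The factor eta0 in the denominator of the hypothesis pays for the length of the geometric series:
   [lam_sum] is bounded by a multiple of e0 eta0. *)
have he : e0 * eta0 <= ln 2 / 4 * ((d%:R - k%:R) / d%:R ^+ 2).
  rewrite -ler_pdivlMr //; apply: le_trans x0_local _.
  by rewrite invfM mulrA -[leRHS]mulrA -!mulrA [eta0^-1 * _]mulrC.
have he16 : e0 * eta0 <= 16^-1 by apply: le_trans he _; exact: ln2_block_ratio_le.
have gP := gaussian_family_coord mX gX.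
have lam0 : M * state_lam (hess f) (grad f) s0 <= e0 by [].
have br := bm_ratio pdH M0 scH mvt mH mg eta0_ge1 s0_good lam0 he16 k_lt_d t.
rewrite (expectation_regular mX (ltnW k_lt_d) gX br) ?lee_fin; last first.
  move=> w; exact: path_ratio_ge0.
exact: expec_ratio.
Qed.
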